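(* Let $A,B\in\mathcal O$. Then the maximal stretching factor $\Lambda_R(A,B)$ is realized by an element $g\in\operatorname{Hyp}(\mathcal O)$, i.e. $\frac{l_B(g)}{l_A(g)}=\Lambda_R(A,B)$, such that the projection of $\mathrm{axis}_A(g)$ to the quotient graph $G\backslash A$ is of one of the following forms: (i) an embedded simple loop; (ii) an embedded figure-eight (a bouquet of two copies of $S^1$); (iii) an embedded barbell (two simple loops joined by a segment); (iv) an embedded singly degenerate barbell (a non-free vertex and a simple loop joined by a segment); (v) an embedded doubly degenerate barbell (two non-free vertices joined by a segment). The loops and segments in (i)–(v) may contain free and non-free vertices.
   Context: Setting. $G=G_1*\dots*G_p*F_k$, where $(G_i)_{i=1}^p$ is a finite family of groups and $F_k$ is the free group of rank $0\le k<\infty$. A simplicial metric tree is a simplicial tree (not necessarily locally compact) with a complete path metric such that edges are isometric to closed intervals of $\mathbb R$; all branch points are vertices. A $G$-tree is a simplicial metric tree on which $G$ acts simplicially by isometries. A vertex $v$ is redundant if it has degree two and every $g\in G$ fixing $v$ also fixes the edges adjacent to $v$. $\mathcal O=\mathcal O(G,(G_i)_{i=1}^p,F_k)$ is the set of $G$-trees $T$, up to $G$-equivariant isometry, such that: (C0) $T$ has no redundant vertices; (C1) the action is minimal (no proper invariant subtree), with trivial edge stabilizers; (C2) for each $i=1,\dots,p$ there is exactly one orbit of vertices with stabilizer conjugate to $G_i$; (C3) all other vertices have trivial stabilizer. A vertex is free if its stabilizer is trivial and non-free otherwise; a vertex of the (finite) quotient graph $G\backslash T$ is free or non-free according to its lifts.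 $l_T(g)=\inf_{x\in T}d_T(x,gx)$ is the translation length. An element $g$ is hyperbolic for $T$ if it fixes no point of $T$; this does not depend on $T\in\mathcal O$, and $\operatorname{Hyp}(\mathcal O)$ is the set of hyperbolic elements. A hyperbolic $g$ translates along a line $\mathrm{axis}_T(g)\subset T$. For $A,B\in\mathcal O$, $\Lambda_R(A,B)=\sup_{g\in\operatorname{Hyp}(\mathcal O)}\frac{l_B(g)}{l_A(g)}$. *)

(* Defs.v *)
From HB Require Import structures.
From mathcomp Require Import all_boot all_order all_algebra.
From mathcomp Require Import all_classical all_reals all_analysis.

Set Implicit Arguments.
Unset Strict Implicit.
Unset Printing Implicit Defensive.

Import Order.TTheory GRing.Theory Num.Theory.
Import numFieldNormedType.Exports.

Local Open Scope classical_set_scope.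
Local Open Scope ring_scope.

Notation group_hom := UMagmaMorphism.type.

(* Universal property of G = G_1 * ... * G_p * F_k, where [iota i] is the map
   G_i -> G and [x] is a basis of F_k: a homomorphism out of F_k is the same
   thing as a k-tuple of elements of the target. *)
Definition is_free_product (p k : nat) (Gi : 'I_p -> groupType) (G : groupType)
    (iota : forall i, group_hom (Gi i) G) (x : 'I_k -> G) : Prop :=
  forall (H : groupType) (f : forall i, group_hom (Gi i) H) (y : 'I_k -> H),
    exists h : group_hom G H,
      [/\ forall i a, h (iota i a) = f i a,
          forall j, h (x j) = y j
        & forall h' : group_hom G H,
            (forall i a, h' (iota i a) = f i a) ->
            (forall j, h' (x j) = y j) -> h' =1 h].

Section SimplicialTree.
Variables (R : realType) (T : metricType R) (V : set T) (E : set (set T)).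

Definition is_edge (e : set T) : Prop :=
  exists (l : R) (c : R -> T),
    [/\ 0 < l,
        {in `[0, l] &, forall s t, mdist (c s) (c t) = `|s - t|},
        e = c @` `[0, l]
      & V `&` e = [set c 0; c l]].

Definition adjacent (u v : T) : bool :=
  `[< [/\ u <> v, V u, V v & exists2 e, E e & e u /\ e v] >].

(* [path coedge x s] says that [x :: s] is a polygonal path in T. *)
Definition coedge (x y : T) : bool := `[< exists2 e, E e & e x /\ e y >].

Definition path_length (x : T) (s : seq T) : R :=
  \sum_(d <- pairmap (@mdist R T) x s) d.

(* Here a vertex is a point of T and an edge is the closed subset of T that it
   spans.  [st_tree] says that any two vertices are joined by exactly one
   simple edge path; [st_path_metric] that the distance is the infimum of the
   lengths of polygonal paths. *)
Record is_simplicial_metric_tree : Prop := {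
  st_nonempty : V !=set0;
  st_edge : forall e, E e -> is_edge e;
  st_cover : forall x, V x \/ exists2 e, E e & e x;
  st_interiors : forall e e', E e -> E e' -> e <> e' -> e `&` e' `<=` V;
  st_no_multi_edge : forall e e' u v, E e -> E e' -> V u -> V v -> u <> v ->
    e u -> e v -> e' u -> e' v -> e = e';
  st_tree : forall u v, V u -> V v ->
    exists! s : seq T, [/\ path adjacent u s, uniq (u :: s) & last u s = v];
  st_path_metric : forall x y, mdist x y =
    inf [set path_length x s | s in [set s | path coedge x s /\ last x s = y]];
  st_complete : forall F : set_system T, ProperFilter F -> cauchy F ->
    exists x : T, F --> x
}.

End SimplicialTree.

Record Gtree (R : realType) (G : groupType) := {
  gt_space :> metricType R;
  vertices : set gt_space;
  edges : set (set gt_space);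
  act : G -> gt_space -> gt_space;
  gt_tree : is_simplicial_metric_tree vertices edges;
  gt_act1 : forall x, act 1%g x = x;
  gt_actM : forall g h x, act (g * h)%g x = act g (act h x);
  gt_isometry : forall g x y, mdist (act g x) (act g y) = mdist x y;
  gt_vertices : forall g v, vertices v -> vertices (act g v);
  gt_edges : forall g e, edges e -> edges (act g @` e)
}.

Arguments vertices {R G} _ _.
Arguments edges {R G} _ _.
Arguments act {R G _} _ _.

Section GTrees.
Variables (R : realType) (G : groupType) (T : Gtree R G).

(* Setwise; so a trivial edge stabilizer also excludes edge inversions. *)
Definition edge_stabilizer (e : set T) : set G := [set g | act g @` e = e].

Definition stabilizer (x : T) : set G := [set g | act g x = x].

Definition edges_at (v : T) : set (set T) := [set e | edges T e /\ e v].

Definition redundant (v : T) : Prop :=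
  [/\ vertices T v, (edges_at v #= `I_2)%card
    & forall g, stabilizer v g ->
        forall e, edges_at v e -> edge_stabilizer e g].

Definition minimal_action : Prop :=
  forall S : set T, S !=set0 -> connected S ->
    (forall g x, S x -> S (act g x)) -> S = setT.

Definition hyperbolic (g : G) : Prop := forall x : T, act g x <> x.

Definition translation_length (g : G) : R :=
  inf [set mdist x (act g x) | x in [set: T]].

(* L is a line of T on which g acts as a nontrivial translation. *)
Definition is_axis (g : G) (L : set T) : Prop :=
  exists (c : R -> T) (tau : R),
    [/\ 0 < tau,
        forall s t, mdist (c s) (c t) = `|s - t|,
        L = range c
      & forall t, act g (c t) = c (t + tau)].

End GTrees.

Definition conjugate_sets (G : groupType) (H K : set G) : Prop :=
  exists h : G, K = [set (a ^ h)%g | a in H].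

Record in_outer_space (R : realType) (p : nat) (Gi : 'I_p -> groupType)
    (G : groupType) (iota : forall i, group_hom (Gi i) G) (T : Gtree R G)
    : Prop := {
  os_C0 : forall v : T, ~ redundant v;
  os_C1_minimal : minimal_action T;
  os_C1_edges : forall e, edges T e -> edge_stabilizer e = [set 1%g];
  os_C2 : forall i, exists v : T,
    [/\ vertices T v, conjugate_sets (range (iota i)) (stabilizer v)
      & forall w : T, vertices T w ->
          conjugate_sets (range (iota i)) (stabilizer w) ->
          exists g, act g v = w];
  os_C3 : forall v : T, vertices T v ->
    (forall i, ~ conjugate_sets (range (iota i)) (stabilizer v)) ->
    stabilizer v = [set 1%g]
}.

(* Elements without fixed points in some tree of the outer space; which tree
   is used does not matter. *)
Definition Hyp (R : realType) (p : nat) (Gi : 'I_p -> groupType)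
    (G : groupType) (iota : forall i, group_hom (Gi i) G) : set G :=
  [set g | exists T : Gtree R G, in_outer_space iota T /\ hyperbolic T g].

(* An [\bar R]-valued supremum, so that unboundedness is not hidden. *)
Definition stretch (R : realType) (p : nat) (Gi : 'I_p -> groupType)
    (G : groupType) (iota : forall i, group_hom (Gi i) G) (A B : Gtree R G)
    : \bar R :=
  ereal_sup [set (translation_length B g / translation_length A g)%:E
            | g in Hyp R iota].

Section QuotientGraph.
Variables (R : realType) (G : groupType) (T : Gtree R G).

Definition same_orbit (x y : T) : bool := `[< exists g, act g x = y >].

Lemma same_orbit_refl : reflexive same_orbit.
Proof. by move=> x; apply/asboolP; exists 1%g; rewrite gt_act1. Qed.

Lemma same_orbit_sym : symmetric same_orbit.
Proof.
have H x y : same_orbit x y -> same_orbit y x.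
  move=> /asboolP[g <-]; apply/asboolP; exists g^-1%g.
  by rewrite -gt_actM mulVg gt_act1.
by move=> x y; apply/idP/idP; exact: H.
Qed.

Lemma same_orbit_trans : transitive same_orbit.
Proof.
move=> y x z /asboolP[g <-] /asboolP[h <-]; apply/asboolP.
by exists (h * g)%g; rewrite gt_actM.
Qed.

Canonical same_orbit_equiv :=
  EquivRel same_orbit same_orbit_refl same_orbit_sym same_orbit_trans.

Definition quotient_graph := quotient_topology {eq_quot same_orbit}%qT.

Definition orbit_proj (x : T) : quotient_graph :=
  (\pi_{eq_quot same_orbit} x)%qT.

Definition nonfree_vertex (q : quotient_graph) : Prop :=
  exists v : T, [/\ vertices T v, stabilizer v <> [set 1%g] & orbit_proj v = q].

End QuotientGraph.

Arguments nonfree_vertex {R G} T _.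

(* Subspaces of a Hausdorff space [X]; there, an injective continuous image of
   a circle or of a compact interval is an embedded one. *)
Section Shapes.
Variables (R : realType) (X : topologicalType).
Implicit Types (S L I : set X) (a b : X).

Definition simple_loop L : Prop :=
  exists c : R -> X,
    [/\ {within `[0, 1], continuous c}, c 0 = c 1, set_inj `[0, 1[ c
      & L = c @` `[0, 1]].

Definition segment I a b : Prop :=
  exists c : R -> X,
    [/\ {within `[0, 1], continuous c}, set_inj `[0, 1] c, c 0 = a, c 1 = b
      & I = c @` `[0, 1]].

Definition figure_eight S : Prop :=
  exists L1 L2 a,
    [/\ simple_loop L1, simple_loop L2, L1 `&` L2 = [set a]
      & S = L1 `|` L2].

Definition barbell S : Prop :=
  exists L1 L2 I a b,
    [/\ simple_loop L1 /\ simple_loop L2, L1 `&` L2 = set0, segment I a b,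
        L1 `&` I = [set a] /\ L2 `&` I = [set b]
      & S = L1 `|` I `|` L2].

Definition singly_degenerate_barbell (nonfree : set X) S : Prop :=
  exists L I a b,
    [/\ simple_loop L, segment I a b, nonfree a, L `&` I = [set b]
      & S = L `|` I].

Definition doubly_degenerate_barbell (nonfree : set X) S : Prop :=
  exists a b, [/\ segment S a b, nonfree a & nonfree b].

End Shapes.

(* Main.v *)
Require Import Defs.
From HB Require Import structures.
From mathcomp Require Import all_boot all_order all_algebra.
From mathcomp Require Import all_classical all_reals all_analysis.
From mathcomp Require Import lra.

(* Choose an equivariant map f : A -> B, defined on vertices, whose maximal
   stretching factor r on edges is minimal; it exists because, up to finitely
   many combinatorial types, the images are coordinatized by a compact box on
   which the stretched lengths are maxima of affine functions.  Among these
   maps take one with the fewest edges stretched by exactly r (tense edges).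
   Then at every free vertex the tense edges leave in at least two gates
   (directions that f identifies): otherwise pushing the image of the vertex
   into the single gate would relax all of them.  At a nonfree vertex a
   nontrivial stabilizer element moves every gate off itself.  Every
   translation length satisfies l_B <= r l_A, and a periodic path of tense
   edges that never turns inside a gate is stretched by exactly r.  A walk that
   turns legally and is stopped when it meets a nonfree vertex or repeats an
   orbit, followed if necessary by a second walk leaving the resulting loop
   through another gate, produces such a path of one of the five shapes. *)

Set Implicit Arguments.
Unset Strict Implicit.
Unset Printing Implicit Defensive.

Import Order.TTheory GRing.Theory Num.Theory.
Import numFieldNormedType.Exports.

Local Open Scope classical_set_scope.
Local Open Scope ring_scope.

(** * Four-point metric spaces *)

(** A map is only ever a function on vertices; it is never extended over edges. Directions and gates
    therefore have to be read off from the images of neighbouring vertices, and the metric relation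
    [between] replaces germs of paths: a turn is legal when the image of its corner is between the
    images of its two far ends. Under the four-point inequality such local conditions propagate
    along a whole path, so a legal path is geodesic in A and its image is geodesic in B. Applied to
    a path followed by its translate under g, this exhibits g as a translation of both trees at
    once, with lengths in ratio r. The main obstacle is that A and B may be locally infinite, so
    compactness has to come from the group. The universal property of the free product and
    minimality give finitely many orbits of edges; hence the stretching factor is a finite maximum,
    and vertex distances up to a given bound take finitely many values. A hyperbolic element
    excludes r = 0: otherwise all of G would fix a point of B, and then a point of every other tree
    of the outer space. *)

Section Hyperbolic.
Variables (R : realType) (T : metricType R).
Local Notation d := (@mdist R T).

Lemma mdistC x y : d x y = d y x. Proof. exact: metric_sym. Qed.
Lemma mdist_triangle y x z : d x z <= d x y + d y z. Proof. exact: metric_triangle. Qed.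
Lemma mdist_nneg x y : 0 <= d x y. Proof. exact: mdist_ge0. Qed.
Lemma mdist_refl x : d x x = 0. Proof. exact: mdistxx. Qed.
Lemma mdist_eq0 x y : d x y = 0 -> x = y. Proof. exact: mdist_positivity. Qed.

Definition between (x y z : T) : Prop := d x z = d x y + d y z.

(** Gromov's 0-hyperbolicity. With [geodesic] it describes real trees, and the arguments on paths
    and axes below rest on these two metric properties. *)
Definition four_point : Prop := forall x y z w,
  d x y + d z w <= d x z + d y w \/ d x y + d z w <= d x w + d y z.

Definition geodesic : Prop := forall x y t, 0 <= t <= d x y ->
  exists2 z, d x z = t & between x z y.

Lemma between_sym x y z : between x y z -> between z y x.
Proof.
by rewrite /between => H; rewrite mdistC H addrC (mdistC y x) (mdistC z y).
Qed.

Lemma between_refl x y : between x x y.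
Proof. by rewrite /between mdist_refl add0r. Qed.

Lemma between_reflr x y : between x y y.
Proof. by rewrite /between mdist_refl addr0. Qed.

Lemma mdist_eq0P x y : d x y = 0 <-> x = y.
Proof. by split=> [/mdist_eq0|->]//; rewrite mdist_refl. Qed.

Lemma between_transr x y z w : between x z w -> between x y z -> between x y w.
Proof.
rewrite /between => H1 H2.
by have := mdist_triangle y x w; have := mdist_triangle z y w; lra.
Qed.

Hypothesis T4 : four_point.

(* Two directions at [o] are in the same gate when [o] is not between them;
   this says that being in the same gate is transitive. *)
Lemma between_gate o x y z : between x o z -> between x o y \/ between y o z.
Proof.
rewrite /between => H.
have := mdist_triangle o x y; have := mdist_triangle o y z.
have [H1|H1] := T4 x z o y.
  by right; move: H1; rewrite H (mdistC z y) (mdistC o y); lra.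
by left; move: H1; rewrite H (mdistC z o); lra.
Qed.

Lemma between_uniq u v y y' : between u y v -> between u y' v -> d u y = d u y' ->
  y = y'.
Proof.
rewrite /between => H1 H2 H3; apply/mdist_eq0P.
have := mdist_nneg y y'.
have := T4 y y' u v; rewrite (mdistC y u) (mdistC y' u).
by case; lra.
Qed.

(** [p], [q], [y] span a tripod and [x] lies on its side from [p] to [q], so the geodesic to [y]
    from at least one of [p], [q] runs through [x]. *)
Lemma between_dist p q x y : between p x q ->
  d x y = d p y - d p x \/ d x y = d q y - d q x.
Proof.
rewrite /between => H.
have := mdist_triangle x p y; have := mdist_triangle x q y.
have := T4 x y p q; rewrite (mdistC x p) (mdistC x q) (mdistC y q).
rewrite (mdistC y p); rewrite (mdistC x q) in H.
by case; [right|left]; lra.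
Qed.

(** Since [d p x] and [d q x] are affine in the position of [x] on its segment, this is the source
    of the maxima of affine functions in the minimization of the stretching factor. *)
Lemma between_dist_max p q x y : between p x q ->
  d x y = Num.max (d p y - d p x) (d q y - d q x).
Proof.
move=> H; have := mdist_triangle x p y; have := mdist_triangle x q y.
case: (between_dist y H) => H1; case: (leP (d p y - d p x) (d q y - d q x)); lra.
Qed.

(** At [z] the point [x] lies in the gate of [y], because [y] is on the way from [x] to [z] and
    differs from [z]; [w] lies in another gate. *)
Lemma between_insert x y z w : y <> z -> between x y z -> between y z w ->
  between x z w.
Proof.
move=> yz xyz yzw; have [xzy|//] := between_gate x yzw.
  case: yz; apply/mdist_eq0P; move: xyz (between_sym xzy); rewrite /between.
  by rewrite (mdistC z y); have := mdist_nneg y z; have := mdistC z x; lra.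
Qed.

Section LocalToGlobal.

Definition turns (e e' : T * T) : bool :=
  `[< e.2 = e'.1 /\ between e.1 e.2 e'.2 >].

Definition elen (e : T * T) : R := d e.1 e.2.

(** Local geodesics in a tree are global ones. The induction also carries the betweenness of the
    last vertex but one, which is what [between_insert] needs to append an edge. *)
Lemma turns_path e es : e.1 <> e.2 -> (forall e', e' \in es -> e'.1 <> e'.2) ->
  path turns e es ->
  d e.1 (last e es).2 = \sum_(e' <- e :: es) elen e' /\
  between e.1 (last e es).1 (last e es).2.
Proof.
move=> e12; elim/last_ind: es => [|es a IH] aes.
  by move=> _; rewrite big_seq1; split=> //; exact: between_refl.
rewrite rcons_path last_rcons => /andP[/IH[|IH1 IH2]].
  by move=> e' e'es; apply: aes; rewrite mem_rcons inE e'es orbT.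
move=> /asboolP[la1 la2].
have bt : between e.1 a.1 a.2.
  rewrite -la1 in la2 *; apply: between_insert IH2 la2.
  have := mem_last e es; rewrite inE => /orP[/eqP->//|H].
  by apply: aes; rewrite mem_rcons inE H orbT.
split=> //; rewrite -cats1 -cat_cons big_cat big_seq1/= -IH1.
by rewrite la1; exact: bt.
Qed.

End LocalToGlobal.
End Hyperbolic.

Section GeodesicParametrization.
Variables (R : realType) (T : metricType R).
Local Notation d := (@mdist R T).
Hypotheses (T4 : four_point T) (Tg : geodesic T).

Lemma between_dist_norm u v y z : between u y v -> between u z v ->
  d y z = `|d u y - d u z|.
Proof.
move=> H1 H2; rewrite (between_dist_max T4 z H1).
have -> : d v z - d v y = d u y - d u z.
  by move: H1 H2; rewrite /between (mdistC v z) (mdistC v y); lra.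
case: (leP (d u z - d u y) (d u y - d u z)) => H.
  by rewrite ger0_norm; lra.
by rewrite ltr0_norm; lra.
Qed.

Lemma geodesic_param u v : exists c : R -> T,
  [/\ c 0 = u, c (d u v) = v,
    {in `[0, d u v] &, forall s t, d (c s) (c t) = `|s - t|}
    & [set y | between u y v] = c @` `[0, d u v]].
Proof.
have /choice[c Hc] t : exists y, 0 <= t <= d u v -> d u y = t /\ between u y v.
  case: (boolP (0 <= t <= d u v)) => [/Tg[y H1 H2]|_]; last by exists u.
  by exists y.
have d0uv : 0 <= d u v by exact: mdist_nneg.
exists c; split.
- by have [|/mdist_eq0//] := Hc 0; rewrite lexx d0uv.
- have [|H1 H2] := Hc (d u v); first by rewrite lexx d0uv.
  apply: (between_uniq T4 H2 (between_reflr _ _)); exact: H1.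
- move=> s t; rewrite !in_itv/= => /Hc[sE sb] /Hc[tE tb].
  by rewrite (between_dist_norm sb tb) sE tE.
- apply/seteqP; split=> [y/= yb|z /= [t tI <-]].
    exists (d u y); rewrite /= ?in_itv/=.
      by rewrite mdist_nneg/= (yb : _ = _); have := mdist_nneg y v; lra.
    have [|H1 H2] := Hc (d u y).
      by rewrite mdist_nneg/= (yb : _ = _); have := mdist_nneg y v; lra.
    exact: (between_uniq T4 H2 yb).
  by move: tI; rewrite in_itv/= => /Hc[].
Qed.

End GeodesicParametrization.

(** * Translations, their lengths and their axes *)

Section Axis.
Variables (R : realType) (G : groupType) (T : Gtree R G).
Local Notation d := (@mdist R T).
Implicit Types (g : G) (x y : T).

Lemma actK g x : act g^-1 (act g x) = x.
Proof. by rewrite -gt_actM mulVg gt_act1. Qed.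

Lemma actVK g x : act g (act g^-1 x) = x.
Proof. by rewrite -gt_actM mulgV gt_act1. Qed.

Lemma act_between g x y z : between (act g x) (act g y) (act g z) <-> between x y z.
Proof. by rewrite /between !gt_isometry. Qed.

Lemma act_inj g x y : act g x = act g y -> x = y.
Proof. by move=> /(congr1 (act g^-1)); rewrite !actK. Qed.

Lemma mdist_expg_le g y n : d y (act (g ^+ n)%g y) <= n%:R * d y (act g y).
Proof.
elim: n => [|n IH]; first by rewrite expg0 gt_act1 mdist_refl mul0r.
rewrite expgSr gt_actM.
have := mdist_triangle (act (g ^+ n)%g y) y (act (g ^+ n)%g (act g y)).
by rewrite gt_isometry mulrSr mulrDl mul1r; move: IH; lra.
Qed.

Lemma translation_length_le g x : translation_length T g <= d x (act g x).
Proof.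
apply: ge_inf; last by exists x.
by exists 0 => _ [y _ <-]; exact: mdist_nneg.
Qed.

Lemma translation_length_ge g tau :
  (forall y, tau <= d y (act g y)) -> tau <= translation_length T g.
Proof.
move=> H; apply: lb_le_inf; last by move=> _ [y _ <-].
by have [v _] := st_nonempty (gt_tree T); exists (d v (act g v)), v.
Qed.

(** For any [y], n tau <= 2 d(x, y) + n d(y, g y), and letting n grow gives tau <= d(y, g y). In the
    proof [n] is chosen past the quotient of 2 d(x, y) by the supposed defect. *)
Lemma translation_length_expg g x tau :
  (forall n, d x (act (g ^+ n)%g x) = n%:R * tau) ->
  translation_length T g = tau /\ forall y, tau <= d y (act g y).
Proof.
move=> H.
have H2 y : tau <= d y (act g y).
  rewrite leNgt; apply/negP => lt.
  have t0 : 0 < tau - d y (act g y) by lra.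
  pose n := (Num.truncn (2 * d x y / (tau - d y (act g y)))).+1.
  have : 2 * d x y / (tau - d y (act g y)) < n%:R by exact: truncnS_gt.
  rewrite ltr_pdivrMr// => Hn.
  have := mdist_expg_le g y n.
  have := H n; have := mdist_triangle y x (act (g ^+ n)%g x).
  have := mdist_triangle (act (g ^+ n)%g y) y (act (g ^+ n)%g x).
  by rewrite gt_isometry (mdistC y x) => *; lra.
split=> //; apply/le_anti/andP; split; last exact: translation_length_ge.
have := H 1%N; rewrite expg1 mul1r => <-; exact: translation_length_le.
Qed.

Hypotheses (T4 : four_point T) (Tg : geodesic T).

Section Translation.
Variables (g : G) (x : T).
Let tau := d x (act g x).
Implicit Types (s t : R) (n m : nat).
Hypotheses (tau_gt0 : 0 < tau) (gx : between x (act g x) (act g (act g x))).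

Lemma expg_between n : between x (act (g ^+ n)%g x) (act (g ^+ n.+1)%g x).
Proof.
elim: n => [|n IH]; first by rewrite expg0 gt_act1; exact: between_refl.
apply: (between_insert T4 _ IH); last first.
  by rewrite !expgSr !gt_actM !act_between.
move=> /eqP; apply/negP; rewrite expgSr gt_actM -mdist_gt0 gt_isometry.
exact: tau_gt0.
Qed.

Lemma expg_dist n : d x (act (g ^+ n)%g x) = n%:R * tau.
Proof.
elim: n => [|n IH]; first by rewrite expg0 gt_act1 mdist_refl mul0r.
rewrite (expg_between n : _ = _) IH expgSr gt_actM gt_isometry.
by rewrite mulrSr mulrDl mul1r.
Qed.

(** [y] is the point at signed position [t] on the axis through [x], described by its distances to
    g^-n x and g^n x. Quantifying over all large [n] makes the description independent of the
    window. *)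
Let on_axis t y := forall n, `|t| <= n%:R * tau ->
  d (act (g ^- n)%g x) y = n%:R * tau + t /\ d y (act (g ^+ n)%g x) = n%:R * tau - t.

Let ends_dist n : d (act (g ^- n)%g x) (act (g ^+ n)%g x) = 2 * (n%:R * tau).
Proof.
rewrite -(gt_isometry (g ^+ n)%g) actVK -gt_actM -expgnDr expg_dist.
by rewrite natrD; lra.
Qed.

Let bound t : exists n : nat, `|t| <= n%:R * tau.
Proof.
exists (Num.truncn (`|t| / tau)).+1; rewrite -ler_pdivrMr//.
by apply/ltW; exact: truncnS_gt.
Qed.

Let on_axis_uniq t y z : on_axis t y -> on_axis t z -> y = z.
Proof.
move=> Hy Hz; have [n tn] := bound t.
have [y1 y2] := Hy n tn; have [z1 z2] := Hz n tn.
apply: (between_uniq T4 (u := act (g ^- n)%g x) (v := act (g ^+ n)%g x)).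
- by rewrite /between ends_dist y1 y2; lra.
- by rewrite /between ends_dist z1 z2; lra.
- by rewrite y1 z1.
Qed.

Let expg_gap n m : (n <= m)%N ->
  d (act (g ^+ n)%g x) (act (g ^+ m)%g x) = (m%:R - n%:R) * tau.
Proof.
move=> nm; have -> : (g ^+ m = g ^+ n * g ^+ (m - n))%g.
  by rewrite -expgnDr subnKC.
by rewrite gt_actM gt_isometry expg_dist natrB.
Qed.

Let expg_gapV n m : (n <= m)%N ->
  d (act (g ^- m)%g x) (act (g ^- n)%g x) = (m%:R - n%:R) * tau.
Proof.
move=> nm; rewrite -(gt_isometry (g ^+ m)%g) actVK.
have -> : (g ^+ m = g ^+ (m - n) * g ^+ n)%g by rewrite -expgnDr subnK.
by rewrite gt_actM actVK expg_dist natrB.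
Qed.

(** One window determines all the others: a larger one by the triangle inequality, a smaller one
    because its ends lie on the same segment as [y]. *)
Let on_axis_of n t y : `|t| <= n%:R * tau ->
  d (act (g ^- n)%g x) y = n%:R * tau + t ->
  d y (act (g ^+ n)%g x) = n%:R * tau - t -> on_axis t y.
Proof.
move=> tn y1 y2 m tm.
have [nm|/ltnW mn] := leqP n m.
  have := mdist_triangle (act (g ^- n)%g x) (act (g ^- m)%g x) y.
  have := mdist_triangle (act (g ^+ n)%g x) y (act (g ^+ m)%g x).
  have := mdist_triangle y (act (g ^- m)%g x) (act (g ^+ m)%g x).
  by rewrite ends_dist (expg_gap nm) (expg_gapV nm); split; lra.
move: tm; rewrite ler_norml => tm.
have := between_dist_max T4 y (p := act (g ^- n)%g x) (q := act (g ^+ n)%g x).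
move=> H.
have H1 : between (act (g ^- n)%g x) (act (g ^- m)%g x) (act (g ^+ n)%g x).
  rewrite /between ends_dist (expg_gapV mn) -(gt_isometry (g ^+ m)%g) actVK.
  by rewrite -gt_actM -expgnDr expg_dist natrD; lra.
have H2 : between (act (g ^- n)%g x) (act (g ^+ m)%g x) (act (g ^+ n)%g x).
  rewrite /between ends_dist (expg_gap mn).
  rewrite -(gt_isometry (g ^+ n)%g) actVK -gt_actM -expgnDr expg_dist natrD.
  lra.
have Y : between (act (g ^- n)%g x) y (act (g ^+ n)%g x).
  by rewrite /between ends_dist y1 y2; lra.
rewrite (between_dist_norm T4 H1 Y) (between_dist_norm T4 Y H2) y1.
have := H2; rewrite /between ends_dist (expg_gap mn) (expg_gapV mn) => E.
have -> : d (act (g ^- n)%g x) (act (g ^+ m)%g x) = (n%:R + m%:R) * tau by lra.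
by split; rewrite ler0_norm; lra.
Qed.

(** The segment from [x] to g x is a fundamental domain: it lies in the axis, and every point of the
    axis can be carried into it by the group. So the two have the same projection to the
    quotient. *)
Lemma axis_of_translation : exists L : set T,
  [/\ is_axis g L, forall y, between x y (act g x) -> L y
    & forall y, L y -> exists h : G, between x (act h y) (act g x)].
Proof.
have /choice[c Hc] t : exists y, on_axis t y.
  have [n tn] := bound t; have := tn; rewrite ler_norml => tn'.
  have [|y y1 y2] := Tg (x := act (g ^- n)%g x) (y := act (g ^+ n)%g x)
    (t := n%:R * tau + t); first by rewrite ends_dist; lra.
  exists y; apply: (on_axis_of tn y1).
  by move: y2; rewrite /between ends_dist y1; lra.
have cg t : act g (c t) = c (t + tau).
  apply: (on_axis_uniq (t := t + tau)); last exact: Hc.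
  have [n tn] := bound t.
  (* In the window n+1 the distances of g (c t) to the two ends come from those of c t in the
     windows n+2 and n, since g carries g^-(n+2) x to g^-(n+1) x and g^n x to g^(n+1) x. *)
  have tS : `|t| <= n.+2%:R * tau.
    by move: tn; rewrite !mulrSr => tn; have := tau_gt0; lra.
  have tS1 : `|t| <= n%:R * tau by [].
  have [y1 y2] := Hc t n.+2 tS; have [z1 z2] := Hc t n tn.
  have tS' : `|t + tau| <= n.+1%:R * tau.
    move: tn; rewrite !ler_norml mulrSr => tn; have := tau_gt0; lra.
  apply: (on_axis_of tS').
    rewrite -(gt_isometry g^-1%g) actK -gt_actM -invgM -expgSr y1.
    by rewrite !mulrSr; lra.
  by rewrite expgS gt_actM gt_isometry z2 mulrSr; lra.
have cgn n t : act (g ^+ n)%g (c t) = c (t + n%:R * tau).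
  elim: n t => [|n IH] t; first by rewrite expg0 gt_act1 mul0r addr0.
  by rewrite expgS gt_actM IH cg mulrSr; congr c; lra.
have cI s t : d (c s) (c t) = `|s - t|.
  have [n] := bound (Num.max `|s| `|t|).
  have -> : `|Num.max `|s| `|t| | = Num.max `|s| `|t|.
    by apply/normr_idP; rewrite le_max normr_ge0.
  rewrite ge_max => /andP[sn tn].
  have [s1 s2] := Hc s n sn; have [t1 t2] := Hc t n tn.
  rewrite (between_dist_norm T4 (u := act (g ^- n)%g x) (v := act (g ^+ n)%g x)).
  - by rewrite s1 t1; congr (`|_|); lra.
  - by rewrite /between ends_dist s1 s2; lra.
  - by rewrite /between ends_dist t1 t2; lra.
have c0 : c 0 = x.
  have [] := Hc 0 0%N; first by rewrite normr0 mul0r.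
  by rewrite expg0 invg1 gt_act1 mul0r addr0 => /mdist_eq0.
have ctau : c tau = act g x by rewrite -c0 cg add0r.
have cseg t : 0 <= t <= tau -> between x (c t) (act g x).
  move=> /andP[t0 t1]; rewrite /between -ctau -c0 !cI !sub0r !normrN.
  by rewrite (distrC t) !ger0_norm//; lra.
exists (range c); split.
- by exists c, tau.
- move=> y xy; exists (d x y) => //.
  apply: (between_uniq T4 (u := x) (v := act g x)) => //; last first.
    by rewrite -{1}c0 cI sub0r normrN ger0_norm// mdist_nneg.
  by apply: cseg; rewrite mdist_nneg/= /tau (xy : _ = _);
    have := mdist_nneg y (act g x); lra.
- move=> _ [t _ <-].
  have [n tn] := bound t.
  have t0 : 0 <= t + n%:R * tau by move: tn; rewrite ler_norml; lra.
  set m := Num.truncn ((t + n%:R * tau) / tau).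
  have /truncn_itv : 0 <= (t + n%:R * tau) / tau by rewrite divr_ge0// ltW.
  rewrite -/m ler_pdivlMr// ltr_pdivrMr// => /andP[m1 m2].
  exists ((g ^- m) * g ^+ n)%g; rewrite gt_actM cgn.
  have -> : t + n%:R * tau = (t + n%:R * tau - m%:R * tau) + m%:R * tau by lra.
  by rewrite -cgn actK; apply: cseg; move: m2; rewrite mulrSr; lra.
Qed.

Lemma translation_length_translation : translation_length T g = tau.
Proof. by have [] := translation_length_expg expg_dist. Qed.

Lemma hyperbolic_translation : hyperbolic T g.
Proof.
move=> y /(congr1 (d y)); rewrite mdist_refl => H.
by have [_ /(_ y)] := translation_length_expg expg_dist; rewrite H leNgt tau_gt0.
Qed.

End Translation.
End Axis.

(** * Simplicial metric trees *)

Section Tree.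
Variables (R : realType) (T : metricType R) (V : set T) (E : set (set T)).
Hypothesis tr : is_simplicial_metric_tree V E.
Local Notation d := (@mdist R T).
Local Notation adj := (Defs.adjacent V E).
Implicit Types (x y z u v w p q : T) (s : seq T) (e : set T).

Definition spans e u v : Prop := [/\ u <> v, V u, V v, E e & e u /\ e v].

Lemma spans_sym e u v : spans e u v -> spans e v u.
Proof. by case=> uv Vu Vv Ee [eu ev]; split=> // vu; apply: uv. Qed.

Lemma edge_spans e : E e -> exists u v, spans e u v.
Proof.
move=> Ee; have [l [c [l0 cI eE Ve]]] := st_edge tr Ee.
have [H0 Hl] : [/\ 0 \in `[0, l] & l \in `[0, l]].
  by split; rewrite in_itv/= lexx (ltW l0).
have : [set c 0; c l] (c 0) /\ [set c 0; c l] (c l) by split; [left|right].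
rewrite -Ve => -[[V0 e0] [Vl el]].
exists (c 0), (c l); split=> // /(congr1 (d (c 0))).
by rewrite mdist_refl cI// sub0r normrN gtr0_norm// => ll; move: l0;
  rewrite -ll ltxx.
Qed.

(** The parametrization of an edge has an arbitrary direction; everything is restated in terms of
    the distance to the chosen end [u], so that the ends can be exchanged freely. *)
Lemma spansP e u v : spans e u v ->
  [/\ forall w, V w -> e w -> w = u \/ w = v,
    forall y z, e y -> e z -> d y z = `|d u y - d u z|,
    forall y, e y -> between u y v
    & forall t, 0 <= t <= d u v -> exists2 y, e y & d u y = t].
Proof.
case=> uv Vu Vv Ee [eu ev]; have [l [c [l0 cI eE Ve]]] := st_edge tr Ee.
have [H0 Hl] : [/\ 0 \in `[0, l] & l \in `[0, l]].
  by split; rewrite in_itv/= lexx (ltW l0).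
have uI : [set c 0; c l] u by rewrite -Ve.
have vI : [set c 0; c l] v by rewrite -Ve.
have split2 w : V w -> e w -> w = c 0 \/ w = c l.
  by move=> Vw ew; have : [set c 0; c l] w by rewrite -Ve.
have cpt y : e y -> exists2 t, t \in `[0, l] & y = c t.
  by rewrite eE => -[t tI <-]; exists t.
have [[uE vE]|[uE vE]] : u = c 0 /\ v = c l \/ u = c l /\ v = c 0.
  case: uI => [u0|ul]; case: vI => [v0|vl].
  - by case: uv; rewrite u0 v0.
  - by left.
  - by right.
  - by case: uv; rewrite ul vl.
- have ud t : t \in `[0, l] -> d u (c t) = t.
    move=> tI; rewrite uE cI// sub0r normrN ger0_norm//.
    by move: tI; rewrite in_itv/= => /andP[].
  split.
  + by move=> w Vw ew; rewrite uE vE; exact: split2.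
  + by move=> _ _ /cpt[s sI ->] /cpt[t tI ->]; rewrite !ud// cI.
  + move=> _ /cpt[t tI ->]; rewrite /between vE !ud// cI//.
    by move: tI; rewrite in_itv/= distrC => tI; rewrite ger0_norm; lra.
  + rewrite vE ud// => t tI; have tI' : t \in `[0, l] by rewrite in_itv.
    by exists (c t); rewrite ?ud// eE; exists t.
- have ud t : t \in `[0, l] -> d u (c t) = l - t.
    move=> tI; rewrite uE cI// ger0_norm//.
    by move: tI; rewrite in_itv/= subr_ge0 => /andP[].
  split.
  + by move=> w Vw ew; rewrite uE vE; case: (split2 w Vw ew); [right|left].
  + move=> _ _ /cpt[s sI ->] /cpt[t tI ->]; rewrite !ud// cI// distrC.
    by congr (`|_|); lra.
  + move=> _ /cpt[t tI ->]; rewrite /between vE !ud// cI//.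
    by move: tI; rewrite in_itv/= => tI; rewrite ger0_norm; lra.
  + rewrite vE ud// => t tI.
    have tI' : l - t \in `[0, l] by rewrite in_itv/=; lra.
    by exists (c (l - t)); rewrite ?ud//; [rewrite eE; exists (l - t)|lra].
Qed.

Lemma adjP u v : reflect (exists e, spans e u v) (adj u v).
Proof.
apply: (iffP idP) => [/asboolP[uv Vu Vv [e Ee uve]]|[e [uv Vu Vv Ee uve]]].
  by exists e.
by apply/asboolP; split=> //; exists e.
Qed.

Lemma adj_sym u v : adj u v -> adj v u.
Proof. by move=> /adjP[e /spans_sym ?]; apply/adjP; exists e. Qed.

Lemma adj_neq u v : adj u v -> u <> v. Proof. by move=> /asboolP[]. Qed.

Lemma adj_gt0 u v : adj u v -> 0 < d u v.
Proof. by move=> /adj_neq/eqP; rewrite mdist_gt0. Qed.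

Lemma adj_V u v : adj u v -> V u /\ V v. Proof. by move=> /asboolP[]. Qed.

Lemma path_V u s w : V u -> path adj u s -> w \in u :: s -> V w.
Proof.
elim: s u => [|a s IH] u Vu /=; first by rewrite inE => _ /eqP->.
move=> /andP[/adj_V[_ Va] ps]; rewrite inE => /orP[/eqP->//|].
exact: IH.
Qed.

Lemma path_length_cat u s1 s2 :
  path_length u (s1 ++ s2) = path_length u s1 + path_length (last u s1) s2.
Proof. by rewrite /path_length pairmap_cat big_cat. Qed.

Lemma path_length_cons u v s : path_length u (v :: s) = d u v + path_length v s.
Proof. by rewrite /path_length/= big_cons. Qed.

Lemma path_length_rcons u s v :
  path_length u (rcons s v) = path_length u s + d (last u s) v.
Proof. by rewrite -cats1 path_length_cat path_length_cons /path_length big_nil addr0. Qed.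

Lemma path_length_ge0 u s : 0 <= path_length u s.
Proof.
elim: s u => [|v s IH] u; first by rewrite /path_length big_nil.
by rewrite path_length_cons addr_ge0// mdist_nneg.
Qed.

Lemma dist_le_path_length u s : d u (last u s) <= path_length u s.
Proof.
elim: s u => [|v s IH] u; first by rewrite /path_length big_nil mdist_refl.
rewrite path_length_cons /=; apply: (le_trans (mdist_triangle v _ _)).
by rewrite lerD2l.
Qed.

Definition simple_path u s v : Prop := [/\ path adj u s, uniq (u :: s) & last u s = v].

Lemma simple_path_exists u v : V u -> V v -> exists s, simple_path u s v.
Proof. by move=> Vu Vv; have [s [H _]] := st_tree tr Vu Vv; exists s. Qed.

Lemma simple_path_uniq u v s1 s2 : V u -> V v ->
  simple_path u s1 v -> simple_path u s2 v -> s1 = s2.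
Proof.
by move=> Vu Vv; have [s [_ H]] := st_tree tr Vu Vv => /H <- /H <-.
Qed.

Lemma simple_path_nil u : simple_path u [::] u. Proof. by []. Qed.

Lemma simple_path_prefix u s1 s2 v :
  simple_path u (s1 ++ s2) v -> simple_path u s1 (last u s1).
Proof.
case; rewrite cat_path -cat_cons cat_uniq => /andP[p1 _] /andP[u1 _] _.
by split.
Qed.

(** [D], the length of the simple path from [u], grows by at most the length of an edge along that
    edge: the edge either prolongs the simple path or leads back to a vertex already on it. Hence no
    polygonal path competing in the infimum is shorter than the simple one. *)
Lemma simple_path_length u s v : V u -> simple_path u s v -> d u v = path_length u s.
Proof.
move=> Vu Hs.
have /choice[P HP] x : exists s, V x -> simple_path u s x.
  have [Vx|nVx] := pselect (V x); last by exists [::].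
  by have [s' Hs'] := simple_path_exists Vu Vx; exists s'.
pose D x := path_length u (P x).
have stepD x y : V x -> adj x y -> D y <= D x + d x y.
  move=> Vx xy; have [_ Vy] := adj_V xy; have [px ux lx] := HP x Vx.
  have [|yP] := boolP (y \in u :: P x).
    rewrite inE => /orP[/eqP->|yP].
      rewrite /D (simple_path_uniq Vu Vu (HP u Vu) (simple_path_nil u)).
      rewrite {1}/path_length big_nil addr_ge0// ?path_length_ge0//;
        exact: mdist_nneg.
    case/splitPr: yP px ux lx => s1 s2; rewrite -cat_rcons => px ux lx.
    have := simple_path_prefix (And3 px ux lx); rewrite last_rcons => H1.
    rewrite /D (simple_path_uniq Vu Vy (HP y Vy) H1).
    have -> : P x = rcons s1 y ++ s2.
      exact: (simple_path_uniq Vu Vx (HP x Vx) (And3 px ux lx)).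
    rewrite path_length_cat; have := path_length_ge0 (last u (rcons s1 y)) s2.
    by have := mdist_nneg x y; lra.
  have H1 : simple_path u (rcons (P x) y) y.
    split; last by rewrite last_rcons.
      by rewrite rcons_path px lx.
    by rewrite -rcons_cons rcons_uniq yP.
  by rewrite /D (simple_path_uniq Vu Vy (HP y Vy) H1) path_length_rcons lx.
have inEdge e x y : E e -> e x -> e y -> V x -> V y -> D y <= D x + d x y.
  move=> Ee ex ey Vx Vy; have [->|/eqP xy] := eqVneq x y.
    by rewrite mdist_refl addr0.
  by apply: stepD => //; apply/adjP; exists e; split.
(* A polygonal path that has reached a point of an edge has length at least
   the combinatorial distance to an end of that edge, up to the last bit. *)
have key s' : path (coedge E) u s' ->
    forall e w, E e -> e (last u s') -> e w -> V w ->
    D w <= path_length u s' + d (last u s') w.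
  elim/last_ind: s' => [_|s' a IH].
    move=> e w Ee /= eu ew Vw; rewrite /path_length big_nil add0r.
    have := inEdge e u w Ee eu ew Vu Vw.
    by rewrite {2}/D (simple_path_uniq Vu Vu (HP u Vu) (simple_path_nil u))
      /path_length big_nil add0r.
  rewrite rcons_path last_rcons path_length_rcons => /andP[/IH{}IH].
  move=> /asboolP[e0 Ee0 [e0l e0a]] e w Ee ea ew Vw.
  have [ee|ne] := pselect (e = e0).
    have := IH e w Ee; rewrite {1}ee => /(_ e0l ew Vw).
    have := mdist_triangle a (last u s') w; lra.
  have Va : V a by apply: (st_interiors tr Ee Ee0 ne).
  have := IH e0 a Ee0 e0l e0a Va.
  have := inEdge e a w Ee ea ew Va Vw; lra.
have [ps us ls] := Hs.
have Vv : V v by rewrite -ls; apply: (path_V Vu ps); exact: mem_last.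
have DE : D v = path_length u s by rewrite /D (simple_path_uniq Vu Vv (HP v Vv) Hs).
apply/le_anti; rewrite -{1}ls dist_le_path_length/= -DE (st_path_metric tr).
apply: lb_le_inf.
  exists (path_length u s), s => //; split=> //.
  apply: sub_path ps => x y /adjP[e [_ _ _ Ee [ex ey]]].
  by apply/asboolP; exists e.
move=> _ [s' [ps' ls'] <-].
have [uv|uv] := pselect (u = v).
  rewrite -uv /D (simple_path_uniq Vu Vu (HP u Vu) (simple_path_nil u)).
  by rewrite {1}/path_length big_nil path_length_ge0.
case/lastP: s' ps' ls' => [|s' a] ps' ls'; first by case: uv.
move: (ps'); rewrite rcons_path => /andP[_ /asboolP[e Ee [_]]].
rewrite last_rcons in ls'; rewrite ls' => ev.
have := key _ ps' e v Ee; rewrite last_rcons ls' => /(_ ev ev Vv).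
by rewrite mdist_refl addr0.
Qed.

Lemma vertex_path u v : V u -> V v -> exists s,
  [/\ path adj u s, last u s = v & d u v = path_length u s].
Proof.
move=> Vu Vv; have [s Hs] := simple_path_exists Vu Vv.
by exists s; rewrite (simple_path_length Vu Hs); case: Hs.
Qed.

Lemma simple_path_between u s v w : V u -> simple_path u s v -> w \in u :: s ->
  between u w v.
Proof.
move=> Vu Hs; rewrite inE => /orP[/eqP->|]; first exact: between_refl.
move=> ws; case/splitPr: ws Hs => s1 s2; rewrite -cat_rcons => Hs.
have := simple_path_prefix Hs; rewrite last_rcons => Hw.
rewrite /between (simple_path_length Vu Hs) (simple_path_length Vu Hw).
rewrite path_length_cat last_rcons; congr (_ + _).
have [ps us ls] := Hs.
rewrite (simple_path_length (s := s2)) //.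
  by apply: (path_V Vu ps); rewrite inE mem_cat mem_rcons mem_head orbT.
move: ps us ls; rewrite cat_path last_cat last_rcons => /andP[_ p2].
rewrite -cat_cons cat_uniq => /and3P[_ H u2] l2; split=> //=.
rewrite u2 andbT; apply: contra H => ws2; apply/hasP; exists w => //.
by rewrite inE mem_rcons mem_head orbT.
Qed.

(** Uniqueness of simple paths: the one from [x] to [u] either meets [v] or can be prolonged by the
    edge. *)
Lemma adj_step x u v : V x -> adj u v ->
  d x v = d x u + d u v \/ d x u = d x v + d u v.
Proof.
move=> Vx uv; have [Vu Vv] := adj_V uv.
have [s Hs] := simple_path_exists Vx Vu; have [ps us ls] := Hs.
have [vs|vs] := boolP (v \in x :: s).
  by right; rewrite (simple_path_between Vx Hs vs : _ = _) (mdistC v).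
left; have H : simple_path x (rcons s v) v.
  by split; rewrite ?last_rcons// ?rcons_path ?ps ?ls// -rcons_cons rcons_uniq vs.
rewrite (simple_path_length Vx H) path_length_rcons ls.
by rewrite (simple_path_length Vx Hs).
Qed.

Lemma adj_neighbours u v w : adj v u -> adj v w -> u <> w -> between u v w.
Proof.
move=> vu vw uw; have [Vv Vu] := adj_V vu.
rewrite /between (simple_path_length (s := [:: v; w]) (u := u))//.
  by rewrite 2!path_length_cons /path_length big_nil addr0.
split; rewrite //= ?(adj_sym vu) ?vw// !inE negb_or !andbT; apply/andP; split.
  by apply/andP; split; apply/eqP=> // uv; apply: (adj_neq vu).
by apply/eqP; exact: (adj_neq vw).
Qed.

(** A vertex common to the simple paths from [x] to [u] and from [v] to [y] would contradict the two
    distance hypotheses; so these paths concatenate across the edge. *)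
Lemma adj_separates x y u v : V x -> V y -> adj u v ->
  d x v = d x u + d u v -> d y u = d y v + d u v -> d x y = d x u + d u v + d v y.
Proof.
move=> Vx Vy uv xuv yvu; have [Vu Vv] := adj_V uv; have uv0 := adj_gt0 uv.
have [s Hs] := simple_path_exists Vx Vu; have [ps us ls] := Hs.
have [t Ht] := simple_path_exists Vv Vy; have [pt ut lt] := Ht.
have H : simple_path x (s ++ v :: t) y.
  split; [|rewrite -cat_cons cat_uniq us ut andbT|by rewrite last_cat].
    by rewrite cat_path ps/= ls uv pt.
  apply/hasP => -[w wt ws].
  have xwu := simple_path_between Vx Hs ws : _ = _.
  have vwy := simple_path_between Vv Ht wt : _ = _.
  have := mdist_triangle w x v; have := mdist_triangle w y u;
    have := mdist_triangle v w u; have := mdist_triangle u w v.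
  by rewrite (mdistC v u) (mdistC w y) (mdistC v w) (mdistC y v) in vwy yvu *;
    lra.
rewrite (simple_path_length Vx H) path_length_cat path_length_cons ls.
by rewrite -(simple_path_length Vx Hs) -(simple_path_length Vv Ht) addrA.
Qed.

End Tree.

(** * The four-point inequality and geodesics in a simplicial tree *)

Section TreeHyperbolic.
Variables (R : realType) (T : metricType R) (V : set T) (E : set (set T)).
Hypothesis tr : is_simplicial_metric_tree V E.
Local Notation d := (@mdist R T).
Local Notation adj := (Defs.adjacent V E).
Local Notation spans := (spans V E).
Implicit Types (x y z u v w p q : T) (s : seq T) (e : set T).

Definition four_point_at x y z w : Prop :=
  d x y + d z w <= d x z + d y w \/ d x y + d z w <= d x w + d y z.

Lemma four_point_at_swap x y z w : four_point_at x y z w -> four_point_at y x z w.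
Proof. by case=> H; [right|left];
  rewrite (mdistC y x) addrC [leRHS]addrC addrC. Qed.

Lemma four_point_at_flip x y z w : four_point_at x y z w -> four_point_at z w x y.
Proof.
have := (mdistC z x, mdistC w y, mdistC w x, mdistC z y) => -[[[E1 E2] E3] E4].
by case=> H; [left|right]; lra.
Qed.

Lemma four_point_vertices w x y z : V w -> V x -> V y -> V z ->
  [/\ four_point_at w x y z, four_point_at w y x z & four_point_at w z x y].
Proof.
move=> Vw Vx Vy Vz; have [s [ps ls ds]] := vertex_path tr Vw Vx.
elim: s w Vw ps ls ds => [|v s IH] w Vw /=.
  move=> _ <- _; rewrite /four_point_at mdist_refl; split.
  - by left; have := mdist_triangle w y z; rewrite (mdistC y w); lra.
  - by right; rewrite (mdistC w y); lra.
  - by right; rewrite (mdistC w z); lra.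
move=> /andP[wv ps] ls; rewrite path_length_cons => ds.
have [_ Vv] := adj_V wv; have wv0 := adj_gt0 wv.
have dvx : d v x = path_length v s.
  have := dist_le_path_length v s; rewrite ls; have := mdist_triangle v w x; lra.
have [fx fy fz] := IH v Vv ps ls dvx; have vw := adj_sym wv.
have cvw := mdistC v w; have cxw := mdistC x w; have cyw := mdistC y w;
  have czw := mdistC z w.
have cxv := mdistC x v; have cyv := mdistC y v; have czv := mdistC z v.
have cxy := mdistC x y; have cxz := mdistC x z; have cyz := mdistC y z.
have xw : d x w = d x v + d v w by lra.
have far t t' : V t -> V t' -> d t v = d t w + d w v -> d t' w = d t' v + d w v ->
    d t' t = d t' v + d v w + d w t.
  move=> Vt Vt' t1 t2; apply: (adj_separates tr Vt' Vt vw); lra.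
have near t : V t -> d t v = d t w + d w v -> d x t = d x v + d v w + d w t.
  by move=> Vt tv; apply: far => //; lra.
have wyz := mdist_triangle w y z; have wxz := mdist_triangle w x z;
  have wxy := mdist_triangle w x y.
case: (adj_step tr Vy wv) (adj_step tr Vz wv) => yS [] zS.
- have y1 := near _ Vy yS; have z1 := near _ Vz zS.
  by split; [left|right|right]; lra.
- have y1 := near _ Vy yS; have z1 := far _ _ Vy Vz yS zS.
  by split; [right|left|left]; lra.
- have y1 := near _ Vz zS; have z1 := far _ _ Vz Vy zS yS.
  by split; [left|left|left]; lra.
- split; [case: fx|case: fy|case: fz] => f.
  + by left; lra.
  + by right; lra.
  + by left; lra.
  + by right; lra.
  + by left; lra.
  + by right; lra.
Qed.

Lemma vertex_to_edge v e p q y : V v -> spans e p q -> e y ->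
  d v y = d v p + d p y \/ d v y = d v q + d q y.
Proof.
move=> Vv epq ey; have [_ _ /(_ y ey) py _] := spansP tr epq.
have pq : adj p q by apply/adjP; exists e.
move: py; rewrite /between => py; have cqy := mdistC q y.
have := mdist_triangle y v q; have := mdist_triangle y v p;
  have := mdist_triangle q v y; have := mdist_triangle p v y.
by have := mdistC p y; case: (adj_step tr Vv pq) => H; [left|right]; lra.
Qed.

(** Otherwise [e] would separate the ends of [e']; as these are adjacent, [e'] would have the same
    ends as [e] and be equal to it. *)
Lemma spans_same_side e e' p q p' q' : spans e p q -> spans e' p' q' -> e <> e' ->
  (d q p' = d p p' + d p q /\ d q q' = d p q' + d p q) \/
  (d p p' = d q p' + d p q /\ d p q' = d q q' + d p q).
Proof.
move=> epq; wlog : p' q' / d q p' = d p p' + d p q.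
  move=> wl epq' ne.
  have pq : adj p q by apply/adjP; exists e.
  have Vp' : V p' by case: epq'.
  have Vq' : V q' by case: epq'.
  have cpp := mdistC p p'; have cqp := mdistC q p'; have cpq := mdistC p q';
    have cqq := mdistC q q'.
  case: (adj_step tr Vp' pq) => H1.
    by apply: wl => //; lra.
  case: (adj_step tr Vq' pq) => H2.
    have [|H|H] := wl q' p' _ (spans_sym epq') ne; [lra|tauto|tauto].
  by right; lra.
move=> H1 epq' ne; have pq : adj p q by apply/adjP; exists e.
have pq' : adj p' q' by apply/adjP; exists e'.
have [Vp Vq] := adj_V pq; have [Vp' Vq'] := adj_V pq'.
have cpp := mdistC p p'; have cqp := mdistC q p'; have cpq := mdistC p q';
  have cqq := mdistC q q'.
have [H2|H2] := adj_step tr Vq' pq; first by left; lra.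
have H3 : d p' q' = d p' p + d p q + d q q'.
  by apply: (adj_separates tr) => //; lra.
have pq0 := adj_gt0 pq; have pq'0 := adj_gt0 pq'.
have t1 := mdist_triangle q p q'; have t2 := mdist_triangle p p' q';
  have t3 := mdist_nneg p p'; have t4 := mdist_nneg q q'.
have pE : d p p' = 0 by case: (adj_step tr Vp pq'); lra.
have qE : d q q' = 0 by have t5 := mdist_triangle p p' q;
  case: (adj_step tr Vq pq'); lra.
case: ne; move/mdist_eq0: pE epq' => <-; move/mdist_eq0: qE => <- epq'.
case: epq' => pqn _ _ Ee' [e'p e'q]; case: epq => _ _ _ Ee [ep eq].
exact: (st_no_multi_edge tr Ee Ee' Vp Vq).
Qed.

Lemma edge_gate e e' p q x y : spans e p q -> E e' -> e x -> e' y -> e <> e' ->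
  (d q y = d p y + d p q /\ d x y = d x p + d p y) \/
  (d p y = d q y + d p q /\ d x y = d x q + d q y).
Proof.
move=> epq Ee'; have [p' [q' epq']] := edge_spans tr Ee'.
move=> ex e'y ne; wlog : p q epq / d q p' = d p p' + d p q /\ d q q' = d p q' + d p q.
  move=> wl; have [H|H] := spans_same_side epq epq' ne; first exact: wl.
  have := wl q p (spans_sym epq); rewrite (mdistC q p) => /(_ H); tauto.
move=> [H1 H2]; left; have [_ _ /(_ x ex) xb _] := spansP tr epq.
have Vq : V q by case: epq.
move: xb; rewrite /between => xb.
have H : d q y = d p y + d p q.
  have := mdist_triangle p' p y; have := mdist_triangle q' p y;
    have := mdist_triangle p q y; have := mdistC p q.
  by case: (vertex_to_edge Vq epq' e'y); lra.
split=> //; have := mdist_triangle p x y; have := mdist_triangle x q y;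
  have := mdistC p x; have := mdistC q x.
by have := mdistC p q; lra.
Qed.

Lemma edge_dist e p q x y : spans e p q -> e x ->
  d x y <= d p y - d p x \/ d x y <= d q y - d q x.
Proof.
move=> epq ex; have [_ eI eb _] := spansP tr epq.
have xb : d p q = d p x + d x q by exact: eb.
have cqx := mdistC q x; have cpx := mdistC p x; have cpq := mdistC p q.
have [Vy|[e' Ee' e'y]] := st_cover tr y.
  have pq : adj p q by apply/adjP; exists e.
  have cpy := mdistC p y; have cqy := mdistC q y;
    have t1 := mdist_triangle p x y; have t2 := mdist_triangle q x y.
  by case: (adj_step tr Vy pq) => H; [right|left]; lra.
have [ee|ne] := pselect (e = e'); last first.
  by case: (edge_gate epq Ee' ex e'y ne) => H; [right|left]; lra.
have ey : e y by rewrite ee.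
have yb : d p q = d p y + d y q by exact: eb.
have cqy := mdistC q y; rewrite (eI x y ex ey).
by case: (leP (d p x) (d p y)) => H; [left|right];
  [rewrite ler0_norm|rewrite gtr0_norm]; lra.
Qed.

(** The premise says that [x] lies between one of [p], [q] and [y]. Moving from that end to [x]
    lowers the left side of the inequality by at least their distance, and either right side by at
    most as much. *)
Lemma four_point_at_edge p q x y z w :
  (d x y <= d p y - d p x \/ d x y <= d q y - d q x) ->
  four_point_at p y z w -> four_point_at q y z w -> four_point_at x y z w.
Proof.
move=> H fp fq; have := mdist_triangle x p z; have := mdist_triangle x p w.
have := mdist_triangle x q z; have := mdist_triangle x q w.
case: H => H; [case: fp|case: fq] => f.
- by left; lra.
- by right; lra.
- by left; lra.
- by right; lra.
Qed.

Lemma point_ends x : exists p q, [/\ V p, V q &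
  forall y, d x y <= d p y - d p x \/ d x y <= d q y - d q x].
Proof.
have [Vx|[e Ee ex]] := st_cover tr x.
  by exists x, x; split=> // y; left; rewrite mdist_refl subr0.
have [p [q epq]] := edge_spans tr Ee; have [_ Vp Vq _ _] := epq.
by exists p, q; split=> // y; exact: edge_dist epq ex.
Qed.

(** Vertices are replaced by arbitrary points one at a time; the symmetries of the inequality bring
    the point being replaced into the first place. *)
Lemma tree_four_point : four_point T.
Proof.
have f1 x y z w : V y -> V z -> V w -> four_point_at x y z w.
  move=> Vy Vz Vw; have [p [q [Vp Vq H]]] := point_ends x.
  have [? _ _] := four_point_vertices Vp Vy Vz Vw.
  have [? _ _] := four_point_vertices Vq Vy Vz Vw.
  exact: (four_point_at_edge (H y)).
have f2 x y z w : V z -> V w -> four_point_at x y z w.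
  move=> Vz Vw; have [p [q [Vp Vq H]]] := point_ends x.
  by apply: (four_point_at_edge (H y)); apply: four_point_at_swap; exact: f1.
have f3 x y z w : V w -> four_point_at x y z w.
  move=> Vw; apply: four_point_at_flip; have [p [q [Vp Vq H]]] := point_ends z.
  apply: (four_point_at_edge (H w)); apply: four_point_at_swap;
    apply: four_point_at_flip; exact: f2.
move=> x y z w; apply: four_point_at_flip; apply: four_point_at_swap.
have [p [q [Vp Vq H]]] := point_ends w.
by apply: (four_point_at_edge (H z)); apply: four_point_at_swap;
  apply: four_point_at_flip; exact: f3.
Qed.

Definition geodesic_between x y : Prop := forall t, 0 <= t <= d x y ->
  exists2 z, d x z = t & between x z y.

Lemma geodesic_between_sym x y : geodesic_between x y -> geodesic_between y x.
Proof.
move=> H t tI; have [|z z1 z2] := H (d x y - t);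
  first by rewrite (mdistC y x) in tI; lra.
exists z; last exact: between_sym.
by move: z2; rewrite /between (mdistC y z); lra.
Qed.

Lemma geodesic_between_trans x y z : between x y z ->
  geodesic_between x y -> geodesic_between y z -> geodesic_between x z.
Proof.
move=> xyz Hx Hz t tI; have [ty|/ltW ty] := leP t (d x y).
  have [|w w1 w2] := Hx t; first lra.
  by exists w => //; exact: between_transr xyz w2.
have [|w w1 w2] := Hz (t - d x y); first by move: xyz; rewrite /between; lra.
have xzw : between x w z.
  by apply: between_sym; apply: between_transr (between_sym xyz) (between_sym w2).
exists w => //; move: xyz w2 xzw; rewrite /between; lra.
Qed.

Lemma geodesic_edge e x y : E e -> e x -> e y -> geodesic_between x y.
Proof.
move=> Ee ex ey; have [p [q epq]] := edge_spans tr Ee.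
have [_ eI eb ept] := spansP tr epq.
wlog : x y ex ey / d p x <= d p y.
  move=> wl; have [|/ltW] := leP (d p x) (d p y); first exact: wl.
  by move=> /(wl _ _ ey ex)/geodesic_between_sym.
move=> xy t; have -> : d x y = d p y - d p x.
  by rewrite (eI x y)// ler0_norm; lra.
move=> tI; have [|z ez pz] := ept (d p x + t).
  by have := mdist_nneg p x; rewrite (eb y ey : _ = _); have := mdist_nneg y q;
    lra.
exists z; first by rewrite (eI x z)// pz ler0_norm; lra.
rewrite /between (eI x y)// (eI x z)// (eI z y)// pz.
by rewrite !ler0_norm; lra.
Qed.

Lemma geodesic_vertices u v : V u -> V v -> geodesic_between u v.
Proof.
move=> Vu Vv; have [s [ps ls ds]] := vertex_path tr Vu Vv.
elim: s u Vu ps ls ds => [|w s IH] u Vu /=.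
  move=> _ <- _ t; rewrite mdist_refl => tI; exists u; last exact: between_refl.
  by rewrite mdist_refl; lra.
move=> /andP[uw ps] ls; rewrite path_length_cons => ds.
have [_ Vw] := adj_V uw.
have dwv : d w v = path_length w s.
  have := dist_le_path_length w s; rewrite ls; have := mdist_triangle w u v; lra.
apply: (@geodesic_between_trans _ w); last exact: IH.
  by rewrite /between ds dwv.
have /adjP[e [_ _ _ Ee [eu ew]]] := uw; exact: geodesic_edge Ee eu ew.
Qed.

Lemma tree_geodesic : geodesic T.
Proof.
have vg v y : V v -> geodesic_between v y.
  move=> Vv; have [Vy|[e Ee ey]] := st_cover tr y; first exact: geodesic_vertices.
  have [p [q epq]] := edge_spans tr Ee; have [_ Vp Vq _ [ep eq]] := epq.
  case: (vertex_to_edge Vv epq ey) => H; apply: (geodesic_between_trans H).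
  - exact: geodesic_vertices.
  - exact: geodesic_edge Ee ep ey.
  - exact: geodesic_vertices.
  - exact: geodesic_edge Ee eq ey.
move=> x y; apply: (_ : geodesic_between x y).
have [Vx|[e Ee ex]] := st_cover tr x; first exact: vg.
have [Vy|[e' Ee' ey]] := st_cover tr y.
  by apply: geodesic_between_sym; exact: vg.
have [ee|ne] := pselect (e = e').
  by apply: (geodesic_edge Ee ex); rewrite ee.
have [p [q epq]] := edge_spans tr Ee; have [_ Vp Vq _ [ep eq]] := epq.
case: (edge_gate epq Ee' ex ey ne) => -[_ H]; apply: (geodesic_between_trans H).
- exact: geodesic_edge Ee ex ep.
- exact: vg.
- exact: geodesic_edge Ee ex eq.
- exact: vg.
Qed.

Lemma spansE e p q : spans e p q -> e = [set y | between p y q].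
Proof.
move=> epq; have [_ _ eb ept] := spansP tr epq.
apply/seteqP; split=> [y|y/= py]; first exact: eb.
have [|z ez pz] := ept (d p y).
  by rewrite (py : _ = _); have := mdist_nneg p y; have := mdist_nneg y q; lra.
by rewrite (between_uniq tree_four_point py (eb z ez)).
Qed.

End TreeHyperbolic.

(** * Trees with a group action *)

Section GtreeGeometry.
Variables (R : realType) (G : groupType) (T : Gtree R G).
Local Notation d := (@mdist R T).
Local Notation V := (vertices T).
Local Notation adj := (Defs.adjacent (vertices T) (edges T)).
Local Notation spans := (spans (vertices T) (edges T)).
Implicit Types (x y z u v w p q : T) (e : set T) (g : G) (s : seq T).

Lemma gt_four_point : four_point T.
Proof. exact: tree_four_point (gt_tree T). Qed.

Lemma gt_geodesic : geodesic T.
Proof. exact: tree_geodesic (gt_tree T). Qed.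

Lemma gt_cover x : V x \/ exists u v, adj u v /\ between u x v.
Proof.
have [Vx|[e Ee ex]] := st_cover (gt_tree T) x; first by left.
right; have [u [v euv]] := edge_spans (gt_tree T) Ee; exists u, v.
have [_ _ /(_ x ex) H _] := spansP (gt_tree T) euv.
by split=> //; apply/adjP; exists e.
Qed.

Lemma adj_between_vertex u v w : adj u v -> V w -> between u w v -> w = u \/ w = v.
Proof.
move=> /adjP[e euv] Vw uwv; have [H _ _ _] := spansP (gt_tree T) euv.
by apply: H => //; rewrite (spansE (gt_tree T) euv).
Qed.

Lemma adj_between_inner u v u' v' x : adj u v -> adj u' v' ->
  between u x v -> between u' x v' -> ~ V x ->
  (u' = u /\ v' = v) \/ (u' = v /\ v' = u).
Proof.
move=> /adjP[e euv] /adjP[e' euv'] ux ux' nVx.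
have [H _ _ _] := spansP (gt_tree T) euv.
have ee : e = e'.
  apply: contrapT => ne; apply: nVx; have [_ _ _ Ee _] := euv.
  have [_ _ _ Ee' _] := euv'; apply: (st_interiors (gt_tree T) Ee Ee' ne).
  by split; [rewrite (spansE (gt_tree T) euv)|rewrite (spansE (gt_tree T) euv')].
case: euv' => uv' Vu' Vv' _; rewrite -ee => -[eu' ev'].
case: (H _ Vu' eu') (H _ Vv' ev') uv' => -> [] -> uv'.
- by case: uv'.
- by left.
- by right.
- by case: uv'.
Qed.

Lemma act_vertices g v : V (act g v) <-> V v.
Proof.
split; last exact: gt_vertices.
by move=> /(gt_vertices g^-1); rewrite actK.
Qed.

Lemma act_spans g e u v : spans e u v -> spans (act g @` e) (act g u) (act g v).
Proof.
move=> [uv Vu Vv Ee [eu ev]]; split.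
- by move=> /act_inj.
- exact: gt_vertices.
- exact: gt_vertices.
- exact: gt_edges.
- by split; [exists u|exists v].
Qed.

Lemma act_adj g u v : adj (act g u) (act g v) = adj u v.
Proof.
have H h a b : adj a b -> adj (act h a) (act h b).
  by move=> /adjP[e /(act_spans h) H]; apply/adjP; exists (act h @` e).
by apply/idP/idP; [move=> /(H g^-1%g); rewrite !actK|exact: H].
Qed.

Lemma gt_path u v : V u -> V v -> exists s,
  [/\ path adj u s, last u s = v & d u v = path_length u s].
Proof. exact: vertex_path (gt_tree T) _ _. Qed.

Lemma gt_neighbours u v w : adj v u -> adj v w -> u <> w -> between u v w.
Proof. exact: adj_neighbours (gt_tree T) _ _ _. Qed.

Lemma midpoint_nonvertex u v : adj u v -> exists2 m, between u m v & ~ V m.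
Proof.
move=> uv; have uv0 := adj_gt0 uv.
have [|m dm um] := gt_geodesic (x := u) (y := v) (t := d u v / 2); first lra.
exists m => // Vm; have := adj_between_vertex uv Vm um.
case=> mE; move: dm; rewrite mE ?mdist_refl; lra.
Qed.

Section TrivialEdgeStabilizers.
Hypothesis edge_stab : forall e, edges T e -> edge_stabilizer e = [set 1%g].

Lemma act_edge_eq1 g u v : adj u v ->
  (act g u = u /\ act g v = v) \/ (act g u = v /\ act g v = u) -> g = 1%g.
Proof.
move=> /adjP[e euv] H; have [_ _ _ Ee _] := euv.
suff : edge_stabilizer e g by rewrite edge_stab.
rewrite /edge_stabilizer/= (spansE (gt_tree T) (act_spans g euv)).
rewrite (spansE (gt_tree T) euv); case: H => -[-> ->] //.
by apply/seteqP; split=> y /= /between_sym.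
Qed.

Lemma fixed_nonvertex g x : ~ V x -> act g x = x -> g = 1%g.
Proof.
move=> nVx gx; have [//|[u [v [uv ux]]]] := gt_cover x.
apply: (act_edge_eq1 uv).
apply: (adj_between_inner (x := x)) => //; first by rewrite act_adj.
by rewrite -gx act_between.
Qed.

Lemma fixed_between g x y z : act g x = x -> act g y = y -> between x z y ->
  act g z = z.
Proof.
move=> gx gy xzy; apply: (between_uniq gt_four_point _ xzy).
  by rewrite -{1}gx -{1}gy act_between.
by rewrite -{1}gx gt_isometry.
Qed.

(** The segment between two fixed points is fixed pointwise, and it contains interior points of
    edges, whose stabilizers are trivial. *)
Lemma fixed_two g x y : x <> y -> act g x = x -> act g y = y -> g = 1%g.
Proof.
move=> xy gx gy.
have [Vx|nVx] := pselect (V x); last exact: fixed_nonvertex nVx gx.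
have [Vy|nVy] := pselect (V y); last exact: fixed_nonvertex nVy gy.
have [[|w s] [/= ps ls ds]] := gt_path Vx Vy; first by case: xy.
move: ps ds => /andP[xw _]; rewrite path_length_cons => ds.
have [m xm nVm] := midpoint_nonvertex xw; apply: (fixed_nonvertex nVm).
apply: (fixed_between gx gy); apply: between_transr xm.
by rewrite /between; have := dist_le_path_length w s; rewrite ls;
  have := mdist_triangle w x y; lra.
Qed.

(** If [z] and its image lay in the same gate at [y], the branching point of the tripod would be a
    second fixed point, against [fixed_two]. *)
Lemma fixed_opposite g y z : g <> 1%g -> act g y = y -> between z y (act g z).
Proof.
move=> g1 gy; have cyz := mdistC y z; have cgz := mdistC y (act g z).
have dgz : d y (act g z) = d y z by rewrite -{1}gy gt_isometry.
have cm := mdistC z (act g z).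
have := mdist_triangle y z (act g z).
rewrite le_eqVlt => /orP[/eqP//|lt].
have le0 := mdist_nneg z (act g z).
(* The distance is the Gromov product at [y] of [z] and its image, both being at distance [d y z]
   from [y]. *)
have [|m dm ym] := gt_geodesic (x := y) (y := z) (t := d y z - d z (act g z) / 2).
  by lra.
case: g1; apply: (@fixed_two g y m) => // [ym0|].
  by move: dm; rewrite -ym0 mdist_refl; lra.
have ymg : between y m (act g z).
  have := mdist_triangle m y (act g z); have := mdistC m z.
  have H := between_dist gt_four_point (act g z) ym.
  by move: ym; rewrite /between; case: H; lra.
apply: (between_uniq gt_four_point _ ymg); first by rewrite -{1}gy act_between.
by rewrite -{1}gy gt_isometry.
Qed.

(** Translation lengths are infima over all points, while equivariant maps are controlled at
    vertices only. If [g] moves the edge of [x], the geodesic from [x] to its image leaves that edge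
    through an end, and this end is moved no further than [x]; if [g] preserves the edge, it is
    trivial. *)
Lemma vertex_displacement g x : exists2 v, V v & d v (act g v) <= d x (act g x).
Proof.
have [Vx|[e Ee ex]] := st_cover (gt_tree T) x; first by exists x.
have [p [q epq]] := edge_spans (gt_tree T) Ee.
have epq' := act_spans g epq; have [_ Vp Vq _ _] := epq.
have ex' : (act g @` e) (act g x) by exists x.
have [_ eI eb _] := spansP (gt_tree T) epq.
have xb : d p q = d p x + d x q by exact: eb.
have gxp := gt_isometry g p x; have gxq := gt_isometry g x q.
have gpq := gt_isometry g p q.
have cxp := mdistC x p; have cgx := mdistC (act g x) (act g q).
have cpq := mdistC p q.
have [ee|ne] := pselect (e = act g @` e).
  have -> : g = 1%g.
    by have : edge_stabilizer e g := esym ee; rewrite edge_stab.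
  by exists p; rewrite // !gt_act1 !mdist_refl.
have Ee' := gt_edges g Ee.
have [[_ H]|[_ H]] := edge_gate (gt_tree T) epq Ee' ex ex' ne.
  exists p => //; have := mdist_triangle (act g q) p (act g p).
  have := mdistC (act g q) (act g p); have := mdist_nneg p x.
  by case: (vertex_to_edge (gt_tree T) Vp epq' ex'); lra.
exists q => //; have := mdist_triangle (act g p) q (act g q);
  have := mdist_nneg x q.
by case: (vertex_to_edge (gt_tree T) Vq epq' ex'); lra.
Qed.

End TrivialEdgeStabilizers.

Lemma orbit_projP x y : orbit_proj x = orbit_proj y <-> exists g, act g x = y.
Proof.
split=> [/(@eqquotP _ _ {eq_quot (same_orbit_equiv T)}%qT)/asboolP//|H].
by apply/(@eqquotP _ _ {eq_quot (same_orbit_equiv T)}%qT)/asboolP.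
Qed.

Lemma orbit_proj_act g x : orbit_proj (act g x) = orbit_proj x.
Proof. by apply/esym/orbit_projP; exists g. Qed.

(** A canonical point in each orbit turns lying in the same orbit into an equality, so that [uniq]
    and membership in sequences can speak about the orbits met by a path. *)
Definition orbit_repr x : T :=
  (repr (orbit_proj x : {eq_quot (same_orbit_equiv T)}))%qT.

Lemma orbit_repr_proj x : orbit_proj (orbit_repr x) = orbit_proj x.
Proof. exact: (reprK (orbit_proj x : {eq_quot (same_orbit_equiv T)}%qT)). Qed.

Lemma orbit_reprP x y : orbit_repr x = orbit_repr y <-> exists g, act g x = y.
Proof.
rewrite -orbit_projP; split=> [|H]; last by rewrite /orbit_repr H.
by move=> /(congr1 (@orbit_proj _ _ _)); rewrite !orbit_repr_proj.
Qed.

Lemma orbit_repr_act g x : orbit_repr (act g x) = orbit_repr x.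
Proof. by apply/esym/orbit_reprP; exists g. Qed.

End GtreeGeometry.

Section OuterSpace.
Variables (R : realType) (p : nat) (Gi : 'I_p -> groupType) (G : groupType).
Variables (iota : forall i, group_hom (Gi i) G).

Lemma conjugate_stabilizer (T : Gtree R G) (H : set G) (v : T) :
  conjugate_sets H (stabilizer v) ->
  exists h, forall g, act g v = v <-> H (h * g * h^-1)%g.
Proof.
move=> [h Hh]; exists h => g.
have -> : (act g v = v) = (stabilizer v g) by [].
rewrite Hh; split=> [[a Ha <-]|Hg].
  by rewrite conjgE !mulgA mulgV mul1g mulgK.
by exists (h * g * h^-1)%g => //; rewrite conjgE !mulgA mulVg mul1g mulgVK.
Qed.

(** Point stabilizers in a tree of the outer space are trivial or conjugate to a factor, and every
    factor fixes a vertex in every other such tree. So subgroups with a fixed point do not depend on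
    the tree. *)
Lemma fixed_point_transfer (S T : Gtree R G) (x : S) :
  in_outer_space iota S -> in_outer_space iota T ->
  exists2 y : T, (vertices S x -> vertices T y)
    & forall g, act g x = x -> act g y = y.
Proof.
move=> oS oT; have [v0 Vv0] := st_nonempty (gt_tree T).
have triv : (forall g, act g x = x -> g = 1%g) ->
    exists2 y : T, (vertices S x -> vertices T y)
      & forall g, act g x = x -> act g y = y.
  by move=> H; exists v0 => // g /H ->; exact: gt_act1.
have [Vx|nVx] := pselect (vertices S x); last first.
  by apply: triv => g gx; exact: (fixed_nonvertex (os_C1_edges oS) nVx gx).
have [[i Hi]|nC] :=
    pselect (exists i, conjugate_sets (range (iota i)) (stabilizer x));
      last first.
  apply: triv => g gx; have : stabilizer x g by [].
  by rewrite (os_C3 oS Vx) // => i Hi; apply: nC; exists i.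
have [y [Vy Hy _]] := os_C2 oT i.
have [h Hh] := conjugate_stabilizer Hi; have [k Hk] := conjugate_stabilizer Hy.
exists (act (h^-1 * k)%g y) => [_|g /Hh H]; first exact: gt_vertices.
rewrite -gt_actM; have : act (k^-1 * (h * g * h^-1) * k)%g y = y.
  by apply/Hk; rewrite !mulgA mulgV mul1g mulgK.
move=> yE; rewrite -{2}yE -gt_actM; congr (act _ y).
by rewrite !mulgA mulgK mulVg mul1g.
Qed.

End OuterSpace.

(** * Cocompactness *)

Section Generation.
Variables (G : groupType) (P : set G).
Hypotheses (P1 : P 1%g) (PM : forall g h, P g -> P h -> P (g * h)%g).
Hypothesis PV : forall g, P g -> P g^-1%g.

Let S : pred G := fun g => `[< P g >].

Lemma generated_group_closed : group_closed S.
Proof.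
split; first exact/asboolP.
by move=> g h /asboolP Pg /asboolP Ph; apply/asboolP; apply: PM => //; exact: PV.
Qed.

Definition generated_subgroup := {g : G | S g}.
HB.instance Definition _ := Choice.on generated_subgroup.
HB.instance Definition _ := SubChoice.on generated_subgroup.
HB.instance Definition _ :=
  SubChoice_isSubGroup.Build G S generated_subgroup generated_group_closed.

Section Corestriction.
Variables (K : groupType) (f : group_hom K G).
Hypothesis Pf : forall a, P (f a).

Definition corestriction (a : K) : generated_subgroup := exist _ (f a) (asboolT (Pf a)).

Lemma corestriction_morphism :
  corestriction 1%g = 1%g /\ {morph corestriction : a b / (a * b)%g}.
Proof.
by split=> [|a b]; apply/val_inj; rewrite ?val1 ?valM/= ?gmulf1 ?gmulfM.
Qed.
HB.instance Definition _ :=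
  isUMagmaMorphism.Build K generated_subgroup corestriction corestriction_morphism.
End Corestriction.

(** The universal property gives a homomorphism from G to the subgroup [P]. Composed with the
    inclusion it is the identity, by uniqueness, so every element of G is a value of it and
    satisfies [P]. *)
Lemma free_product_generated (p k : nat) (Gi : 'I_p -> groupType)
    (iota : forall i, group_hom (Gi i) G) (x : 'I_k -> G) :
  is_free_product iota x -> (forall i a, P (iota i a)) -> (forall j, P (x j)) ->
  forall g, P g.
Proof.
move=> fp Pi Px g.
have [h [h1 h2 _]] := fp generated_subgroup (fun i => corestriction (Pi i))
  (fun j => exist _ (x j) (asboolT (Px j))).
have [h' [_ _ hU]] := fp G iota x.
have e1 : (idfun : G -> G) g = h' g by apply: hU.
have -> : g = val (h g).
  rewrite [LHS]e1; apply/esym.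
  apply: (hU ((val : generated_subgroup -> G) \o h)) => [i a|j] /=.
    by rewrite h1.
  by rewrite h2.
by have /asboolP := valP (h g).
Qed.
End Generation.

Lemma lipschitz_continuous_within (R : realType) (T : metricType R) (A : set R)
    (c : R -> T) (K : R) :
  (forall s t, A s -> A t -> mdist (c s) (c t) <= K * `|s - t|) ->
  {within A, continuous c}.
Proof.
move=> H; apply/subspace_continuousP => x Ax.
apply/metricType_numDomainType.cvgrPdist_lt => eps eps0.
have K1 : 0 < `|K| + 1 by rewrite ltr_wpDl.
rewrite near_withinE; near=> t => At.
apply: (le_lt_trans (H x t Ax At)).
apply: (@le_lt_trans _ _ ((`|K| + 1) * `|x - t|)).
  by rewrite ler_wpM2r// (le_trans (ler_norm K))// lerDl.
rewrite mulrC -ltr_pdivlMr//.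
near: t; apply: (@cvgr_dist_lt _ _ _ (nbhs x)) => //.
by rewrite divr_gt0.
Unshelve. all: by end_near.
Qed.

Section Segments.
Variables (R : realType) (T : metricType R).
Hypotheses (T4 : four_point T) (Tg : geodesic T).

Lemma between_connected (u v : T) : connected [set y | between u y v].
Proof.
have [c [_ _ cI ->]] := geodesic_param T4 Tg u v.
apply: connected_continuous_connected; first exact: segment_connected.
apply: (@lipschitz_continuous_within _ _ _ _ 1) => s t sI tI.
by rewrite mul1r cI// inE.
Qed.

End Segments.

Section Cocompact.
Variables (R : realType) (p k : nat) (Gi : 'I_p -> groupType) (G : groupType).
Variables (iota : forall i, group_hom (Gi i) G) (x : 'I_k -> G).
Variable (T : Gtree R G).
Local Notation d := (@mdist R T).
Local Notation V := (vertices T).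
Local Notation adj := (Defs.adjacent (vertices T) (edges T)).

Section Chains.
Variable ES : seq (T * T).
Hypothesis ES_sym : forall e, e \in ES -> (e.2, e.1) \in ES.

Let link (u v : T) : bool :=
  adj u v && `[< exists g, (act g u, act g v) \in ES >].

Definition chained (u v : T) : Prop := exists2 s, path link u s & last u s = v.

Lemma link_act g u v : link u v -> link (act g u) (act g v).
Proof.
move=> /andP[uv /asboolP[h hE]]; rewrite /link act_adj uv/=; apply/asboolP.
by exists (h * g^-1)%g; rewrite !gt_actM !actK.
Qed.

Lemma link_sym u v : link u v -> link v u.
Proof.
move=> /andP[/adj_sym uv /asboolP[h /ES_sym hE]]; rewrite /link uv/=.
by apply/asboolP; exists h.
Qed.

Lemma chained_refl u : chained u u. Proof. by exists [::]. Qed.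

Lemma chained_trans u v w : chained u v -> chained v w -> chained u w.
Proof.
move=> [s ps <-] [t pt <-]; exists (s ++ t); last by rewrite last_cat.
by rewrite cat_path ps.
Qed.

Lemma chained_sym u v : chained u v -> chained v u.
Proof.
move=> [s ps <-]; elim: s u ps => [|w s IH] u /=; first by move=> _; exists [::].
move=> /andP[uw /IH H]; apply: (chained_trans H); exists [:: u] => //=.
by rewrite link_sym.
Qed.

Lemma chained_act g u v : chained u v -> chained (act g u) (act g v).
Proof.
move=> [s ps <-]; exists (map (act g) s); last by rewrite last_map.
elim: s u ps => //= w s IH u /andP[uw /IH ->]; by rewrite link_act.
Qed.

Lemma chained_V u v : V u -> chained u v -> V v.
Proof.
move=> Vu [s ps <-]; elim: s u Vu ps => //= w s IH u Vu /andP[/andP[uw _] ps].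
by apply: IH ps; have [] := adj_V uw.
Qed.

Let carrier (o : T) : set T :=
  [set y | exists u v, [/\ chained o u, u = v \/ link u v & between u y v]].

Lemma carrier_chained o u : chained o u -> carrier o u.
Proof. by move=> ou; exists u, u; split=> //; [left|exact: between_refl]. Qed.

Lemma chain_connected o s : path link o s ->
  exists C : set T, [/\ connected C, C o, C (last o s) & C `<=` carrier o].
Proof.
elim/last_ind: s => [_|s v IH].
  exists [set o]; split=> //; first exact: connected1.
  by move=> _ ->; apply: carrier_chained; exact: chained_refl.
rewrite rcons_path last_rcons => /andP[ps lv]; have [C [cC Co Cl CS]] := IH ps.
exists (C `|` [set y | between (last o s) y v]); split.
- apply: connectedU => //.
    by exists (last o s); split=> //=; exact: between_refl.
  apply: between_connected; [exact: gt_four_point|exact: gt_geodesic].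
- by left.
- by right; exact: between_reflr.
- move=> y [/CS//|/= yb]; exists (last o s), v; split=> //; last by right.
  by exists s.
Qed.

Lemma carrier_connected o : connected (carrier o).
Proof.
have -> : carrier o = \bigcup_(C in [set C | connected C /\ C o /\ C `<=` carrier o]) C.
  apply/seteqP; split=> [y [u [v [[s ps ls] uv yb]]]|y [C [_ [_ CS]] /CS]]//.
  have [C [cC Co Cl CS]] := chain_connected ps.
  rewrite ls in Cl; exists (C `|` [set y | between u y v]); last by right.
  split; last first.
    split; first by left.
    by move=> z [/CS//|/= zb]; exists u, v; split=> //; exists s.
  apply: connectedU => //; first by exists u; split=> //=; exact: between_refl.
  apply: between_connected; [exact: gt_four_point|exact: gt_geodesic].
apply: bigcup_connected; last by move=> C [].
by exists o => C [_ []].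
Qed.

(** The subtree reached from [o] through edges in the orbits of [ES] is invariant as soon as it
    contains the orbit of [o]; by minimality it is then everything. The midpoint of an edge, lying
    in no other edge, shows that the edge itself belongs to one of these orbits. *)
Lemma chained_cocompact o : minimal_action T -> V o ->
  (forall g, chained o (act g o)) ->
  forall u v, adj u v -> exists g, (act g u, act g v) \in ES.
Proof.
move=> Tm Vo og.
have ST : carrier o = setT.
  apply: Tm; first by exists o; apply: carrier_chained; exact: chained_refl.
    exact: carrier_connected.
  move=> g y [u [v [ou uv yb]]]; exists (act g u), (act g v); split.
  - exact: (chained_trans (og g) (chained_act g ou)).
  - by case: uv => [->|/(link_act g)]; [left|right].
  - exact/act_between.
move=> u v uv; have [m um nVm] := midpoint_nonvertex uv.
have [a [b [oa ab mb]]] : carrier o m by rewrite ST.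
case: ab => [ab|/andP[ab /asboolP[g gE]]].
  case: nVm; rewrite -ab in mb; suff <- : a = m by exact: chained_V oa.
  apply/mdist_eq0; move: mb; rewrite /between mdist_refl;
    have := mdist_nneg a m; have := mdist_nneg m a; lra.
case: (adj_between_inner ab uv mb um nVm) => -[-> ->]; first by exists g.
by exists g; exact: (ES_sym gE).
Qed.

End Chains.

Lemma cocompact : is_free_product iota x -> in_outer_space iota T ->
  exists es : seq (T * T), [/\ forall e, e \in es -> adj e.1 e.2,
    forall e, e \in es -> (e.2, e.1) \in es
    & forall u v, adj u v -> exists g, (act g u, act g v) \in es].
Proof.
move=> fp oT; have [ o Vo] := st_nonempty (gt_tree T).
have /(@choice _ _ _)[w Hw] : forall i, exists w : T, V w /\ forall a, act (iota i a) w = w.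
  move=> i; have [v [Vv Hv _]] := os_C2 oT i;
    have [h Hh] := conjugate_stabilizer Hv.
  exists (act h v); split=> [|a]; first exact: gt_vertices.
  have : act (h^-1 * iota i a * h)%g v = v.
    by apply/Hh; exists a => //; rewrite !mulgA mulgV mul1g mulgK.
  by rewrite !gt_actM => /(congr1 (act h)); rewrite actVK.
(* Paths from [o] to these finitely many vertices suffice: an element of a factor moves [o] along
   the path to the fixed vertex and back along the image of that path, and a basis element moves [o]
   to the end of a chosen path. *)
pose targets := [seq w i | i <- enum 'I_p] ++ [seq act (x j) o | j <- enum 'I_k].
have Vt t : t \in targets -> V t.
  rewrite mem_cat => /orP[] /mapP[i _ ->]; first by case: (Hw i).
  exact: gt_vertices.
have /choice[P HP] t : exists s, t \in targets -> path adj o s /\ last o s = t.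
  have [|tt] := boolP (t \in targets); last by exists [::].
  by move=> /Vt Vt'; have [s [? ? _]] := gt_path Vo Vt'; exists s.
pose es0 := flatten [seq pairmap pair o (P t) | t <- targets].
pose es := es0 ++ [seq (e.2, e.1) | e <- es0].
have pairs_adj u s e : path adj u s -> e \in pairmap pair u s -> adj e.1 e.2.
  elim: s u => //= v s IH u /andP[uv ps]; rewrite inE => /orP[/eqP->//|].
  exact: IH.
have es0_adj e : e \in es0 -> adj e.1 e.2.
  by move=> /flatten_mapP[t /HP[pt _]]; exact: pairs_adj.
have es_sym e : e \in es -> (e.2, e.1) \in es.
  rewrite !mem_cat => /orP[e0|/mapP[f f0 ->]/=].
    by apply/orP; right; apply/mapP; exists e.
  by rewrite -surjective_pairing f0.
have es_adj e : e \in es -> adj e.1 e.2.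
  by rewrite mem_cat => /orP[/es0_adj//|/mapP[f /es0_adj/adj_sym f0 ->]].
exists es; split=> //; apply: (chained_cocompact es_sym (os_C1_minimal oT) Vo).
have chain s u : path adj u s -> {subset pairmap pair u s <= es} ->
    chained es u (last u s).
  elim: s u => [|v s IH] u /=; first by move=> _ _; exact: chained_refl.
  move=> /andP[uv ps] sub; apply: (@chained_trans _ _ v); last first.
    by apply: IH ps _ => e es'; apply: sub; rewrite inE es' orbT.
  exists [:: v] => //=; rewrite uv andbT; apply/asboolP; exists 1%g.
  by rewrite !gt_act1; apply: sub; rewrite inE eqxx.
have target t : t \in targets -> chained es o t.
  move=> tt; have [pt <-] := HP t tt; apply: chain => // e et.
  by rewrite mem_cat; apply/orP; left; apply/flatten_mapP; exists t.
apply: (free_product_generated (P := fun g => chained es o (act g o)) _ _ _ fp).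
- by rewrite gt_act1; exact: chained_refl.
- move=> g h og oh; rewrite gt_actM; apply: (chained_trans og);
  exact: chained_act.
- by move=> g /(chained_act g^-1%g)/(chained_sym es_sym); rewrite actK.
- move=> i a; have ow : chained es o (w i).
    by apply: target; rewrite mem_cat map_f// mem_enum.
  apply: (chained_trans ow); apply: (chained_sym es_sym).
  by have [_ /(_ a) wa] := Hw i; rewrite -wa; exact: chained_act.
- move=> j; apply: target; rewrite mem_cat; apply/orP; right.
  by apply/mapP; exists j; rewrite ?mem_enum.
Qed.

End Cocompact.

(** * Equivariant maps of least stretching factor *)

Lemma bigmax_seq_ge (R : realType) (I : eqType) (s : seq I) (F : I -> R) i :
  i \in s -> F i <= \big[Num.max/0]_(j <- s) F j.
Proof. by move=> si; apply: Order.TotalTheory.le_bigmax_seq. Qed.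

Lemma bigmax_seq_le (R : realType) (I : eqType) (s : seq I) (F : I -> R) r :
  0 <= r -> (forall i, i \in s -> F i <= r) -> \big[Num.max/0]_(j <- s) F j <= r.
Proof.
move=> r0 H; rewrite big_seq; elim/big_ind: _ => //.
by move=> a b ar br; rewrite ge_max ar br.
Qed.

Lemma bigmax_seq_attained (R : realType) (I : eqType) (s : seq I) (F : I -> R) :
  0 < \big[Num.max/0]_(j <- s) F j ->
  exists2 i, i \in s & F i = \big[Num.max/0]_(j <- s) F j.
Proof.
elim: s => [|a s IH]; first by rewrite big_nil ltxx.
rewrite big_cons; case: (leP (F a) (\big[Num.max/0]_(j <- s) F j)) => _ H.
  by have [i si <-] := IH H; exists i; rewrite // inE si orbT.
by exists a; rewrite ?inE ?eqxx.
Qed.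

Section EquivariantMaps.
Variables (R : realType) (G : groupType) (A B : Gtree R G).
Local Notation dA := (@mdist R A).
Local Notation dB := (@mdist R B).
Local Notation V := (vertices A).
Local Notation adj := (Defs.adjacent (vertices A) (edges A)).
Variable es : seq (A * A).
Hypotheses (es_adj : forall e, e \in es -> adj e.1 e.2)
  (es_orbit : forall u v, adj u v -> exists g, (act g u, act g v) \in es).
Hypothesis edgeA : forall e, edges A e -> edge_stabilizer e = [set 1%g].

Implicit Types (u v w : A) (f y : A -> B) (g : G).

Definition equivariant (f : A -> B) : Prop :=
  forall g v, V v -> f (act g v) = act g (f v).

Definition stretching (f : A -> B) : R :=
  \big[Num.max/0]_(e <- es) (dB (f e.1) (f e.2) / dA e.1 e.2).

Lemma stretching_ge0 f : 0 <= stretching f.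
Proof.
rewrite /stretching; elim/big_ind: _ => [//|a b a0 b0|e _].
  by rewrite le_max a0.
by rewrite divr_ge0 ?mdist_nneg.
Qed.

Lemma stretching_adj f u v : equivariant f -> adj u v ->
  dB (f u) (f v) <= stretching f * dA u v.
Proof.
move=> fe uv; have [g gE] := es_orbit uv; have [Vu Vv] := adj_V uv.
rewrite -ler_pdivrMr; last exact: adj_gt0 uv.
rewrite -(gt_isometry g) -(gt_isometry g u) -!fe//.
exact: (bigmax_seq_ge (fun e => dB (f e.1) (f e.2) / dA e.1 e.2) gE).
Qed.

Lemma stretching_lipschitz f u v : equivariant f -> V u -> V v ->
  dB (f u) (f v) <= stretching f * dA u v.
Proof.
move=> fe Vu Vv; have [s [ps <- ->]] := gt_path Vu Vv.
elim: s u Vu ps => [|w s IH] u Vu /=.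
  by rewrite mdist_refl /path_length big_nil mulr0.
move=> /andP[uw ps]; have [_ Vw] := adj_V uw; rewrite path_length_cons mulrDr.
apply: (le_trans (mdist_triangle (f w) _ _)); apply: lerD;
  first exact: stretching_adj.
exact: IH.
Qed.

(** A stretching factor 0 is treated apart because the general case divides by it, to turn the bound
    at every point of A into a bound on the infimum. *)
Lemma translation_length_stretching f g : equivariant f ->
  translation_length B g <= stretching f * translation_length A g.
Proof.
move=> fe; rewrite le_eqVlt; apply/orP.
have [s0|s0] := eqVneq (stretching f) 0.
  have [v Vv] := st_nonempty (gt_tree A).
  have : dB (f v) (f (act g v)) <= stretching f * dA v (act g v).
    by apply: stretching_lipschitz => //; exact: gt_vertices.
  have := translation_length_le g (f v); rewrite -fe// s0 !mul0r => H1 H2.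
  by apply/orP; rewrite -le_eqVlt; exact: le_trans H1 H2.
have sp : 0 < stretching f by rewrite lt_neqAle eq_sym s0 stretching_ge0.
apply/orP; rewrite -le_eqVlt mulrC -ler_pdivrMr//.
apply: translation_length_ge => x.
have [v Vv /(le_trans _)] := vertex_displacement edgeA g x; apply.
rewrite ler_pdivrMr// mulrC; apply: (le_trans (translation_length_le g (f v))).
by rewrite -fe//; apply: stretching_lipschitz => //; exact: gt_vertices.
Qed.

Definition transporter (v : A) : G :=
  projT1 (cid (proj1 (orbit_projP (orbit_repr v) v) (orbit_repr_proj v))).

Lemma transporterE v : act (transporter v) (orbit_repr v) = v.
Proof. by rewrite /transporter; case: cid. Qed.

(** Values on orbit representatives are spread by the group. The arbitrary choice of [transporter]
    is harmless once each such value is fixed by the stabilizer of its representative. *)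
Definition extension (y : A -> B) (v : A) : B :=
  act (transporter v) (y (orbit_repr v)).

Definition stabilizer_compatible (y : A -> B) : Prop :=
  forall u g, V u -> act g u = u -> act g (y u) = y u.

Lemma orbit_repr_V v : V v -> V (orbit_repr v).
Proof. by rewrite -{1}(transporterE v) => /act_vertices. Qed.

Lemma orbit_repr_id v : orbit_repr (orbit_repr v) = orbit_repr v.
Proof. by rewrite -{2}(transporterE v) orbit_repr_act. Qed.

Lemma extension_equivariant y : stabilizer_compatible y ->
  equivariant (extension y).
Proof.
move=> yc g v Vv; rewrite /extension orbit_repr_act.
set u := orbit_repr v; have Vu : V u by exact: orbit_repr_V.
have H : act ((transporter (act g v))^-1 * (g * transporter v))%g u = u.
  apply: (act_inj (g := transporter (act g v))).
  have uE : orbit_repr (act g v) = u by exact: orbit_repr_act.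
  by rewrite -{2}uE transporterE 2!gt_actM actVK transporterE.
have := yc u _ Vu H => /(congr1 (act (transporter (act g v)))).
by rewrite 2!gt_actM actVK => <-.
Qed.

Lemma extensionE f v : equivariant f -> V v -> extension f v = f v.
Proof.
move=> fe Vv; rewrite /extension -fe ?transporterE//.
exact: orbit_repr_V.
Qed.

Lemma eq_stretching f f' : equivariant f -> (forall v, V v -> f v = f' v) ->
  stretching f = stretching f'.
Proof.
move=> fe H; rewrite /stretching big_seq [RHS]big_seq;
  apply: eq_bigr => e /es_adj uv.
by have [V1 V2] := adj_V uv; rewrite !H.
Qed.

End EquivariantMaps.

(** * Discreteness of the vertex distances *)

Section VertexDistances.
Variables (R : realType) (G : groupType) (T : Gtree R G) (es : seq (T * T)).
Local Notation d := (@mdist R T).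
Local Notation adj := (Defs.adjacent (vertices T) (edges T)).
Hypotheses (es_adj : forall e, e \in es -> adj e.1 e.2)
  (es_orbit : forall u v : T, adj u v -> exists g, (act g u, act g v) \in es).

Let lengths := [seq d e.1 e.2 | e <- es].

Lemma adj_length (u v : T) : adj u v -> d u v \in lengths.
Proof.
move=> /es_orbit[g gE]; apply/mapP; exists (act g u, act g v) => //=.
by rewrite gt_isometry.
Qed.

Lemma finitely_many_edge_lengths : exists ls : seq R,
  forall x : T, exists p q, [/\ vertices T p, vertices T q, between p x q & d p q \in ls].
Proof.
exists (0 :: lengths) => x; have [Vx|[u [v [uv ux]]]] := gt_cover x.
  by exists x, x; split; rewrite ?mdist_refl ?inE ?eqxx//; exact: between_refl.
have [Vu Vv] := adj_V uv; exists u, v; split=> //.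
by rewrite inE adj_length ?orbT.
Qed.

(** Edge lengths are bounded below by some m > 0, so a path of length at most [M] has at most M / m
    edges, and its length is one of finitely many sums. This replaces local finiteness of the
    tree. *)
Lemma finitely_many_vertex_distances (M : R) : exists ls : seq R,
  forall u v, vertices T u -> vertices T v -> d u v <= M -> d u v \in ls.
Proof.
have [m m0 mE] : exists2 m : R, 0 < m & forall u v, adj u v -> m <= d u v.
  have pos l : l \in lengths -> 0 < l.
    by move=> /mapP[e /es_adj/adj_gt0 e0 ->].
  have [m m0 mE] : exists2 m : R, 0 < m & forall l, l \in lengths -> m <= l.
    elim: lengths pos => [|l s IH] pos; first by exists 1.
    have [l' l's|m m0 mE] := IH; first by apply: pos; rewrite inE l's orbT.
    exists (Num.min l m).
      by rewrite lt_min m0 pos// inE eqxx.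
    move=> l'; rewrite inE ge_min => /orP[/eqP->|/mE ->]; first by rewrite lexx.
    by rewrite orbT.
  by exists m => // u v /adj_length/mE.
pose fix sums (n : nat) : seq R :=
  if n is n'.+1 then 0 :: [seq l + x | l <- lengths, x <- sums n'] else [:: 0].
have sumsP n (u : T) s : path adj u s -> (size s <= n)%N -> path_length u s \in sums n.
  elim: n u s => [|n IH] u [|v s] //=.
  - by rewrite /path_length big_nil inE eqxx.
  - by rewrite /path_length big_nil inE eqxx.
  - move=> /andP[uv ps] sn; rewrite path_length_cons inE; apply/orP; right.
    by apply: allpairs_f; [exact: adj_length|exact: IH].
have sizeP (u : T) s : path adj u s -> (size s)%:R * m <= path_length u s.
  elim: s u => [|v s IH] u /=; first by rewrite mul0r /path_length big_nil.
  move=> /andP[/mE uv /IH ps]; rewrite path_length_cons mulrSr mulrDl mul1r.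
  by rewrite addrC lerD.
exists (sums (Num.truncn (M / m)).+1) => u v Vu Vv.
have [s [ps ls ->]] := gt_path Vu Vv => sM; apply: sumsP => //.
have : (size s)%:R <= M / m.
  by rewrite ler_pdivlMr//; exact: le_trans (sizeP _ _ ps) sM.
move=> H; have : (size s)%:R < (Num.truncn (M / m)).+1%:R :> R.
  exact: le_lt_trans H (truncnS_gt _).
by rewrite ltr_nat => /ltnW.
Qed.

End VertexDistances.

Lemma seqs_over_finite (X : eqType) (xs : seq X) n : exists L : seq (seq X),
  forall s, size s = n -> {subset s <= xs} -> s \in L.
Proof.
elim: n => [|n [L HL]]; first by exists [:: [::]] => s /size0nil ->.
exists [seq a :: t | a <- xs, t <- L] => -[|a t] //= [st] sub.
apply: allpairs_f; first by apply: sub; rewrite inE eqxx.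
by apply: HL => // b bt; apply: sub; rewrite inE bt orbT.
Qed.

Lemma seq_min_exists (R : realType) (s : seq R) (P : R -> Prop) :
  (exists2 r, r \in s & P r) ->
  exists2 m, P m & forall r, r \in s -> P r -> m <= r.
Proof.
elim: s => [|a s IH] [r]; first by rewrite in_nil.
rewrite inE => /orP[/eqP-> Pa|rs Pr].
  have [/IH[m Pm mm]|ne] := pselect (exists2 r, r \in s & P r).
    have [am|/ltW ma] := leP a m.
      exists a => // b; rewrite inE => /orP[/eqP->//|bs /(mm _ bs)].
      exact: le_trans.
    by exists m => // b; rewrite inE => /orP[/eqP->//|]; exact: mm.
  exists a => // b; rewrite inE => /orP[/eqP->//|bs Pb].
  by case: ne; exists b.
have [|m Pm mm] := IH; first by exists r.
have [Pa|nPa] := pselect (P a); last first.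
  by exists m => // b; rewrite inE => /orP[/eqP->//|]; exact: mm.
have [am|/ltW ma] := leP a m.
  exists a => // b; rewrite inE => /orP[/eqP->//|bs /(mm _ bs)].
  exact: le_trans.
by exists m => // b; rewrite inE => /orP[/eqP->//|]; exact: mm.
Qed.

Section OptimalMap.
Variables (R : realType) (G : groupType) (A B : Gtree R G).
Local Notation dA := (@mdist R A).
Local Notation dB := (@mdist R B).
Local Notation V := (vertices A).
Variable es : seq (A * A).
Implicit Types (u v w : A) (f y : A -> B) (g : G) (P Q : A -> B) (t : A -> R).

(* A configuration confines each [f u] to the segment [P u, Q u] between two
   vertices; the points of these segments are then coordinatized by
   [t u = d(P u, f u)]. *)
Definition configuration P Q : Prop := forall u, V u ->
  [/\ vertices B (P u), vertices B (Q u) & forall g, g <> 1%g -> act g u = u ->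
      P u = Q u /\ act g (P u) = P u].

Definition in_box P Q t : Prop := forall u, 0 <= t u <= dB (P u) (Q u).

Definition segment_point (p q : B) (s : R) : B :=
  xget p [set z | dB p z = s /\ between p z q].

Lemma segment_pointP p q s : 0 <= s <= dB p q ->
  dB p (segment_point p q s) = s /\ between p (segment_point p q s) q.
Proof.
move=> /(gt_geodesic (T := B))[z z1 z2]; rewrite /segment_point.
by case: xgetP => [x -> //|/(_ z)]; case.
Qed.

Definition placed P Q t u := segment_point (P u) (Q u) (t u).

Definition config_map P Q t : A -> B := extension (placed P Q t).

Lemma placed_compatible P Q t : configuration P Q -> in_box P Q t ->
  stabilizer_compatible (placed P Q t).
Proof.
move=> cPQ tb u g Vu gu; have [->|/eqP g1] := eqVneq g 1%g; first exact: gt_act1.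
have [_ _ /(_ g g1 gu)[PQ gP]] := cPQ u Vu.
have [pd pb] := segment_pointP (tb u); rewrite -/(placed P Q t u) in pd pb.
suff <- : P u = placed P Q t u by [].
by apply/mdist_eq0; move: pb; rewrite /between -PQ mdist_refl;
  have := mdist_nneg (P u) (placed P Q t u);
  have := mdist_nneg (placed P Q t u) (P u); lra.
Qed.

Lemma config_map_equivariant P Q t : configuration P Q -> in_box P Q t ->
  equivariant (config_map P Q t).
Proof. by move=> cPQ tb; apply: extension_equivariant;
  exact: placed_compatible. Qed.

(** The combinatorial type of a configuration as seen by one edge: apart from the coordinates, the
    stretched length of the edge depends on nothing else. *)
Definition config_data P Q (e : A * A) : R * R * (R * R * R * R) :=
  let u := orbit_repr e.1 in let v := orbit_repr e.2 in
  let a := transporter e.1 in let b := transporter e.2 in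
  (dB (P u) (Q u), dB (P v) (Q v),
   (dB (act a (P u)) (act b (P v)), dB (act a (P u)) (act b (Q v)),
    dB (act a (Q u)) (act b (P v)), dB (act a (Q u)) (act b (Q v)))).

(** This is [between_dist_max] applied at both ends, with [s] and [s'] the positions on the two
    segments. [D.1] holds the segment lengths, [D.2] the distances between their ends in the order
    PP, PQ, QP, QQ. *)
Definition data_dist (D : R * R * (R * R * R * R)) (s s' : R) : R :=
  Num.max (Num.max (D.2.1.1.1 - s' - s) (D.2.1.1.2 - (D.1.2 - s') - s))
          (Num.max (D.2.1.2 - s' - (D.1.1 - s)) (D.2.2 - (D.1.2 - s') - (D.1.1 - s))).

Lemma max_subr (a b c : R) : Num.max a b - c = Num.max (a - c) (b - c).
Proof. by rewrite addr_maxl. Qed.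

Lemma config_map_dist P Q t (e : A * A) : configuration P Q -> in_box P Q t ->
  dB (config_map P Q t e.1) (config_map P Q t e.2) =
  data_dist (config_data P Q e) (t (orbit_repr e.1)) (t (orbit_repr e.2)).
Proof.
move=> cPQ tb; rewrite /config_map /extension /data_dist /=.
set u := orbit_repr e.1; set v := orbit_repr e.2.
set a := transporter e.1; set b := transporter e.2.
have [ud ub] := segment_pointP (tb u); have [vd vb] := segment_pointP (tb v).
rewrite -/(placed P Q t u) -/(placed P Q t v) in ud ub vd vb.
set y := placed P Q t u in ud ub *; set z := placed P Q t v in vd vb *.
have yb : between (act a (P u)) (act a y) (act a (Q u)) by apply/act_between.
have zb : between (act b (P v)) (act b z) (act b (Q v)) by apply/act_between.
have four := gt_four_point (T := B).
have zd (w : B) : dB w (act b z) = Num.max (dB w (act b (P v)) - t v)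
    (dB w (act b (Q v)) - (dB (P v) (Q v) - t v)).
  rewrite mdistC (between_dist_max four w zb) gt_isometry vd.
  have -> : dB (act b (Q v)) (act b z) = dB (P v) (Q v) - t v.
    by rewrite gt_isometry mdistC (vb : _ = _) vd; lra.
  by rewrite (mdistC w) (mdistC w (act b (Q v))).
rewrite (between_dist_max four (act b z) yb) gt_isometry ud.
have -> : dB (act a (Q u)) (act a y) = dB (P u) (Q u) - t u.
  by rewrite gt_isometry mdistC (ub : _ = _) ud; lra.
by rewrite !zd !max_subr.
Qed.

Definition config_stretching (D : A * A -> R * R * (R * R * R * R)) t : R :=
  \big[Num.max/0]_(e <- es)
    (data_dist (D e) (t (orbit_repr e.1)) (t (orbit_repr e.2)) / dA e.1 e.2).

Lemma config_stretchingE P Q t : configuration P Q -> in_box P Q t ->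
  stretching es (config_map P Q t) = config_stretching (config_data P Q) t.
Proof.
move=> cPQ tb; rewrite /stretching /config_stretching.
by apply: eq_bigr => e _; rewrite config_map_dist.
Qed.

Lemma continuous_data_dist (T : topologicalType) D (alpha beta : T -> R) :
  continuous alpha -> continuous beta ->
  continuous (fun t : T => data_dist D (alpha t) (beta t)).
Proof.
move=> ca cb t.
have aff c l (f : T -> R) : continuous f -> {for t, continuous (fun t : T => c - (l - f t))}.
  move=> cf; apply: continuousB; first exact: cst_continuous.
  by apply: continuousB; [exact: cst_continuous|exact: cf].
have aff' c (f : T -> R) : continuous f -> {for t, continuous (fun t : T => c - f t)}.
  by move=> cf; apply: continuousB; [exact: cst_continuous|exact: cf].
apply: (@continuous_max R T); apply: (@continuous_max R T).
- by apply: continuousB; [exact: aff'|exact: ca].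
- by apply: continuousB; [exact: aff|exact: ca].
- apply: continuousB; first exact: aff'.
  by apply: continuousB; [exact: cst_continuous|exact: ca].
- apply: continuousB; first exact: aff.
  by apply: continuousB; [exact: cst_continuous|exact: ca].
Qed.

Lemma continuous_bigmax (T : topologicalType) (I : eqType) (s : seq I)
    (F : I -> T -> R) : (forall i, continuous (F i)) ->
  continuous (fun t : T => \big[Num.max/0]_(i <- s) F i t).
Proof.
move=> cF; elim: s => [|i s IH].
  have -> : (fun t : T => \big[Num.max/0]_(i <- [::]) F i t) = (fun=> 0).
    by apply/funext => t; rewrite big_nil.
  by move=> t; exact: cvg_cst.
have -> : (fun t : T => \big[Num.max/0]_(i <- i :: s) F i t) =
    (F i \max (fun t : T => \big[Num.max/0]_(i <- s) F i t)).
  by apply/funext => t; rewrite big_cons.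
by move=> t; apply: (@continuous_max R T); [exact: cF|exact: IH].
Qed.

Lemma continuous_config_stretching D :
  continuous (config_stretching D : prod_topology (fun _ : A => R) -> R).
Proof.
apply: (@continuous_bigmax (prod_topology (fun _ : A => R)) _ es
  (fun e (t : prod_topology (fun _ : A => R)) =>
    data_dist (D e) (t (orbit_repr e.1)) (t (orbit_repr e.2)) / dA e.1 e.2)).
move=> e t; apply: (@continuousM R (prod_topology (fun _ : A => R))
  (fun t : prod_topology (fun _ : A => R) =>
    data_dist (D e) (t (orbit_repr e.1)) (t (orbit_repr e.2)))
  (fun=> (dA e.1 e.2)^-1)); last exact: cst_continuous.
exact: (@continuous_data_dist (prod_topology (fun _ : A => R)) (D e)
  (fun t : prod_topology (fun _ : A => R) => t (orbit_repr e.1))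
  (fun t : prod_topology (fun _ : A => R) => t (orbit_repr e.2))
  (@proj_continuous A (fun _ => R) _) (@proj_continuous A (fun _ => R) _)).
Qed.

(** Coordinates are indexed by all points of A, so the box is a possibly infinite product of
    intervals, compact by Tychonoff; the function to be minimized depends on finitely many of
    them. *)
Lemma config_min P Q : exists2 t, in_box P Q t & forall t', in_box P Q t' ->
  config_stretching (config_data P Q) t <= config_stretching (config_data P Q) t'.
Proof.
pose box : set (prod_topology (fun _ : A => R)) :=
  [set t | forall u, `[0, dB (P u) (Q u)]%classic (t u)].
have boxE t : box t <-> in_box P Q t.
  by split=> H u; have := H u; rewrite /= in_itv.
have cb : compact box.
  exact: (@tychonoff A (fun _ => R) (fun u => `[0, dB (P u) (Q u)]%classic)
    (fun u => @segment_compact _ _ _)).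
have b0 : box !=set0.
  by exists (fun=> 0); apply/boxE => u; rewrite lexx mdist_nneg.
have cf : {within box, continuous
    (config_stretching (config_data P Q) : prod_topology (fun _ : A => R) -> R)}.
  exact: (@continuous_subspaceT (prod_topology (fun _ : A => R)) R box _
    (@continuous_config_stretching (config_data P Q))).
have [t tb tm] := compact_EVT_min b0 cb cf.
exists t; first by apply/boxE; exact: set_mem.
by move=> t' /boxE t'b; apply: tm; exact: mem_set.
Qed.

End OptimalMap.

Section OptimalMapExists.
Variables (R : realType) (G : groupType) (A B : Gtree R G).
Local Notation dA := (@mdist R A).
Local Notation dB := (@mdist R B).
Local Notation V := (vertices A).
Local Notation adjA := (Defs.adjacent (vertices A) (edges A)).
Local Notation adjB := (Defs.adjacent (vertices B) (edges B)).
Variables (es : seq (A * A)) (es' : seq (B * B)).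
Hypotheses (es_adj : forall e, e \in es -> adjA e.1 e.2)
  (es_orbit : forall u v : A, adjA u v -> exists g, (act g u, act g v) \in es).
Hypotheses (es'_adj : forall e, e \in es' -> adjB e.1 e.2)
  (es'_orbit : forall u v : B, adjB u v -> exists g, (act g u, act g v) \in es').
Hypothesis edgeB : forall e, edges B e -> edge_stabilizer e = [set 1%g].
Implicit Types (u v w : A) (f y : A -> B) (g : G) (P Q : A -> B) (t : A -> R).

(** A free vertex is confined to an edge of B containing its image, or to the image itself if that
    is a vertex. The image of a nonfree vertex is fixed by a nontrivial element, hence is a vertex
    of B, and its segment is reduced to that point. *)
Lemma config_of_map : exists ls : seq R, forall f, equivariant f ->
  exists P Q, [/\ configuration P Q, forall u, between (P u) (f u) (Q u)
    & forall u, dB (P u) (Q u) \in ls].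
Proof.
have [ls Hls] := finitely_many_edge_lengths es'_orbit.
have /choice[p /choice[q pq]] := Hls.
exists (0 :: ls) => f fe.
pose nonfree u := `[< exists2 g, g <> 1%g & act g u = u >].
exists (fun u => if nonfree u then f u else p (f u)),
  (fun u => if nonfree u then f u else q (f u)); split.
- move=> u Vu; have [P1 P2 _ _] := pq (f u).
  case: ifPn => [/asboolP[g g1 gu]|/asboolP nf].
    have Vf : vertices B (f u).
      apply: contrapT => nV; apply: g1; apply: (fixed_nonvertex edgeB nV).
      by rewrite -fe// gu.
    by split=> // h _ hu; split=> //; rewrite -fe// hu.
  by split=> // g g1 gu; case: nf; exists g.
- move=> u; case: ifP => _; first exact: between_refl.
  by have [] := pq (f u).
- move=> u; case: ifP => _; first by rewrite mdist_refl inE eqxx.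
  by have [_ _ _ ?] := pq (f u); rewrite inE; apply/orP; right.
Qed.

Lemma config_map_coordinates f P Q : equivariant f -> configuration P Q ->
  (forall u, between (P u) (f u) (Q u)) ->
  in_box P Q (fun u => dB (P u) (f u)) /\
  forall v, V v -> config_map P Q (fun u => dB (P u) (f u)) v = f v.
Proof.
move=> fe cPQ fb; have tb : in_box P Q (fun u => dB (P u) (f u)).
  by move=> u; rewrite mdist_nneg/= (fb u : _ = _) lerDl mdist_nneg.
split=> // v Vv; rewrite /config_map -[RHS](extensionE fe Vv) /extension /placed.
have [H1 H2] := segment_pointP (tb (orbit_repr v)).
by rewrite (between_uniq (gt_four_point (T := B)) H2 (fb _) H1).
Qed.

Lemma same_data_stretching P Q P' Q' t :
  (forall e, e \in es -> config_data P Q e = config_data P' Q' e) ->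
  in_box P Q t -> exists2 t', in_box P' Q' t' &
    config_stretching es (config_data P' Q') t' = config_stretching es (config_data P Q) t.
Proof.
(* Coordinates are truncated to fit the new box; at the representatives of the ends of [es], where
   the data agree, this changes nothing. *)
move=> PQ tb; exists (fun u => Num.min (t u) (dB (P' u) (Q' u))).
  move=> u; rewrite le_min ge_min lexx orbT andbT mdist_nneg andbT.
  by have /andP[] := tb u.
rewrite /config_stretching big_seq [RHS]big_seq; apply: eq_bigr => e /PQ E.
rewrite -E; have [E1 E2 _ _ _ _] := E.
rewrite -E1 -E2 !min_l//; by have /andP[] := tb (orbit_repr e.1);
  have /andP[] := tb (orbit_repr e.2).
Qed.

Lemma config_data_finite (C : R) (ls : seq R) :
  exists L : seq (seq (R * R * (R * R * R * R))), forall f P Q,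
    equivariant f -> configuration P Q -> (forall u, between (P u) (f u) (Q u)) ->
    (forall u, dB (P u) (Q u) \in ls) -> stretching es f <= C ->
    [seq config_data P Q e | e <- es] \in L.
Proof.
pose lm : R := \big[Num.max/0]_(l <- ls) l.
pose LA : R := \big[Num.max/0]_(e <- es) dA e.1 e.2.
(* The bound goes from an end of one segment to the image of a vertex, across the image of an edge
   stretched at most by [C], and on to an end of the other segment. *)
have [DL HDL] := finitely_many_vertex_distances es'_adj es'_orbit (lm + C * LA + lm).
pose XL := [seq (x, c) | x <- [seq (l, l') | l <- ls, l' <- ls],
  c <- [seq (z, b) | z <- [seq (z, b) | z <- [seq (a, b) | a <- DL, b <- DL], b <- DL],
          b <- DL]].
have [L HL] := seqs_over_finite XL (size es).
exists L => f P Q fe cPQ fb Pl fC; apply: HL; first by rewrite size_map.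
move=> _ /mapP[e ee ->]; rewrite /config_data.
set u := orbit_repr e.1; set v := orbit_repr e.2.
have [V1 V2] := adj_V (es_adj ee).
have [VPu VQu _] := cPQ u (orbit_repr_V V1);
  have [VPv VQv _] := cPQ v (orbit_repr_V V2).
have lmP w (x : B) : x = P w \/ x = Q w -> dB x (f w) <= lm.
  move=> xPQ; apply: (@le_trans _ _ (dB (P w) (Q w))); last first.
    exact: (bigmax_seq_ge id (Pl w)).
  by case: xPQ => ->;
    rewrite (fb w : _ = _) ?lerDl ?mdist_nneg// (mdistC (Q w)) lerDr mdist_nneg.
have fd : dB (f e.1) (f e.2) <= C * LA.
  have H0 := adj_gt0 (es_adj ee).
  apply: (@le_trans _ _ (C * dA e.1 e.2)).
    rewrite -ler_pdivrMr//; apply: le_trans fC.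
    exact: (bigmax_seq_ge (fun e => dB (f e.1) (f e.2) / dA e.1 e.2) ee).
  apply: ler_wpM2l; first exact: le_trans (stretching_ge0 es f) fC.
  exact: (bigmax_seq_ge (fun e => dA e.1 e.2) ee).
have bound (x y : B) : x = P u \/ x = Q u -> y = P v \/ y = Q v ->
    dB (act (transporter e.1) x) (act (transporter e.2) y) \in DL.
  move=> xu yv; apply: HDL.
  - by apply: gt_vertices; case: xu => ->.
  - by apply: gt_vertices; case: yv => ->.
  have := mdist_triangle (f e.1) (act (transporter e.1) x) (act (transporter e.2) y).
  have := mdist_triangle (f e.2) (f e.1) (act (transporter e.2) y).
  have := lmP u x xu; have := lmP v y yv.
  have E1 : act (transporter e.1) (f u) = f e.1.
    by rewrite -fe ?transporterE//; exact: orbit_repr_V.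
  have E2 : act (transporter e.2) (f v) = f e.2.
    by rewrite -fe ?transporterE//; exact: orbit_repr_V.
  rewrite -(gt_isometry (transporter e.1) x) E1.
  rewrite -(gt_isometry (transporter e.2) y) E2 (mdistC _ (f e.2)).
  by move: fd; lra.
rewrite /XL; apply: allpairs_f; first by apply: allpairs_f; exact: Pl.
do 3?[apply: allpairs_f]; apply: bound; by [left|right].
Qed.

Hypothesis stab_fixed : forall u, V u ->
  exists z : B, forall g, act g u = u -> act g z = z.

Lemma equivariant_exists : exists f : A -> B, equivariant f.
Proof.
have /choice[y Hy] u : exists z : B, V u -> forall g, act g u = u -> act g z = z.
  have [/stab_fixed[z Hz]|nV] := pselect (V u); first by exists z.
  by have [z _] := st_nonempty (gt_tree B); exists z.
exists (extension y); apply: extension_equivariant => u g Vu; exact: Hy.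
Qed.

(** The minimum is taken inside each combinatorial type, over a compact box, and then over the
    finitely many types of maps that do no worse than a given [f0]. *)
Lemma optimal_map_exists : exists2 f : A -> B, equivariant f &
  forall f' : A -> B, equivariant f' -> stretching es f <= stretching es f'.
Proof.
have [f0 f0e] := equivariant_exists.
have [ls Hls] := config_of_map.
have [L HL] := config_data_finite (stretching es f0) ls.
pose ty P Q := [seq config_data P Q e | e <- es].
have /choice[mu Hmu] tau : exists r, (exists P Q, configuration P Q /\ ty P Q = tau) ->
    (exists2 f : A -> B, equivariant f & stretching es f = r) /\
    forall P Q t, configuration P Q -> ty P Q = tau -> in_box P Q t ->
      r <= config_stretching es (config_data P Q) t.
  have [[P [Q [cPQ tyE]]]|ne] :=
    pselect (exists P Q, configuration P Q /\ ty P Q = tau); last by exists 0.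
  have [t tb tm] := config_min es P Q.
  exists (config_stretching es (config_data P Q) t) => _; split.
    exists (config_map P Q t); first exact: config_map_equivariant.
    exact: config_stretchingE.
  move=> P' Q' t' cPQ' tyE' tb'.
  have PP e : e \in es -> config_data P' Q' e = config_data P Q e.
    by have /eq_in_map H : ty P' Q' = ty P Q; [rewrite tyE tyE'|exact: H].
  have [t'' tb'' <-] := same_data_stretching PP tb'.
  exact: tm.
have key f : equivariant f -> stretching es f <= stretching es f0 ->
    exists r, [/\ r \in map mu L, exists2 f' : A -> B, equivariant f' & stretching es f' = r
      & r <= stretching es f].
  move=> fe fC; have [P [Q [cPQ fb Pl]]] := Hls f fe.
  have tyL := HL f P Q fe cPQ fb Pl fC.
  have [tb tE] := config_map_coordinates fe cPQ fb.
  have [|H1 H2] := Hmu (ty P Q); first by exists P, Q.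
  exists (mu (ty P Q)); split=> //; first exact: map_f.
  have := H2 P Q _ cPQ erefl tb; rewrite -config_stretchingE//.
  by rewrite (eq_stretching es_adj (config_map_equivariant cPQ tb) tE).
(* [L] may contain lists that are the type of no configuration, and [mu] is arbitrary there; so the
   minimum is taken among values that some equivariant map attains. *)
have [|m [f fe fm] mm] := @seq_min_exists R (map mu L)
    (fun r => exists2 f : A -> B, equivariant f & stretching es f = r).
  by have [r [rL rf _]] := key f0 f0e (lexx _); exists r.
exists f => // f' fe'; rewrite fm.
have [fC|/ltW fC] := leP (stretching es f') (stretching es f0).
  have [r [rL rf rle]] := key f' fe' fC.
  exact: le_trans (mm r rL rf) rle.
have [r [rL rf rle]] := key f0 f0e (lexx _).
exact: le_trans (mm r rL rf) (le_trans rle fC).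
Qed.

End OptimalMapExists.

(** * Gates in the tension graph *)

Lemma sub_count_strict (T : eqType) (a b : pred T) (s : seq T) x :
  (forall y, y \in s -> a y -> b y) -> x \in s -> b x -> ~~ a x ->
  (count a s < count b s)%N.
Proof.
move=> ab xs bx ax; elim: s ab xs => // y s IH ab /=.
have abs : (count a s <= count b s)%N.
  rewrite (@eq_in_count _ a (predI a b)); first by apply: sub_count => z /andP[].
  move=> z zs /=; have := ab z; rewrite inE zs orbT => /(_ isT).
  by case: (a z) => // ->.
rewrite inE => /orP[/eqP<-|xs]; first by rewrite bx (negPf ax).
have ayb : (a y <= b y)%N by have := ab y (mem_head _ _); case: (a y) => // ->.
rewrite -addnS; apply: leq_add => //; apply: IH => // z zs; apply: ab.
by rewrite inE zs orbT.
Qed.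

Section TensionGates.
Variables (R : realType) (G : groupType) (A B : Gtree R G).
Local Notation dA := (@mdist R A).
Local Notation dB := (@mdist R B).
Local Notation V := (vertices A).
Local Notation adj := (Defs.adjacent (vertices A) (edges A)).
Variables (es : seq (A * A)).
Hypotheses (es_adj : forall e, e \in es -> adj e.1 e.2)
  (es_orbit : forall u v : A, adj u v -> exists g, (act g u, act g v) \in es).
Implicit Types (u v w : A) (f : A -> B) (g : G).

Definition tense (f : A -> B) (r : R) u v : bool := dB (f u) (f v) == r * dA u v.

Definition tension_count f r : nat := count (fun e => tense f r e.1 e.2) es.

Lemma common_step (P : A * A -> R -> Prop) :
  (forall e s t, P e t -> 0 < s <= t -> P e s) ->
  (forall e, e \in es -> exists2 t, 0 < t & P e t) ->
  exists2 t, 0 < t & forall e, e \in es -> P e t.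
Proof.
move=> mono; elim: es => [|e s IH] H; first by exists 1.
have [|t t0 tP] := IH; first by move=> e' es'; apply: H; rewrite inE es' orbT.
have [|t' t'0 t'P] := H e; first by rewrite inE eqxx.
have m0 : 0 < Num.min t t' by rewrite lt_min t0.
exists (Num.min t t') => // e'; rewrite inE => /orP[/eqP->|/tP e'P].
  by apply: mono t'P _; rewrite m0 ge_min lexx orbT.
by apply: mono e'P _; rewrite m0 ge_min lexx.
Qed.

Section Perturbation.
Variables (f : A -> B) (r : R) (u v : A) (z : B) (t : R).
Hypotheses (fe : equivariant f) (Vu : V u) (u_free : forall g, act g u = u -> g = 1%g).

(** [z] is the new image of [u]. The inverse transporter appears because [extension] prescribes
    values at the orbit representative. *)
Definition moved (w : A) : B :=
  if orbit_repr w == orbit_repr u then act (transporter u)^-1 z else f w.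

Lemma moved_compatible : stabilizer_compatible moved.
Proof.
move=> w g Vw gw; rewrite /moved; case: ifP => [/eqP/orbit_reprP[h hw]|_].
  have -> : g = 1%g; last exact: gt_act1.
  have /u_free : act (h * g * h^-1)%g u = u by rewrite !gt_actM -hw actK gw.
  by move=> /(congr1 (fun k => h^-1 * k * h)%g);
    rewrite !mulgA mulVg mul1g mulg1 mulgVK mulVg.
by rewrite -fe// gw.
Qed.

Definition perturbed : A -> B := extension moved.

Lemma perturbed_equivariant : equivariant perturbed.
Proof. exact: extension_equivariant moved_compatible. Qed.

Lemma perturbed_u : perturbed u = z.
Proof. by rewrite /perturbed /extension /moved orbit_repr_id eqxx actVK. Qed.

Lemma perturbed_act g : perturbed (act g u) = act g z.
Proof. by rewrite perturbed_equivariant// perturbed_u. Qed.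

Lemma perturbed_other w : V w -> (forall g, act g u <> w) -> perturbed w = f w.
Proof.
move=> Vw wu; rewrite -[RHS](extensionE fe Vw) /perturbed /extension /moved.
rewrite orbit_repr_id; case: eqP => // /esym/orbit_reprP[g gE].
by case: (wu g).
Qed.

Hypotheses (t_gt0 : 0 < t) (z_dist : dB (f u) z = t).
Hypothesis tense_between : forall w, adj u w -> tense f r u w ->
  t < dB (f u) (f w) /\ between (f u) z (f w).
Hypothesis slack_gap : forall w, adj u w -> ~~ tense f r u w ->
  dB (f u) (f w) + 2 * t < r * dA u w.
Hypothesis f_lip : forall a b, adj a b -> dB (f a) (f b) <= r * dA a b.

Lemma perturbed_at w : adj u w ->
  dB (perturbed u) (perturbed w) < r * dA u w.
Proof.
move=> uw; rewrite perturbed_u; have [_ Vw] := adj_V uw; have t0 := t_gt0.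
have zd := z_dist; have czu := mdistC z (f u).
have [[h hu]|wu] := pselect (exists h, act h u = w); last first.
  rewrite perturbed_other//; last by move=> g gE; apply: wu; exists g.
  have [T|T] := boolP (tense f r u w).
    have [_] := tense_between uw T; rewrite /between z_dist (eqP T); lra.
  have := slack_gap uw T; have := mdist_triangle (f u) z (f w); lra.
rewrite -hu perturbed_act; rewrite -hu in uw.
have fhu : f (act h u) = act h (f u) by exact: fe.
have [T|T] := boolP (tense f r u (act h u)); last first.
  have := slack_gap uw T; rewrite fhu; have := mdist_triangle (f u) z (act h z).
  have := mdist_triangle (act h (f u)) (f u) (act h z).
  by have := gt_isometry h (f u) z; lra.
have [t1] := tense_between uw T; rewrite fhu => b1.
(* Read from its other end, the edge is a translate of a tense edge from [u] to h^-1 u. So [z] and h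
   z both lie on the image segment, at distance [t] from opposite ends. *)
have uw' : adj u (act h^-1%g u) by apply: adj_sym; rewrite -(act_adj h) actVK.
have T' : tense f r u (act h^-1%g u).
  have E1 : dB (f u) (f (act h^-1 u)) = dB (f u) (f (act h u)).
    by rewrite !fe// -(gt_isometry h (f u)) actVK mdistC.
  have E2 : dA u (act h^-1 u) = dA u (act h u).
    by rewrite -(gt_isometry h u) actVK mdistC.
  by rewrite /tense E1 E2.
have [_] := tense_between uw' T'; rewrite fe// => /(act_between h).
rewrite actVK => /between_sym b2.
rewrite (between_dist_norm (gt_four_point (T := B)) b1 b2) z_dist.
have E : dB (f u) (act h z) = dB (f u) (f (act h u)) - t.
  by rewrite fhu (b2 : _ = _); have := gt_isometry h z (f u); lra.
rewrite E; rewrite fhu in t1 E *; have := T; rewrite /tense fhu => /eqP TE.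
by rewrite -TE ltr_norml; lra.
Qed.

Lemma perturbed_le a b : adj a b ->
  dB (perturbed a) (perturbed b) <= r * dA a b /\
  (tense perturbed r a b -> tense f r a b).
Proof.
have near c w : adj c w -> (exists h, act h u = c) ->
    dB (perturbed c) (perturbed w) < r * dA c w.
  move=> cw [h hu]; have uw : adj u (act h^-1%g w) by rewrite -(act_adj h) actVK hu.
  have [_ Vw] := adj_V uw.
  have := perturbed_at uw;
    rewrite -(gt_isometry h u) -(gt_isometry h (perturbed u)).
  by rewrite -!perturbed_equivariant// actVK hu.
move=> ab; have [Va Vb] := adj_V ab.
have strict : dB (perturbed a) (perturbed b) < r * dA a b ->
    dB (perturbed a) (perturbed b) <= r * dA a b /\
    (tense perturbed r a b -> tense f r a b).
  by move=> lt; split; [exact: ltW|rewrite /tense lt_eqF].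
have [ua|nua] := pselect (exists h, act h u = a); first by apply: strict;
  exact: near.
have [ub|nub] := pselect (exists h, act h u = b).
  apply: strict; rewrite (mdistC (perturbed a)) (mdistC a); apply: near => //;
    exact: adj_sym.
have pa : perturbed a = f a.
  by apply: perturbed_other => // g gE; apply: nua; exists g.
have pb : perturbed b = f b.
  by apply: perturbed_other => // g gE; apply: nub; exists g.
by rewrite /tense pa pb; split=> //; exact: f_lip.
Qed.

End Perturbation.

(** If all tense edges at [u] left through the gate of [v], pushing [f u] slightly towards [f v]
    would keep the stretching factor and make them slack, against the minimality of the tension
    count. *)
Lemma tension_gate f u v :
  equivariant f -> 0 < stretching es f ->
  (forall f' : A -> B, equivariant f' -> stretching es f <= stretching es f') ->
  (forall f' : A -> B, equivariant f' -> stretching es f' = stretching es f ->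
    (tension_count f (stretching es f) <= tension_count f' (stretching es f))%N) ->
  (forall g, act g u = u -> g = 1%g) -> adj u v -> tense f (stretching es f) u v ->
  exists w, [/\ adj u w, tense f (stretching es f) u w & between (f v) (f u) (f w)].
Proof.
move=> fe r0 fopt fmin u_free uv Tuv;
  set r := stretching es f in r0 fopt fmin Tuv *.
apply: contrapT => H.
have gate w : adj u w -> tense f r u w -> dB (f v) (f w) < dB (f v) (f u) + dB (f u) (f w).
  move=> uw Tuw; rewrite lt_neqAle mdist_triangle andbT; apply/eqP => b.
  by apply: H; exists w; split.
have [Vu Vv] := adj_V uv.
have tense_gt0 w : adj u w -> tense f r u w -> 0 < dB (f u) (f w).
  by move=> uw /eqP->; apply: mulr_gt0 => //; exact: adj_gt0 uw.
(* The bound on [2 * t] keeps [t] below the Gromov product of [f v] and [f w] at [f u], that is,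
   within the common initial part of the two segments. *)
pose step e t := forall g, act g e.1 = u -> let w := act g e.2 in
  (tense f r u w -> t < dB (f u) (f w) /\
    2 * t <= dB (f v) (f u) + dB (f u) (f w) - dB (f v) (f w)) /\
  (~~ tense f r u w -> dB (f u) (f w) + 2 * t < r * dA u w).
have [|e ee|t t0 tP] := @common_step step.
- move=> e s t eP st g gE; have [H1 H2] := eP g gE; split=> T.
    by have := H1 T; lra.
  by have := H2 T; lra.
- have [[g gE]|ng] := pselect (exists g, act g e.1 = u); last first.
    by exists 1 => // g gE; case: ng; exists g.
  set w := act g e.2; have uw : adj u w by rewrite -gE act_adj; exact: es_adj.
  (* As [u] is free, each listed edge has at most one translate leaving [u] from its first end,
     hence imposes at most one condition on the step. *)
  have uniq h : act h e.1 = u -> h = g.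
    move=> hE; have /u_free : act (h * g^-1)%g u = u by rewrite -{1}gE gt_actM actK.
    by move=> /(congr1 (fun k => k * g)%g); rewrite mulgVK mul1g.
  have [T|T] := boolP (tense f r u w).
    have := gate w uw T; have := tense_gt0 w uw T => dw gw.
    exists (Num.min (dB (f u) (f w) / 2)
        ((dB (f v) (f u) + dB (f u) (f w) - dB (f v) (f w)) / 2)).
      by rewrite lt_min; lra.
    move=> h /uniq ->; split; rewrite -/w; last by rewrite T.
    move=> _; case: (leP (dB (f u) (f w) / 2) _); lra.
  have := stretching_adj es_orbit fe uw; rewrite -/r le_eqVlt.
  move: (T); rewrite /tense => /negPf -> /= lt.
  exists ((r * dA u w - dB (f u) (f w)) / 3); first lra.
  move=> h /uniq ->; split; rewrite -/w; first by rewrite (negPf T).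
  by move=> _; lra.
have near w : adj u w -> (tense f r u w -> t < dB (f u) (f w) /\
    2 * t <= dB (f v) (f u) + dB (f u) (f w) - dB (f v) (f w)) /\
  (~~ tense f r u w -> dB (f u) (f w) + 2 * t < r * dA u w).
  move=> uw; have [g gE] := es_orbit uw.
  by have := tP _ gE g^-1%g; rewrite /= !actK; apply.
have [tv _] := (near v uv).1 Tuv.
have [|z zd zb] := gt_geodesic (T := B) (x := f u) (y := f v) (t := t).
  by rewrite (ltW t0) ltW.
have tense_between w : adj u w -> tense f r u w ->
    t < dB (f u) (f w) /\ between (f u) z (f w).
  move=> uw T; have [t1 t2] := (near w uw).1 T; split=> //.
  have := mdist_triangle z (f u) (f w); rewrite /between zd.
  have := zb; rewrite /between zd => zbE; have := mdistC (f v) z;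
    have := mdistC (f v) (f u).
  by case: (between_dist (gt_four_point (T := B)) (f w) zb); lra.
have f_lip a b : adj a b -> dB (f a) (f b) <= r * dA a b.
  by move=> ab; exact: (stretching_adj es_orbit fe ab).
have slack w : adj u w -> ~~ tense f r u w -> dB (f u) (f w) + 2 * t < r * dA u w.
  by move=> uw; exact: (near w uw).2.
pose f' := perturbed f u z.
have fe' : equivariant f' by exact: perturbed_equivariant.
have le' a b (ab : adj a b) :=
  perturbed_le fe Vu u_free t0 zd tense_between slack f_lip ab.
have sE : stretching es f' = r.
  apply/le_anti; rewrite fopt// andbT; apply: bigmax_seq_le; first exact: ltW.
  move=> e /es_adj ab; rewrite ler_pdivrMr; last exact: adj_gt0 ab.
  by have [] := le' _ _ ab.
have := fmin f' fe' sE; rewrite leqNgt => /negP; apply.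
have [g gE] := es_orbit uv.
rewrite /tension_count;
  apply: (@sub_count_strict _ _ _ es (act g u, act g v)) => //=.
- by move=> e /es_adj ab; have [_] := le' _ _ ab.
- by rewrite /tense !fe// !gt_isometry.
- rewrite /tense !fe'// !gt_isometry lt_eqF//.
  exact: (perturbed_at fe Vu u_free t0 zd tense_between slack uv).
Qed.

End TensionGates.

Section TrainTrack.
Variables (R : realType) (p k : nat) (Gi : 'I_p -> groupType) (G : groupType).
Variables (iota : forall i, group_hom (Gi i) G) (x : 'I_k -> G).
Hypothesis fp : is_free_product iota x.

Lemma train_track_exists (A B : Gtree R G) :
  in_outer_space iota A -> in_outer_space iota B -> Hyp R iota !=set0 ->
  exists (f : A -> B) (r : R) (es : seq (A * A)),
  [/\ equivariant f, 0 < r,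
    forall g, translation_length B g <= r * translation_length A g,
    forall u v, Defs.adjacent (vertices A) (edges A) u v ->
      exists g, (act g u, act g v) \in es
  & (exists u v, Defs.adjacent (vertices A) (edges A) u v /\ tense f r u v) /\
    forall u v, (forall g, act g u = u -> g = 1%g) ->
      Defs.adjacent (vertices A) (edges A) u v -> tense f r u v ->
      exists w, [/\ Defs.adjacent (vertices A) (edges A) u w, tense f r u w
        & between (f v) (f u) (f w)]].
Proof.
move=> oA oB [g0 [T0 [oT0 hyp0]]].
have [es [es_adj es_sym es_orbit]] := cocompact fp oA.
have [es' [es'_adj es'_sym es'_orbit]] := cocompact fp oB.
have stab_fixed u : vertices A u -> exists z : B, forall g, act g u = u -> act g z = z.
  by have [z _ Hz] := fixed_point_transfer u oA oB; exists z.
have [f1 f1e f1opt] :=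
  optimal_map_exists es_adj es'_adj es'_orbit (os_C1_edges oB) stab_fixed.
pose r := stretching es f1.
have [n [f [fe fr fn] nmin]] : exists2 n : nat, (exists f : A -> B,
      [/\ equivariant f, stretching es f = r & tension_count es f r = n])
    & forall m, (exists f : A -> B,
      [/\ equivariant f, stretching es f = r & tension_count es f r = m]) -> (n <= m)%N.
  have ex : exists n, `[< exists f : A -> B,
      [/\ equivariant f, stretching es f = r & tension_count es f r = n] >].
    by exists (tension_count es f1 r); apply/asboolP; exists f1.
  case: (ex_minnP ex) => n /asboolP nP nmin; exists n => // m mP.
  by apply: nmin; apply/asboolP.
(* With r = 0 every element of G would fix [f v], and then [g0] would fix a point of the tree in
   which it is hyperbolic. *)
have r0 : 0 < r.
  rewrite lt_neqAle stretching_ge0 andbT; apply/eqP => rE.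
  have [v Vv] := st_nonempty (gt_tree A).
  have fixed g : act g (f v) = f v.
    rewrite -fe//; apply/mdist_eq0/le_anti; rewrite mdist_nneg andbT.
    have := stretching_lipschitz es_orbit fe (gt_vertices g Vv) Vv.
    by rewrite fr -rE mul0r.
  have [y _ Hy] := fixed_point_transfer (f v) oB oT0.
  exact: (hyp0 y (Hy g0 (fixed g0))).
exists f, r, es; split=> //.
- by move=> g; rewrite -fr;
  exact: (translation_length_stretching es_orbit (os_C1_edges oA)).
split.
  have : 0 < stretching es f by rewrite fr.
  move=> /bigmax_seq_attained[e ee eE]; exists e.1, e.2; have uv := es_adj _ ee.
  split=> //; rewrite /tense -fr -[stretching es f]eE divfK// gt_eqF//.
  exact: adj_gt0 uv.
move=> u v uf uv; rewrite -fr => T.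
apply: (tension_gate es_adj es_orbit fe) => //; rewrite fr//.
move=> f' fe' f'r; rewrite fn; apply: nmin; exists f'; split=> //.
Qed.

End TrainTrack.

Section EdgePaths.
Variables (R : realType) (T : metricType R).
Local Notation d := (@mdist R T).
Hypothesis T4 : four_point T.

Lemma turns_path_between (e : T * T) es y : e.1 <> e.2 ->
  (forall e', e' \in es -> e'.1 <> e'.2) -> path (@turns R T) e es ->
  between e.1 y (last e es).2 <-> exists2 e', e' \in e :: es & between e'.1 y e'.2.
Proof.
move=> e12; elim/last_ind: es => [|es a IH] aes pe.
  split=> [H|[e']]; first by exists e; rewrite ?inE.
  by rewrite inE => /eqP->.
have [_] := turns_path T4 e12 aes pe; rewrite last_rcons => xm.
have aes' e' : e' \in es -> e'.1 <> e'.2.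
  by move=> e'es; apply: aes; rewrite mem_rcons inE e'es orbT.
move: pe; rewrite rcons_path => /andP[pe /asboolP[la _]].
have {}IH := IH aes' pe; rewrite la in IH.
split=> [xy|[e' e'es e'y]].
  have [le|/ltW le] := leP (d e.1 y) (d e.1 a.1).
    have /IH[e' e'es H] : between e.1 y a.1.
      by rewrite /between (between_dist_norm T4 xy xm) ler0_norm; lra.
    by exists e' => //; rewrite -rcons_cons mem_rcons inE e'es orbT.
  exists a; first by rewrite -rcons_cons mem_rcons mem_head.
  have := between_dist_norm T4 xm xy; rewrite ler0_norm; last lra.
  by move: xm xy; rewrite /between; lra.
move: e'es; rewrite -rcons_cons mem_rcons inE => /orP[/eqP e'a|e'es].
  rewrite e'a in e'y; apply: between_sym.
  exact: between_transr (between_sym xm) (between_sym e'y).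
apply: between_transr xm _; apply/IH; by exists e'.
Qed.

End EdgePaths.

(** * Arcs and loops in the quotient graph *)

Section Arcs.
Variables (R : realType) (G : groupType) (T : Gtree R G).
Local Notation d := (@mdist R T).
Local Notation proj := (@orbit_proj R G T).
Implicit Types (u v y z : T).

Lemma orbit_proj_continuous : continuous proj.
Proof. exact: (@pi_continuous T {eq_quot (same_orbit_equiv T)}%qT). Qed.

Lemma arc_param u v : u <> v -> exists c : R -> T,
  [/\ {within `[0, 1], continuous (proj \o c)}, c 0 = u, c 1 = v,
    {in `[0, 1] &, forall s t, d (c s) (c t) = d u v * `|s - t|}
    & [set y | between u y v] = c @` `[0, 1]].
Proof.
move=> uv; have D0 : 0 < d u v by rewrite mdist_gt0; exact/eqP.
have [c [c0 c1 cI cE]] :=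
  geodesic_param (gt_four_point (T := T)) (gt_geodesic (T := T)) u v.
have rescale s : s \in `[0, 1] -> d u v * s \in `[0, d u v].
  rewrite !in_itv/= => /andP[s0 s1]; rewrite mulr_ge0 ?mdist_nneg//=.
  by rewrite ler_piMr// mdist_nneg.
have iso : {in `[0, 1] &, forall s t : R,
    d (c (d u v * s)) (c (d u v * t)) = d u v * `|s - t|}.
  move=> s t sI tI; rewrite cI ?rescale// -mulrBr normrM ger0_norm//.
  exact: mdist_nneg.
exists (fun s => c (d u v * s)); split=> //.
- have ctn : {within `[0, 1], continuous (fun s => c (d u v * s))}.
    apply: (@lipschitz_continuous_within _ _ _ _ (d u v)) => s t sI tI.
    by rewrite iso// inE.
  apply/subspace_continuousP => s sI; move/subspace_continuousP: ctn => ctn.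
  exact: cvg_comp (ctn s sI) (@orbit_proj_continuous (c (d u v * s))).
- by rewrite mulr0.
- by rewrite mulr1.
- rewrite cE; apply/seteqP; split=> [_ [t tI <-]|_ [s sI <-]].
    exists (t / d u v); last by rewrite mulrC divfK// gt_eqF.
    move: tI; rewrite /= !in_itv/= => /andP[t0 t1].
    by rewrite divr_ge0 ?(ltW D0)// ler_pdivrMr// mul1r.
  by exists (d u v * s) => //; exact: rescale.
Qed.

Lemma arc_segment u v : u <> v ->
  (forall y z, between u y v -> between u z v -> proj y = proj z -> y = z) ->
  segment R (proj @` [set y | between u y v]) (proj u) (proj v).
Proof.
move=> uv inj; have [c [cc c0 c1 cI cE]] := arc_param uv.
have D0 : 0 < d u v by rewrite mdist_gt0; exact/eqP.
have cb s : s \in `[0, 1] -> between u (c s) v.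
  by move=> sI; rewrite -[between _ _ _]/([set y | between u y v] (c s)) cE;
    exists s.
exists (proj \o c); split=> //=.
- move=> s t; rewrite !inE => sI tI /inj -/(_ (cb s sI) (cb t tI)) E.
  have := cI s t sI tI; rewrite E mdist_refl => /esym/eqP.
  by rewrite mulf_eq0 gt_eqF//= normr_eq0 subr_eq0 => /eqP.
- by rewrite c0.
- by rewrite c1.
- by rewrite cE image_comp.
Qed.

Lemma arc_loop u v : u <> v -> proj u = proj v ->
  (forall y z, between u y v -> between u z v -> y <> v -> z <> v ->
    proj y = proj z -> y = z) ->
  simple_loop R (proj @` [set y | between u y v]).
Proof.
move=> uv puv inj; have [c [cc c0 c1 cI cE]] := arc_param uv.
have D0 : 0 < d u v by rewrite mdist_gt0; exact/eqP.
have I1 : 1 \in `[0, 1 : R] by rewrite in_itv/= lexx ler01.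
have sub (s : R) : `[0, 1[%classic s -> s \in `[0, 1] /\ s <> 1.
  rewrite /= !in_itv/= => /andP[s0 s1]; rewrite s0 ltW//; split=> //.
  by move=> sE; rewrite sE ltxx in s1.
have cb s : s \in `[0, 1] -> between u (c s) v.
  by move=> sI; rewrite -[between _ _ _]/([set y | between u y v] (c s)) cE;
    exists s.
have eqc s t : s \in `[0, 1] -> t \in `[0, 1] -> c s = c t -> s = t.
  move=> sI tI E; have := cI s t sI tI; rewrite E mdist_refl => /esym/eqP.
  by rewrite mulf_eq0 gt_eqF//= normr_eq0 subr_eq0 => /eqP.
exists (proj \o c); split=> //=.
- by rewrite c0 c1.
- move=> s t /set_mem/sub[sI s1] /set_mem/sub[tI t1] E; apply: (eqc s t) => //.
  apply: inj => //; [exact: cb|exact: cb| |]; rewrite -c1 => /eqc E1.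
    by apply: s1; apply: E1.
  by apply: t1; apply: E1.
- by rewrite cE image_comp.
Qed.

End Arcs.

(** * Legal paths and their projections *)

Section LegalPaths.
Variables (R : realType) (G : groupType) (A B : Gtree R G).
Local Notation dA := (@mdist R A).
Local Notation dB := (@mdist R B).
Local Notation V := (vertices A).
Local Notation adj := (Defs.adjacent (vertices A) (edges A)).
Local Notation proj := (@orbit_proj R G A).
Variables (f : A -> B) (r : R).
Hypotheses (fe : equivariant f) (r_gt0 : 0 < r).
Implicit Types (u v w x y : A) (g h : G) (e l : A * A) (s : seq (A * A)).

Definition tense_edge e : bool := adj e.1 e.2 && tense f r e.1 e.2.

Definition legal_turn e e' : bool :=
  `[< e.2 = e'.1 /\ between (f e.1) (f e.2) (f e'.2) >].

Definition act_edge g e : A * A := (act g e.1, act g e.2).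

Definition flip e : A * A := (e.2, e.1).

(** Carrying the first edge [e] and the last edge [l] as arguments lets paths be concatenated,
    reversed and translated without recomputing their ends. *)
Definition legal s e l : Prop := exists2 es, s = e :: es &
  [/\ all tense_edge s, path legal_turn e es & last e es = l].

Definition trace s : set (quotient_graph A) :=
  [set q | exists2 e, e \in s & exists2 y, between e.1 y e.2 & proj y = q].

Lemma tense_adj e : tense_edge e -> adj e.1 e.2. Proof. by case/andP. Qed.

Lemma tense_neq e : tense_edge e -> f e.1 <> f e.2.
Proof.
move=> /andP[/adj_gt0 e0 /eqP E] fE; move: E; rewrite fE mdist_refl => /esym/eqP.
by rewrite mulf_eq0 !gt_eqF.
Qed.

Lemma tense_flip e : tense_edge (flip e) = tense_edge e.
Proof.
rewrite /tense_edge /tense /= (mdistC (f e.2)) (mdistC e.2); congr andb.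
by apply/idP/idP; exact: adj_sym.
Qed.

Lemma tense_act g e : tense_edge (act_edge g e) = tense_edge e.
Proof.
rewrite /tense_edge act_adj /=; case: (boolP (adj e.1 e.2)) => //= uv.
by have [V1 V2] := adj_V uv; rewrite /tense !fe// !gt_isometry.
Qed.

Lemma flipK e : flip (flip e) = e. Proof. by case: e. Qed.

Lemma legal_turn_flip e e' : legal_turn e e' -> legal_turn (flip e') (flip e).
Proof.
move=> /asboolP[E b]; apply/asboolP; split=> //=; rewrite -E; exact: between_sym.
Qed.

Lemma legal_turn_act g e e' : tense_edge e -> tense_edge e' ->
  legal_turn e e' -> legal_turn (act_edge g e) (act_edge g e').
Proof.
move=> /tense_adj te /tense_adj te' /asboolP[E b].
have [? ?] := adj_V te; have [? ?] := adj_V te'.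
apply/asboolP; split; first by rewrite /= E.
by rewrite /= !fe//; apply/act_between.
Qed.

Lemma legal_tense s e l e' : legal s e l -> e' \in s -> tense_edge e'.
Proof. by case=> es _ [/allP H _ _]; exact: H. Qed.

Lemma legal_head s e l : legal s e l -> e \in s.
Proof. by case=> es -> _; exact: mem_head. Qed.

Lemma legal_last s e l : legal s e l -> l \in s.
Proof. by case=> es -> [_ _ <-]; exact: mem_last. Qed.

Lemma legal1 e : tense_edge e -> legal [:: e] e e.
Proof. by move=> te; exists [::]; rewrite //= te. Qed.

Lemma legal_cat s1 s2 e1 l1 e2 l2 : legal s1 e1 l1 -> legal s2 e2 l2 ->
  legal_turn l1 e2 -> legal (s1 ++ s2) e1 l2.
Proof.
move=> [t1 E1 [a1 p1 la1]] [t2 E2 [a2 p2 la2]] t12.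
exists (t1 ++ s2); first by rewrite E1.
split; first by rewrite all_cat a1 a2.
  by rewrite cat_path p1 E2 /= la1 t12 p2.
by rewrite last_cat E2 /= la2.
Qed.

Lemma legal_act g s e l : legal s e l ->
  legal (map (act_edge g) s) (act_edge g e) (act_edge g l).
Proof.
move=> [t -> [a p <-]]; exists (map (act_edge g) t) => //; split.
- by rewrite all_map; apply: sub_all a => e' /=; rewrite tense_act.
- elim: t e a p => //= e' t IH e /and3P[te te' a] /andP[ee' p].
  by rewrite legal_turn_act//= IH//= te'.
- by rewrite last_map.
Qed.

Lemma legal_rev s e l : legal s e l -> legal (rev (map flip s)) (flip l) (flip e).
Proof.
move=> [t -> [a p <-]]; elim: t e a p => [|e' t IH] e /=.
  by move=> /andP[te _] _; apply: legal1; rewrite tense_flip.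
move=> /andP[te a] /andP[ee' p]; rewrite rev_cons -cats1.
apply: legal_cat (IH e' a p) _ (legal_turn_flip ee').
by apply: legal1; rewrite tense_flip.
Qed.

Lemma legal_split s1 e' s2 e l : legal (s1 ++ e' :: s2) e l ->
  legal (e' :: s2) e' l /\
  (s1 != [::] -> exists2 l1, legal s1 e l1 & legal_turn l1 e').
Proof.
move=> [t E [a p la]]; move: a; rewrite all_cat => /andP[a1 a2].
case: s1 E a1 => [|e1 s1] /= [E1 E2].
  by move=> _; split=> //; rewrite E1 E2 in a2 *; exists t.
move: p la; rewrite -E2 cat_path last_cat /= => /and3P[p1 t1 p2] la.
rewrite E1; move=> a1; split; first by exists s2.
by move=> _; exists (last e s1) => //; exists s1.
Qed.

Lemma legal_source s e l e' : legal s e l -> e' \in s ->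
  e'.2 = l.2 \/ e'.2 \in map fst (behead s).
Proof.
move=> [t -> [_ + <-]] /=; elim: t e => [|e1 t IH] e /=.
  by rewrite inE => _ /eqP->; left.
move=> /andP[/asboolP[E _] p]; rewrite inE => /orP[/eqP->|/(IH _ p)[->|H]].
- by right; rewrite E inE eqxx.
- by left.
- by right; rewrite inE H orbT.
Qed.

(** A legal turn cannot backtrack, since its image would; so consecutive edges are aligned in A as
    well as in B, and [turns_path] applies in both trees. *)
Lemma legal_geodesic s e l : legal s e l ->
  [/\ dA e.1 l.2 = \sum_(e' <- s) elen e',
    dB (f e.1) (f l.2) = r * dA e.1 l.2
    & forall y, between e.1 y l.2 <-> exists2 e', e' \in s & between e'.1 y e'.2].
Proof.
move=> [t -> [a p <-]]; have /allP at' := a.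
have neq e' : e' \in e :: t -> e'.1 <> e'.2 by move=> /at'/tense_adj/adj_neq.
have neqB e' : e' \in e :: t -> f e'.1 <> f e'.2 by move=> /at'; exact: tense_neq.
have e12 : e.1 <> e.2 by apply: neq; rewrite mem_head.
have t12 e' : e' \in t -> e'.1 <> e'.2 by move=> et; apply: neq;
  rewrite inE et orbT.
have pA : path (@turns R A) e t.
  elim: t e a p {at' neq neqB e12 t12} => //= e' t IH e /andP[te a] /andP[ee' p].
  rewrite IH//= andbT; move/asboolP: ee' => [E b]; apply/asboolP; split=> //.
  have := a; rewrite /= => /andP[te' _].
  apply: (gt_neighbours (v := e.2)).
  - exact/adj_sym/tense_adj.
  - by rewrite E; exact: tense_adj.
  - move=> E'; move: b; rewrite /between -E' mdist_refl (mdistC (f e.2)).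
    have := tense_neq te => /eqP; rewrite -mdist_gt0; lra.
pose fF (e' : A * A) := (f e'.1, f e'.2).
have pB : path (@turns R B) (fF e) (map fF t).
  elim: t e a p {at' neq neqB e12 t12 pA} => //= e' t IH e /andP[te a] /andP[ee' p].
  rewrite IH//= andbT; move/asboolP: ee' => [E b]; apply/asboolP; split=> //=.
  by rewrite E.
have [dAE _] := turns_path (gt_four_point (T := A)) e12 t12 pA.
have [|e' /mapP[e'' e''t ->]|dBE _] := turns_path (gt_four_point (T := B)) _ _ pB.
- by apply: neqB; rewrite mem_head.
- by apply: neqB; rewrite inE e''t orbT.
split=> //; last by move=> y;
  exact: (turns_path_between (gt_four_point (T := A))).
move: dBE; rewrite last_map /= => ->; rewrite dAE -map_cons.
rewrite big_map mulr_sumr big_seq [RHS]big_seq; apply: eq_bigr => e' /at'.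
by move=> /andP[_ /eqP].
Qed.

Lemma legal_gt0 s e l : legal s e l -> 0 < dA e.1 l.2.
Proof.
move=> H; have [-> _ _] := legal_geodesic H;
  have e0 := tense_adj (legal_tense H (legal_head H)).
have [t -> _] := H; rewrite big_cons; apply: ltr_wpDr; last exact: adj_gt0 e0.
by apply: sumr_ge0 => e' _; exact: mdist_nneg.
Qed.

Lemma legal_trace s e l : legal s e l ->
  proj @` [set y | between e.1 y l.2] = trace s.
Proof.
move=> H; have [_ _ Hb] := legal_geodesic H.
apply/seteqP; split=> [_ [y /Hb[e' e's yb] <-]|_ [e' e's [y yb <-]]].
  by exists e' => //; exists y.
by exists y => //; apply/Hb; exists e'.
Qed.

(** The path followed by its translate is legal, so the first vertex and its images under [g] and
    its square are aligned in A, and likewise their images in B. Hence [g] is a translation of both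
    trees. *)
Lemma closed_legal_path s e l g : legal s e l -> legal_turn l (act_edge g e) ->
  exists L : set A, [/\ hyperbolic A g,
    translation_length B g / translation_length A g = r, is_axis g L
    & proj @` L = trace s].
Proof.
move=> H t12; have lg : l.2 = act g e.1 by move/asboolP: t12 => [].
have H2 := legal_cat H (legal_act g H) t12.
have [d1 d1B Hb] := legal_geodesic H; have [d2 d2B _] := legal_geodesic H2.
have p0 := legal_gt0 H.
have [Ve _] := adj_V (tense_adj (legal_tense H (legal_head H))).
have sumg : \sum_(e' <- map (act_edge g) s) elen e' = \sum_(e' <- s) elen e'.
  by rewrite big_map; apply: eq_bigr => e' _; rewrite /elen /= gt_isometry.
rewrite big_cat /= sumg -d1 lg in d2.
rewrite lg in p0 d1 d1B; rewrite /= lg in d2B.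
have bA : between e.1 (act g e.1) (act g (act g e.1)).
  by rewrite /between gt_isometry d2.
rewrite !fe// in d1B d2B; last exact: gt_vertices.
have pB : 0 < dB (f e.1) (act g (f e.1)) by rewrite d1B mulr_gt0.
have bB : between (f e.1) (act g (f e.1)) (act g (act g (f e.1))).
  by rewrite /between gt_isometry d2B d1B d2 mulrDr.
have [L [axL L1 L2]] := axis_of_translation (gt_four_point (T := A))
  (gt_geodesic (T := A)) p0 bA.
exists L; split=> //.
- by move=> y; exact: (hyperbolic_translation (gt_four_point (T := A)) p0 bA).
- rewrite (translation_length_translation (gt_four_point (T := A)) p0 bA).
  rewrite (translation_length_translation (gt_four_point (T := B)) pB bB).
  by rewrite d1B mulfK// gt_eqF.
- rewrite -(legal_trace H) lg; apply/seteqP; split=> [_ [y /L2[h hb] <-]|].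
    by exists (act h y) => //; rewrite orbit_proj_act.
  by move=> _ [y /L1 yb <-]; exists y.
Qed.

End LegalPaths.

Lemma uniq_map_inj (T1 T2 : eqType) (h : T1 -> T2) (s : seq T1) :
  uniq (map h s) -> {in s &, injective h}.
Proof.
elim: s => //= a s IH /andP[ha us] x y.
rewrite !inE => /orP[/eqP->|xs] /orP[/eqP->|ys] // E.
- by move: ha; rewrite E map_f.
- by move: ha; rewrite -E map_f.
- exact: IH.
Qed.

(** * Projections of legal paths to the quotient graph *)

Section Shapes.
Variables (R : realType) (G : groupType) (A B : Gtree R G).
Local Notation dA := (@mdist R A).
Local Notation V := (vertices A).
Local Notation adj := (Defs.adjacent (vertices A) (edges A)).
Local Notation proj := (@orbit_proj R G A).
Variables (f : A -> B) (r : R).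
Local Notation legal := (legal f r).
Local Notation legal_turn := (legal_turn f).
Hypotheses (fe : equivariant f) (r_gt0 : 0 < r).
Hypothesis edgeA : forall e, edges A e -> edge_stabilizer e = [set 1%g].
Implicit Types (u v w x y : A) (g h : G) (e l : A * A) (s : seq (A * A)).

Definition free_point u : Prop := forall g, act g u = u -> g = 1%g.

Definition starts s : seq A := [seq orbit_repr e.1 | e <- s].

Lemma trace_cat s1 s2 : trace (s1 ++ s2) = trace s1 `|` trace s2.
Proof.
apply/seteqP; split=> [q [e]|q [] [e es H]].
- by rewrite mem_cat => /orP[] es H; [left|right]; exists e.
- by exists e; rewrite // mem_cat es.
- by exists e; rewrite // mem_cat es orbT.
Qed.

Lemma trace_act g s : trace (map (act_edge g) s) = trace s.
Proof.
apply/seteqP; split=> [q [_ /mapP[e es ->] [y yb yq]]|q [e es [y yb yq]]].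
  exists e => //; exists (act g^-1%g y); last by rewrite orbit_proj_act.
  by move: yb => /= yb; apply/(act_between g); rewrite actVK.
exists (act_edge g e); first exact: map_f.
by exists (act g y); [exact/act_between|rewrite orbit_proj_act].
Qed.

Lemma trace_rev s : trace (rev (map (@flip R G A) s)) = trace s.
Proof.
apply/seteqP; split=> [q [e]|q [e es [y yb yq]]].
  rewrite mem_rev => /mapP[e' es ->] [y yb yq]; exists e' => //; exists y => //.
  exact: between_sym.
exists (flip e); first by rewrite mem_rev map_f.
by exists y => //; exact: between_sym.
Qed.

Lemma trace_vertex s e : e \in s -> trace s (proj e.1) /\ trace s (proj e.2).
Proof.
move=> es; split; exists e => //.
  by exists e.1 => //; exact: between_refl.
by exists e.2 => //; exact: between_reflr.
Qed.

Lemma ends_in s e l e' : legal s e l -> e' \in s ->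
  e'.1 \in map fst s /\ (e'.2 = l.2 \/ e'.2 \in map fst s).
Proof.
move=> H e's; split; first exact: map_f.
case: (legal_source H e's) => [->|H1]; [by left|right].
by case: s H1 {H e's} => //= a s H1; rewrite inE H1 orbT.
Qed.

(** An interior point determines its edge, so two points with the same projection are either both
    vertices or come with an identification of their edges, possibly reversed. *)
Lemma projected_edges e e' y z : adj e.1 e.2 -> adj e'.1 e'.2 ->
  between e.1 y e.2 -> between e'.1 z e'.2 -> proj y = proj z ->
  (exists a b, [/\ a = e.1 \/ a = e.2, b = e'.1 \/ b = e'.2,
     orbit_repr a = orbit_repr b & y = a /\ z = b]) \/
  exists2 g, act g y = z & act_edge g e = e' \/ act_edge g e = flip e'.
Proof.
move=> ae ae' yb zb /orbit_projP[g gE].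
have [Vy|nVy] := pselect (V y).
  left; exists y, z; split=> //.
  - exact: (adj_between_vertex ae Vy yb).
  - apply: (adj_between_vertex ae' _ zb); rewrite -gE; exact: gt_vertices.
  - by apply/orbit_reprP; exists g.
right; exists g => //.
have ga : adj (act g e.1) (act g e.2) by rewrite act_adj.
have gb : between (act g e.1) z (act g e.2) by rewrite -gE; exact/act_between.
have nVz : ~ V z by rewrite -gE => /act_vertices.
case: (adj_between_inner ae' ga zb gb nVz) => -[E1 E2]; [left|right].
  by rewrite /act_edge E1 E2 -surjective_pairing.
by rewrite /act_edge E1 E2.
Qed.

Lemma equivalent_edge_fixed g e : adj e.1 e.2 ->
  act_edge g e = e \/ act_edge g e = flip e -> g = 1%g.
Proof.
move=> ae H; apply: (act_edge_eq1 edgeA ae).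
by case: H => E; [left|right]; (split; [exact: (congr1 fst E)|exact: (congr1 snd E)]).
Qed.

Lemma edges_inj (W : seq A) e e' y z : {in W &, injective (@orbit_repr R G A)} ->
  adj e.1 e.2 -> adj e'.1 e'.2 -> e.1 \in W -> e.2 \in W -> e'.1 \in W -> e'.2 \in W ->
  between e.1 y e.2 -> between e'.1 z e'.2 -> proj y = proj z -> y = z.
Proof.
move=> inj ae ae' W1 W2 W3 W4 yb zb pyz.
case: (projected_edges ae ae' yb zb pyz) => [[a [b [aE bE ab [-> ->]]]]|[g gE eq]].
  by apply: inj => //; [case: aE => ->|case: bE => ->].
have -> : z = y; last by [].
rewrite -gE; have -> : g = 1%g; last exact: gt_act1.
apply: (equivalent_edge_fixed ae).
have red u v : u \in W -> v \in W -> act g u = v -> u = v.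
  by move=> uW vW gu; apply: inj => //; apply/orbit_reprP; exists g.
left; case: eq => E; rewrite E.
  have E1 := red _ _ W1 W3 (congr1 fst E);
    have E2 := red _ _ W2 W4 (congr1 snd E).
  by rewrite [LHS]surjective_pairing -E1 -E2 -surjective_pairing.
have E1 := red _ _ W1 W4 (congr1 fst E); have E2 := red _ _ W2 W3 (congr1 snd E).
by rewrite /flip -E1 -E2 -surjective_pairing.
Qed.

Lemma legal_segment s e l : legal s e l ->
  uniq (rcons (starts s) (orbit_repr l.2)) -> segment R (trace s) (proj e.1) (proj l.2).
Proof.
move=> H u; have p0 := legal_gt0 r_gt0 H.
have [_ _ Hb] := legal_geodesic r_gt0 H.
rewrite -(legal_trace r_gt0 H); apply: arc_segment.
  by apply/eqP; rewrite -mdist_gt0.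
move=> y z /Hb[e1 e1s yb] /Hb[e2 e2s zb].
have inj : {in rcons (map fst s) l.2 &, injective (@orbit_repr R G A)}.
  by apply: uniq_map_inj; rewrite map_rcons -map_comp.
have inW e' : e' \in s -> e'.1 \in rcons (map fst s) l.2 /\ e'.2 \in rcons (map fst s) l.2.
  move=> e's; have [H1 H2] := ends_in H e's; rewrite !mem_rcons !inE H1 orbT.
  by split=> //; case: H2 => ->; rewrite ?eqxx ?orbT.
have [? ?] := inW _ e1s; have [? ?] := inW _ e2s.
have ad e' : e' \in s -> adj e'.1 e'.2 by move=> /(legal_tense H)/tense_adj.
exact: (edges_inj inj (ad _ e1s) (ad _ e2s)).
Qed.

(** Freeness of the inner vertices excludes a fold: an edge followed by the image of its reverse
    under a stabilizer element of the middle vertex may also have starts in distinct orbits, and it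
    closes up, yet it projects to a single edge traversed twice. *)
Lemma legal_loop s e l : legal s e l -> uniq (starts s) ->
  orbit_repr l.2 = orbit_repr e.1 ->
  (forall e', e' \in behead s -> free_point e'.1) -> simple_loop R (trace s).
Proof.
move=> H us le fr; have p0 := legal_gt0 r_gt0 H.
have [_ _ Hb] := legal_geodesic r_gt0 H.
have el : e.1 <> l.2 by apply/eqP; rewrite -mdist_gt0.
rewrite -(legal_trace r_gt0 H); apply: arc_loop => //.
  by apply/orbit_projP/orbit_reprP.
have inj : {in map fst s &, injective (@orbit_repr R G A)}.
  by apply: uniq_map_inj; rewrite -map_comp.
have ad e' : e' \in s -> adj e'.1 e'.2 by move=> /(legal_tense H)/tense_adj.
have eW : e.1 \in map fst s by exact/map_f/(legal_head H).
have frW w : w \in map fst s -> w = e.1 \/ free_point w.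
  have [t E _] := H; rewrite E /= inE => /orP[/eqP|/mapP[e' e't ->]];
    first by left.
  by right; apply: fr; rewrite E.
have red g u v : u \in map fst s -> v \in map fst s -> act g u = v -> u = v.
  by move=> uW vW gu; apply: inj => //; apply/orbit_reprP; exists g.
have redl g u : u \in map fst s -> act g u = l.2 -> u = e.1.
  by move=> uW gu; apply: inj => //; rewrite -le -gu orbit_repr_act.
(* This rules out that an edge arriving at the final vertex [l.2] is a translate, possibly reversed,
   of an edge arriving at an earlier vertex: the fold mentioned above. *)
have mixed g e1 e2 : e1 \in s -> e2 \in s -> e1.2 \in map fst s -> e2.2 = l.2 ->
    act_edge g e1 = e2 \/ act_edge g e1 = flip e2 -> False.
  move=> e1s e2s W12 e2l; have W11 := map_f fst e1s; have W21 := map_f fst e2s.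
  have neq := adj_neq (ad _ e1s).
  case=> E.
    have E1 := red g _ _ W11 W21 (congr1 fst E).
    have gE2 : act g e1.2 = l.2 by rewrite -e2l; exact: (congr1 snd E).
    have E2 := redl g _ W12 gE2.
    case: (frW _ W11) => [e1e|fr1]; first by apply: neq; rewrite e1e E2.
    have g1 : g = 1%g by apply: fr1; rewrite {2}E1; exact: (congr1 fst E).
    by apply: el; rewrite -gE2 g1 gt_act1 E2.
  have gE1 : act g e1.1 = l.2 by rewrite -e2l; exact: (congr1 fst E).
  have E1 := redl g _ W11 gE1.
  have E2 := red g _ _ W12 W21 (congr1 snd E).
  case: (frW _ W12) => [e1e|fr1]; first by apply: neq; rewrite e1e E1.
  have g1 : g = 1%g by apply: fr1; rewrite {2}E2; exact: (congr1 snd E).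
  by apply: el; rewrite -gE1 g1 gt_act1 E1.
move=> y z /Hb[e1 e1s yb] /Hb[e2 e2s zb] yl zl pyz.
have [W11 W12] := ends_in H e1s; have [W21 W22] := ends_in H e2s.
case: (projected_edges (ad _ e1s) (ad _ e2s) yb zb pyz) => [|[g gE eq]].
  move=> [a [b [aE bE ab [yE zE]]]]; rewrite yE zE; apply: inj => //.
    case: aE yE => -> yE //; case: W12 => // E; by case: yl; rewrite yE E.
  case: bE zE => -> zE //; case: W22 => // E; by case: zl; rewrite zE E.
have g1 : g = 1%g -> y = z by move=> g1; rewrite -gE g1 gt_act1.
case: W12 W22 => [l1|W12] [l2|W22].
- apply: g1; apply: (equivalent_edge_fixed (ad _ e1s)).
  case: eq => E.
    left; rewrite E; have E1 := red g _ _ W11 W21 (congr1 fst E).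
    by rewrite [LHS]surjective_pairing [RHS]surjective_pairing E1 l1 l2.
  have gE1 : act g e1.1 = l.2 by rewrite -l2; exact: (congr1 fst E).
  have E1 := redl g _ W11 gE1.
  have gE2 : act g^-1%g e2.1 = l.2.
    by rewrite -l1 -(congr1 snd E : act g e1.2 = e2.1) actK.
  have E2 := redl _ _ W21 gE2.
  by right; rewrite E /flip l1 l2 E1 E2.
- exfalso; apply: (mixed g^-1%g e2 e1 e2s e1s W22 l1); case: eq => E.
    by left; rewrite -E /act_edge /= !actK -surjective_pairing.
  right; rewrite /act_edge /flip.
  by rewrite -(congr1 fst E : act g e1.1 = e2.2) -(congr1 snd E : act g e1.2 = e2.1) !actK.
- by exfalso; apply: (mixed g e1 e2 e1s e2s W12 l2).
- exact: (edges_inj inj (ad _ e1s) (ad _ e2s)).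
Qed.

Lemma touching_starts s e l e' a : legal s e l -> e' \in s -> a = e'.1 \/ a = e'.2 ->
  orbit_repr a \in rcons (starts s) (orbit_repr l.2).
Proof.
move=> H e's aE; rewrite mem_rcons inE.
have st w : w \in map fst s -> orbit_repr w \in starts s.
  by move=> /mapP[e'' e''s ->]; apply/mapP; exists e''.
have [H1 H2] := ends_in H e's; case: aE => ->; first by rewrite st ?orbT.
by case: H2 => [->|/st ->]; rewrite ?eqxx ?orbT.
Qed.

Lemma trace_cap s1 e1 l1 s2 e2 l2 q : legal s1 e1 l1 -> legal s2 e2 l2 ->
  (forall e e' g, e \in s1 -> e' \in s2 -> orbit_repr e.1 = orbit_repr e'.1 \/
     orbit_repr e.1 = orbit_repr e'.2 ->
     act_edge g e = e' \/ act_edge g e = flip e' -> False) ->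
  trace s1 q -> trace s2 q ->
  exists a, [/\ q = proj a, orbit_repr a \in rcons (starts s1) (orbit_repr l1.2)
    & orbit_repr a \in rcons (starts s2) (orbit_repr l2.2)].
Proof.
move=> H1 H2 ne [e es [y yb <-]] [e' es' [z zb /esym zq]].
have ae : adj e.1 e.2 := tense_adj (legal_tense H1 es).
have ae' : adj e'.1 e'.2 := tense_adj (legal_tense H2 es').
case: (projected_edges ae ae' yb zb zq) => [[a [b [aE bE ab [-> zE]]]]|[g _ eq]].
  exists a; split=> //; first exact: touching_starts H1 es aE.
  rewrite ab; exact: touching_starts H2 es' bE.
exfalso; apply: (ne e e' g) => //; case: eq => E; [left|right].
  by apply/orbit_reprP; exists g; exact: (congr1 fst E).
by apply/orbit_reprP; exists g; exact: (congr1 fst E).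
Qed.

Lemma equivalent_edges_repr e e' g : act_edge g e = e' \/ act_edge g e = flip e' ->
  (orbit_repr e.1 = orbit_repr e'.1 /\ orbit_repr e.2 = orbit_repr e'.2) \/
  (orbit_repr e.1 = orbit_repr e'.2 /\ orbit_repr e.2 = orbit_repr e'.1).
Proof.
by case=> E; [left|right]; (split; apply/orbit_reprP; exists g;
  [exact: (congr1 fst E)|exact: (congr1 snd E)]).
Qed.

Lemma segment_edge_repr s e l e' : legal s e l ->
  uniq (rcons (starts s) (orbit_repr l.2)) -> e' \in s ->
  orbit_repr e'.1 <> orbit_repr e'.2.
Proof.
move=> H u e's E; apply: (adj_neq (tense_adj (legal_tense H e's))).
have inj : {in rcons (map fst s) l.2 &, injective (@orbit_repr R G A)}.
  by apply: uniq_map_inj; rewrite map_rcons -map_comp.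
have [H1 H2] := ends_in H e's; apply: inj => //;
  rewrite mem_rcons inE ?H1 ?orbT//.
by case: H2 => ->; rewrite ?eqxx ?orbT.
Qed.

Lemma trace_cap_disjoint s1 e1 l1 s2 e2 l2 : legal s1 e1 l1 -> legal s2 e2 l2 ->
  (forall a, a \in rcons (starts s1) (orbit_repr l1.2) ->
    a \in rcons (starts s2) (orbit_repr l2.2) -> False) ->
  trace s1 `&` trace s2 = set0.
Proof.
move=> H1 H2 dis; apply/seteqP; split=> // q [q1 q2].
have [|a [_ a1 a2]] := trace_cap H1 H2 _ q1 q2; last exact: dis a1 a2.
move=> e e' g es es' E _; apply: (dis (orbit_repr e.1)).
  by apply: (touching_starts H1 es); left.
by case: E => ->; apply: (touching_starts H2 es'); [left|right].
Qed.

(** A common edge would have both its ends in the orbit of [b], whereas the ends of an edge of an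
    embedded segment lie in distinct orbits. *)
Lemma trace_cap_segment s1 e1 l1 s2 e2 l2 b : legal s1 e1 l1 -> legal s2 e2 l2 ->
  uniq (rcons (starts s2) (orbit_repr l2.2)) ->
  (forall a, a \in rcons (starts s1) (orbit_repr l1.2) ->
    a \in rcons (starts s2) (orbit_repr l2.2) -> a = orbit_repr b) ->
  trace s1 (proj b) -> trace s2 (proj b) -> trace s1 `&` trace s2 = [set proj b].
Proof.
move=> H1 H2 u com b1 b2; apply/seteqP; split=> [q [q1 q2]|_ ->//].
have [|a [-> a1 a2]] := trace_cap H1 H2 _ q1 q2; last first.
  by apply/orbit_projP/orbit_reprP; exact: com.
move=> e e' g es es' _ eq; apply: (segment_edge_repr H2 u es').
have t1 a : a = e'.1 \/ a = e'.2 ->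
    orbit_repr a \in rcons (starts s2) (orbit_repr l2.2).
  exact: touching_starts H2 es'.
have t2 a : a = e.1 \/ a = e.2 ->
    orbit_repr a \in rcons (starts s1) (orbit_repr l1.2).
  exact: touching_starts H1 es.
have [[E1 E2]|[E1 E2]] := equivalent_edges_repr eq.
  rewrite (com (orbit_repr e'.1)); first apply/esym.
  - by apply: com; [rewrite -E2; apply: t2; right|apply: t1; right].
  - by rewrite -E1; apply: t2; left.
  - by apply: t1; left.
rewrite (com (orbit_repr e'.1)); first apply/esym.
- by apply: com; [rewrite -E1; apply: t2; left|apply: t1; right].
- by rewrite -E2; apply: t2; right.
- by apply: t1; left.
Qed.

End Shapes.

(** * Loops of the five shapes *)

Section CandidateLoops.
Variables (R : realType) (G : groupType) (A B : Gtree R G).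
Local Notation V := (vertices A).
Local Notation adj := (Defs.adjacent (vertices A) (edges A)).
Local Notation proj := (@orbit_proj R G A).
Variables (f : A -> B) (r : R) (es : seq (A * A)).
Local Notation legal := (legal f r).
Local Notation legal_turn := (legal_turn f).
Local Notation tense_edge := (tense_edge f r).
Hypotheses (fe : equivariant f) (r_gt0 : 0 < r).
Hypothesis edgeA : forall e, edges A e -> edge_stabilizer e = [set 1%g].
Hypothesis edgeB : forall e, edges B e -> edge_stabilizer e = [set 1%g].
Hypothesis es_orbit : forall u v, adj u v -> exists g, (act g u, act g v) \in es.
Hypothesis gate : forall u v, free_point u -> adj u v -> tense f r u v ->
  exists w, [/\ adj u w, tense f r u w & between (f v) (f u) (f w)].
Implicit Types (u v w x y : A) (g h : G) (e l : A * A) (s : seq (A * A)).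

Definition shape (S : set (quotient_graph A)) : Prop :=
  [\/ simple_loop R S, figure_eight R S, barbell R S
    | singly_degenerate_barbell R (nonfree_vertex A) S \/
      doubly_degenerate_barbell R (nonfree_vertex A) S].

Definition realized : Prop := exists (g : G) (L : set A),
  [/\ hyperbolic A g, translation_length B g / translation_length A g = r,
    is_axis g L & shape (proj @` L)].

Let four := gt_four_point (T := B).

Lemma realized_closed s e l g : legal s e l -> legal_turn l (act_edge g e) ->
  shape (trace s) -> realized.
Proof.
move=> H t sh; have [L [H1 H2 H3 H4]] := closed_legal_path fe r_gt0 H t.
by exists g, L; split; rewrite // H4.
Qed.

Lemma realized_loop s e l g : legal s e l -> legal_turn l (act_edge g e) ->
  uniq (starts s) -> (forall e', e' \in behead s -> free_point e'.1) -> realized.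
Proof.
move=> H t us fr; apply: (realized_closed H t); apply: Or41.
apply: (legal_loop r_gt0 edgeA H us) => //.
by move/asboolP: t => [-> _]; exact: orbit_repr_act.
Qed.

(* If a path comes back to its branching point through the same gate as it
   left, then it may leave along the stem by which it first arrived. *)
Lemma hook_turn l1 e' l h : tense_edge l1 -> tense_edge e' -> legal_turn l1 e' ->
  l.2 = act h e'.1 -> ~ legal_turn l (act_edge h e') ->
  legal_turn l (act_edge h (flip l1)).
Proof.
move=> t1 t2 /asboolP[E b] lh nt; apply/asboolP; split; first by rewrite /= lh -E.
have [V1 _] := adj_V (tense_adj t1); have [V3 V4] := adj_V (tense_adj t2).
move: b; rewrite E => /(act_between h) => b; rewrite /= lh !fe//.
have [b'|b'] := between_gate four (f l.1) b; first exact: between_sym.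
by case: nt; apply/asboolP; split=> //=; rewrite lh !fe.
Qed.

Lemma nonfree_exists u : ~ free_point u -> exists2 k : G, k <> 1%g & act k u = u.
Proof.
move=> nf; apply: contrapT => H; apply: nf => g gu.
by apply: contrapT => g1; apply: H; exists g.
Qed.

(** By equivariance [k] also fixes the image of the vertex, and by [fixed_opposite] it moves every
    direction there into another gate. *)
Lemma nonfree_turn e (k : G) : tense_edge e -> k <> 1%g -> act k e.2 = e.2 ->
  legal_turn e (act_edge k (flip e)).
Proof.
move=> te s1 su; have [V1 V2] := adj_V (tense_adj te).
apply/asboolP; split; first by rewrite /= su.
rewrite /= fe//; apply: (fixed_opposite edgeB _ s1).
by rewrite -fe// su.
Qed.

Lemma nonfree_turn_source e (k : G) h : tense_edge e -> k <> 1%g ->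
  act k e.1 = e.1 -> legal_turn (act_edge h (flip e)) (act_edge (h * k)%g e).
Proof.
move=> te k1 ke; have tf : tense_edge (flip e) by rewrite tense_flip.
have T : tense_edge (act_edge k e) by rewrite tense_act.
have := nonfree_turn tf k1 ke; rewrite flipK => /(legal_turn_act fe h tf T).
by rewrite /act_edge /= !gt_actM.
Qed.

Lemma nonfree_proj u : V u -> ~ free_point u -> nonfree_vertex A (proj u).
Proof.
move=> Vu nf; exists u; split=> // E; apply: nf => g gu.
by have : stabilizer u g by []; rewrite E.
Qed.

(** The end of the last edge [l] is left unconstrained: it is where a walk may have to stop. *)
Definition walk_ok (stop : seq A) (e : A * A) (s : seq (A * A)) (l : A * A) : Prop :=
  [/\ legal (e :: s) e l,
    forall e', e' \in s -> free_point e'.1 /\ orbit_repr e'.1 \notin stop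
    & uniq (starts (e :: s))].

Lemma walk stop e : tense_edge e -> exists s l, walk_ok stop e s l /\
  [\/ ~ free_point l.2, orbit_repr l.2 \in stop
    | orbit_repr l.2 \in starts (e :: s)].
Proof.
move=> te; apply: contrapT => H.
have long n : exists s l, walk_ok stop e s l /\ size s = n.
  elim: n => [|n [s [l [[Hl fr us] sn]]]].
    by exists [::], e; split=> //; split=> //; exact: legal1.
  have lf : free_point l.2.
    by apply: contrapT => nf; apply: H; exists s, l; split=> //; apply: Or31.
  have ls : orbit_repr l.2 \notin stop.
    by apply/negP => ls; apply: H; exists s, l; split=> //; apply: Or32.
  have lr : orbit_repr l.2 \notin starts (e :: s).
    by apply/negP => lr; apply: H; exists s, l; split=> //; apply: Or33.
  have tl := legal_tense Hl (legal_last Hl).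
  have /andP[al Tl] : tense_edge (flip l) by rewrite tense_flip.
  have [w [aw Tw bw]] := gate lf al Tl.
  exists (rcons s (l.2, w)), (l.2, w); split; last by rewrite size_rcons sn.
  split.
  - rewrite -rcons_cons -cats1; apply: (legal_cat Hl).
      by apply: legal1; rewrite /tense_edge aw.
    exact/asboolP.
  - by move=> e'; rewrite mem_rcons inE => /orP[/eqP->//|]; exact: fr.
  - by rewrite -rcons_cons /starts map_rcons rcons_uniq lr.
(* The first edge [e] is not counted in [s], so the path has one start more than [es]. *)
have [s [l [[Hl _ us] sn]]] := long (size es).
have sub : {subset starts (e :: s) <= starts es}.
  move=> a /mapP[e' e's ->].
  have [g gE] := es_orbit (tense_adj (legal_tense Hl e's)).
  by rewrite -(orbit_repr_act g); apply/mapP; exists (act g e'.1, act g e'.2).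
by have := uniq_leq_size us sub; rewrite /= !size_map sn ltnn.
Qed.

Lemma starts_split v e s : orbit_repr v \in starts (e :: s) ->
  exists s1 e' s2 h, e :: s = s1 ++ e' :: s2 /\ v = act h e'.1.
Proof.
move=> /mapP[e' e's vE]; have /orbit_reprP[h hE] := esym vE.
case/splitPr: e's => s1 s2; by exists s1, e', s2, h.
Qed.

Lemma starts_cat s1 s2 : starts (s1 ++ s2) = starts s1 ++ starts s2.
Proof. exact: map_cat. Qed.

Lemma shape_lollipop s1 e1 l1 e' s2 l2 : legal s1 e1 l1 -> legal (e' :: s2) e' l2 ->
  l1.2 = e'.1 -> uniq (starts (s1 ++ e' :: s2)) ->
  uniq (rcons (starts s1) (orbit_repr l1.2)) /\
  (forall a, a \in rcons (starts (e' :: s2)) (orbit_repr e'.1) ->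
    a \in rcons (starts s1) (orbit_repr l1.2) -> a = orbit_repr e'.1).
Proof.
move=> H1 H2 E; rewrite starts_cat cat_uniq => /and3P[u1 /hasPn dis u2]; split.
  by rewrite rcons_uniq u1 andbT E; apply: dis; rewrite mem_head.
move=> a; rewrite !mem_rcons !inE E => a1; case: eqP => //= ne a2.
by move: a1 => /orP[/eqP//|/dis]; rewrite a2.
Qed.

(** If the loop does not close legally, the path goes around it, back along the stem by [hook_turn],
    and is reflected at the nonfree start: a singly degenerate barbell. *)
Lemma realized_lollipop s1 e1 l1 e' s2 l2 h : legal s1 e1 l1 ->
  legal (e' :: s2) e' l2 -> legal_turn l1 e' -> l2.2 = act h e'.1 ->
  ~ free_point e1.1 -> (forall e, e \in s2 -> free_point e.1) ->
  uniq (starts (s1 ++ e' :: s2)) -> realized.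
Proof.
move=> H1 H2 t12 lh nf fr us.
have us2 : uniq (starts (e' :: s2)) by move: us;
  rewrite starts_cat cat_uniq => /and3P[].
have [t|nt] := pselect (legal_turn l2 (act_edge h e')).
  exact: (realized_loop H2 t us2).
have te1 := legal_tense H1 (legal_head H1);
  have tl1 := legal_tense H1 (legal_last H1).
have te' := legal_tense H2 (legal_head H2).
have hk := hook_turn tl1 te' t12 lh nt.
have [s0 s01 s0e] := nonfree_exists nf.
have H3 := legal_cat (legal_cat H1 H2 t12) (legal_act fe h (legal_rev H1)) hk.
apply: (realized_closed (g := (h * s0)%g) H3).
  exact: nonfree_turn_source te1 s01 s0e.
have E : l1.2 = e'.1 by move/asboolP: t12 => [].
have [u1 com] := shape_lollipop H1 H2 E us.
rewrite !trace_cat trace_act trace_rev setUC setUA setUid setUC.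
apply: Or44; left; exists (trace (e' :: s2)), (trace s1), (proj e1.1), (proj e'.1).
have [Ve _] := adj_V (tense_adj te1).
split.
- apply: (legal_loop r_gt0 edgeA H2 us2) => //.
  by rewrite lh orbit_repr_act.
- by rewrite -E; exact: (legal_segment r_gt0 edgeA H1 u1).
- exact: nonfree_proj.
- apply: (trace_cap_segment H2 H1 u1).
  + by rewrite lh orbit_repr_act.
  + by have [] := trace_vertex (mem_head e' s2).
  + by rewrite -E; have [] := trace_vertex (legal_last H1).
- by [].
Qed.

(** A walk from a nonfree vertex closes up at its start, closes up at an inner vertex, or ends at a
    nonfree vertex of a new orbit: a loop, a lollipop or a doubly degenerate barbell. *)
Lemma realized_nonfree e : tense_edge e -> ~ free_point e.1 -> realized.
Proof.
move=> te nf; have [s [l [[Hl fr us] stop]]] := walk [::] te.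
have [s0 s01 s0e] := nonfree_exists nf; have [Ve1 Ve2] := adj_V (tense_adj te).
have [lr|lr] := boolP (orbit_repr l.2 \in starts (e :: s)).
  have [s1 [e' [s2 [h [E lE]]]]] := starts_split lr.
  case: s1 E => [[ee ss]|e1 s1 E].
    rewrite -ee in lE; have tl := legal_tense Hl (legal_last Hl).
    have [Vl1 Vl2] := adj_V (tense_adj tl).
    have frb e'' : e'' \in behead (e :: s) -> free_point e''.1 by move=> /fr[].
    suff [h' th'] : exists h', legal_turn l (act_edge h' e).
      exact: (realized_loop Hl th' us frb).
    have [t|nt] := pselect (legal_turn l (act_edge h e)); first by exists h.
    (* The reversed first edge, moved by [s0], serves as a stem of length one for [hook_turn]: if
       closing up by [h] is illegal, closing up by [h * s0] is legal. *)
    have ts : legal_turn (act_edge s0 (flip e)) e.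
      have := nonfree_turn (e := flip e) (k := s0) _ s01 s0e.
      rewrite tense_flip flipK => /(_ te)/legal_turn_flip.
      by rewrite flipK => H0; exact: H0.
    have ts0 : tense_edge (act_edge s0 (flip e)) by rewrite tense_act// tense_flip.
    exists (h * s0)%g; have := hook_turn ts0 te ts lE nt.
    by rewrite /act_edge /flip /= !gt_actM.
  have [e1E sE] : e = e1 /\ s = s1 ++ e' :: s2 by case: E.
  have [H2] := legal_split (s1 := e1 :: s1) (eq_ind _ (fun t => legal t e l) Hl _ E).
  move=> /(_ isT)[l1 H1 t1].
  apply: (realized_lollipop H1 H2 t1 lE nf).
    by move=> e'' es2; have [] := fr e''; rewrite // sE mem_cat inE es2 !orbT.
  by rewrite -E.
have nfl : ~ free_point l.2.
  by case: stop => [//||]; rewrite ?in_nil// (negPf lr).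
have [s2 s21 s2l] := nonfree_exists nfl.
have tl := legal_tense Hl (legal_last Hl); have [Vl1 Vl2] := adj_V (tense_adj tl).
(* The path is reflected at its far end by [s2] and at its start by [s0], so [s2 * s0] translates
   along the segment and back. *)
have H3 := legal_cat Hl (legal_act fe s2 (legal_rev Hl)) (nonfree_turn tl s21 s2l).
apply: (realized_closed (g := (s2 * s0)%g) H3).
  exact: nonfree_turn_source te s01 s0e.
rewrite trace_cat trace_act trace_rev setUid.
apply: Or44; right; exists (proj e.1), (proj l.2); split.
- by apply: (legal_segment r_gt0 edgeA Hl); rewrite rcons_uniq lr.
- exact: nonfree_proj.
- exact: nonfree_proj.
Qed.

Lemma no_backtracking e : tense_edge e -> between (f e.1) (f e.2) (f e.1) -> False.
Proof.
move=> /(tense_neq r_gt0)/eqP;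
  rewrite -mdist_gt0 /between mdist_refl (mdistC (f e.2)).
by move=> ? ?; lra.
Qed.

Lemma legal_snd s e l : legal s e l -> map snd s = rcons (map fst (behead s)) l.2.
Proof.
move=> [t -> [_ + <-]] /=; elim: t e => //= e' t IH e /andP[/asboolP[E _] p].
by rewrite E (IH e' p).
Qed.

Lemma starts_act g s : starts (map (act_edge g) s) = starts s.
Proof. by rewrite /starts -map_comp; apply: eq_map => e /=;
  exact: orbit_repr_act. Qed.

Lemma starts_rev e s l : legal (e :: s) e l ->
  starts (rev (map (@flip R G A) (e :: s))) = rev (rcons (starts s) (orbit_repr l.2)).
Proof.
move=> /legal_snd E; rewrite /starts map_rev; congr rev.
transitivity (map (@orbit_repr R G A) (map snd (e :: s))); last first.
  by rewrite E map_rcons -map_comp.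
by rewrite -!map_comp; apply: eq_map.
Qed.

Lemma act_edgeM g h e : act_edge (g * h)%g e = act_edge g (act_edge h e).
Proof. by rewrite /act_edge !gt_actM. Qed.

(* The remaining case: a loop [e1 :: X] whose ends lie in the same gate, and a
   walk [f0 :: ws] that leaves its base point through another gate. *)
Section SecondWalk.
Variables (e1 f0 l lw : A * A) (X ws : seq (A * A)) (h : G).
Hypothesis all_free : forall e, tense_edge e -> free_point e.1.
Hypotheses (HX : legal (e1 :: X) e1 l) (HW : legal (f0 :: ws) f0 lw).
Hypotheses (f0e1 : f0.1 = e1.1) (lh : l.2 = act h e1.1).
Hypotheses (turn_e1f0 : legal_turn (flip e1) f0) (turn_lf0 : legal_turn l (act_edge h f0)).
Hypotheses (uX : uniq (starts (e1 :: X))) (uW : uniq (starts (f0 :: ws))).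
Hypothesis disj : forall a, a \in starts ws -> a \in starts X -> False.

Let te1 : tense_edge e1. Proof. exact: legal_tense HX (mem_head _ _). Qed.
Let tf0 : tense_edge f0. Proof. exact: legal_tense HW (mem_head _ _). Qed.
Let tlw : tense_edge lw. Proof. exact: legal_tense HW (legal_last HW). Qed.
Let tl : tense_edge l. Proof. exact: legal_tense HX (legal_last HX). Qed.

Let base_notin a : a = orbit_repr e1.1 -> a \in starts X \/ a \in starts ws -> False.
Proof.
move=> -> []; first by apply/negP; move: uX => /= /andP[].
by rewrite -f0e1; apply/negP; move: uW => /= /andP[].
Qed.

Lemma legal_behead_free s e l' : legal s e l' ->
  forall e', e' \in behead s -> free_point e'.1.
Proof.
by move=> [t -> [/= /andP[_ /allP a] _ _]] e' /a; exact: all_free.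
Qed.

Lemma simple_loop_closed s e l' g : legal s e l' -> uniq (starts s) ->
  l'.2 = act g e.1 -> simple_loop R (trace s).
Proof.
move=> H u E; apply: (legal_loop r_gt0 edgeA H u);
  last exact: legal_behead_free H.
by rewrite E orbit_repr_act.
Qed.

(** Loop and walk form a theta graph. Where the walk runs into the loop, at least one of the two
    ways along it is legal; either leads to the base point, where the turn into [f0] is legal. *)
Lemma second_walk_hits_loop : orbit_repr lw.2 \in starts X -> realized.
Proof.
move=> /mapP[e2 e2X lE]; have /orbit_reprP[h2 hE] := esym lE.
case/splitPr: e2X HX uX disj => q1 q2 HX' uX' dj.
have [H2 /(_ isT)[lq H1 t12]] := legal_split (s1 := e1 :: q1) HX'.
have tlq := legal_tense H1 (legal_last H1);
  have te2 := legal_tense H2 (mem_head _ _).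
have E12 : lq.2 = e2.1 by move/asboolP: t12 => [].
have u3 : uniq (starts (e2 :: q2)) /\ uniq (rcons (starts q1) (orbit_repr e2.1)).
  move: uX'; rewrite /= starts_cat /= cat_uniq /= => /and4P[_ u1 hn /andP[u2 u3]].
  split; first by rewrite u2.
  rewrite rcons_uniq u1 andbT; apply: contra hn => ->; by [].
have sub a : a \in starts (e2 :: q2) \/ a \in rcons (starts q1) (orbit_repr e2.1) ->
    a \in starts (q1 ++ e2 :: q2).
  rewrite starts_cat mem_cat mem_rcons !inE.
  by case=> /orP[->|->]; rewrite ?orbT.
have dis a : a \in starts (q1 ++ e2 :: q2) -> a \in starts (f0 :: ws) -> False.
  move=> aX; rewrite inE f0e1 => /orP[/eqP aE|aw]; last exact: dj aw aX.
  by move: uX'; rewrite /= -aE aX.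
have [t|nt] := pselect (legal_turn lw (act_edge h2 e2)).
  have H3 := legal_cat HW (legal_act fe h2 H2) t.
  apply: (realized_loop (g := (h2 * h)%g) H3).
  - rewrite act_edgeM; apply: (legal_turn_act fe h2 tl) => //.
    by rewrite tense_act.
  - rewrite starts_cat starts_act cat_uniq.
    apply/and3P; split; [exact: uW| |exact: (proj1 u3)].
    by apply/hasPn => a aq; apply/negP => aW; apply: (dis a _ aW); apply: sub;
      left.
  - exact: legal_behead_free H3.
have hk := hook_turn tlq te2 t12 (esym hE) nt.
have H3 := legal_cat HW (legal_act fe h2 (legal_rev H1)) hk.
apply: (realized_loop (g := h2) H3).
- by apply: (legal_turn_act fe h2 _ tf0) => //; rewrite tense_flip.
- rewrite starts_cat starts_act (starts_rev H1) E12 cat_uniq rev_uniq.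
  apply/and3P; split; [exact: uW| |exact: (proj2 u3)].
  apply/hasPn => a; rewrite mem_rev => aq; apply/negP => aW.
  by apply: (dis a _ aW); apply: sub; right.
- exact: legal_behead_free H3.
Qed.

(** Two loops at one base point. If the second does not close legally, it comes back through the
    gate of [f0], so it may continue into [e1], and the figure-eight closes. *)
Lemma second_walk_returns h2 : lw.2 = act h2 f0.1 -> realized.
Proof.
move=> lwE; have [t|nt] := pselect (legal_turn lw (act_edge h2 f0)).
  exact: (realized_loop HW t uW (legal_behead_free HW)).
have tfl : tense_edge (flip e1) by rewrite tense_flip.
have := hook_turn tfl tf0 turn_e1f0 lwE nt; rewrite flipK => t2.
have H3 := legal_cat HX (legal_act fe h HW) turn_lf0.
apply: (realized_closed (g := (h * h2)%g) H3).
  by rewrite act_edgeM; apply: (legal_turn_act fe h tlw) => //; rewrite tense_act.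
rewrite trace_cat trace_act; apply: Or42.
have com a : a \in rcons (starts (e1 :: X)) (orbit_repr l.2) ->
    a \in rcons (starts (f0 :: ws)) (orbit_repr lw.2) -> a = orbit_repr e1.1.
  rewrite !mem_rcons !inE lh lwE !orbit_repr_act f0e1 orbA orbb.
  move=> /orP[/eqP//|aX]; rewrite orbA orbb => /orP[/eqP//|aw].
  by case: (disj aw aX).
exists (trace (e1 :: X)), (trace (f0 :: ws)), (proj e1.1); split=> //.
- exact: simple_loop_closed HX uX lh.
- exact: simple_loop_closed HW uW lwE.
apply/seteqP; split=> [q [q1 q2]|_ ->]; last first.
  split; first by have [] := trace_vertex (mem_head e1 X).
  by rewrite -f0e1; have [] := trace_vertex (mem_head f0 ws).
have [|a [-> a1 a2]] := trace_cap HX HW _ q1 q2; last first.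
  by apply/orbit_projP/orbit_reprP; exact: com.
(* An edge common to both loops would have its ends in the orbit of the base point. It would then be
   [e1], which would be the whole first loop, identified with [f0]; one of the turns into [f0] would
   backtrack. *)
move=> e e' g eX eW _ eq.
have c1 b : b = e.1 \/ b = e.2 ->
  orbit_repr b \in rcons (starts (e1 :: X)) (orbit_repr l.2).
  exact: touching_starts HX eX.
have c2 b : b = e'.1 \/ b = e'.2 ->
  orbit_repr b \in rcons (starts (f0 :: ws)) (orbit_repr lw.2).
  exact: touching_starts HW eW.
have [E1 E2 E3] : [/\ orbit_repr e.1 = orbit_repr e1.1,
    orbit_repr e.2 = orbit_repr e1.1 & orbit_repr e'.1 = orbit_repr e1.1].
  have [[E1 E2]|[E1 E2]] := equivalent_edges_repr eq.
    have H1 : orbit_repr e.1 = orbit_repr e1.1.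
      by apply: com; [apply: c1; left|rewrite E1; apply: c2; left].
    split=> //; last by rewrite -E1.
    by apply: com; [apply: c1; right|rewrite E2; apply: c2; right].
  have H2 : orbit_repr e.2 = orbit_repr e1.1.
    by apply: com; [apply: c1; right|rewrite E2; apply: c2; left].
  split=> //; last by rewrite -E2.
  by apply: com; [apply: c1; left|rewrite E1; apply: c2; right].
have ee1 : e = e1 by apply: (uniq_map_inj uX) => //; exact: mem_head.
have ef0 : e' = f0.
  by apply: (uniq_map_inj uW) => //; rewrite ?mem_head// f0e1.
have le1 : l = e1.
  have [t [Xt] [_ p <-]] := HX; rewrite -Xt in p *.
  case: (X) p base_notin => //= b X' /andP[/asboolP[E _] _] bn.
  by case: (bn (orbit_repr b.1)); [rewrite -E -E2 ee1|left; exact: mem_head].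
rewrite ee1 ef0 in eq; case: eq => gE.
  have g1 : g = 1%g.
    by apply: (all_free te1); rewrite -{2}f0e1; exact: (congr1 fst gE).
  move/asboolP: turn_e1f0 => [_]; rewrite -gE g1 /= gt_act1.
  by apply: (no_backtracking (e := flip e1)); rewrite tense_flip.
move/asboolP: turn_lf0 => [_]; rewrite le1 /=.
have gE1 : act g e1.1 = f0.2 by exact: (congr1 fst gE).
have gE2 : act g e1.2 = f0.1 by exact: (congr1 snd gE).
have gh : (g * h)%g = 1%g.
  by apply: (all_free te1); rewrite gt_actM -lh le1 gE2 f0e1.
have -> : act h f0.2 = e1.1; last exact: no_backtracking.
by apply: (act_inj (g := g)); rewrite -gt_actM gh gt_act1 gE1.
Qed.

(** The second walk is a lollipop. If its loop does not close legally, a barbell does: around the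
    first loop, out along the stem, around the second loop and back. *)
Lemma second_walk_hits_itself (w1 w2 : seq (A * A)) e2 h2 : ws = w1 ++ e2 :: w2 ->
  lw.2 = act h2 e2.1 -> realized.
Proof.
move=> wsE lwE; have HW' := HW; rewrite wsE in HW'.
have uW' := uW; rewrite wsE in uW'.
have [H2 /(_ isT)[l1 H1 t12]] := legal_split (s1 := f0 :: w1) HW'.
have u2 : uniq (starts (e2 :: w2)).
  by move: uW'; rewrite -cat_cons starts_cat cat_uniq => /and3P[].
have [t|nt] := pselect (legal_turn lw (act_edge h2 e2)).
  exact: (realized_loop H2 t u2 (legal_behead_free H2)).
have tl1 := legal_tense H1 (legal_last H1);
  have te2 := legal_tense H2 (mem_head _ _).
have E12 : l1.2 = e2.1 by move/asboolP: t12 => [].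
have hk := hook_turn tl1 te2 t12 lwE nt.
have H3 := legal_cat HW' (legal_act fe h2 (legal_rev H1)) hk.
have H4 := legal_cat HX (legal_act fe h H3) turn_lf0.
apply: (realized_closed (g := (h * h2)%g) H4).
  rewrite act_edgeM -!act_edgeM; apply: (legal_turn_act fe _ _ te1).
    by rewrite tense_flip.
  by have := legal_turn_flip turn_e1f0; rewrite flipK.
rewrite trace_cat trace_act -cat_cons !trace_cat trace_act trace_rev.
rewrite (setUC (_ `|` _) (trace (f0 :: w1))) (setUA (trace (f0 :: w1))) setUid setUA.
have [u1 com] := shape_lollipop (s1 := f0 :: w1) H1 H2 E12 uW'.
apply: Or43; exists (trace (e1 :: X)), (trace (e2 :: w2)), (trace (f0 :: w1)),
  (proj e1.1), (proj e2.1).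
have sub a : a \in starts (e2 :: w2) -> a \in starts ws.
  by rewrite wsE starts_cat mem_cat => ->; rewrite orbT.
have sub' a : a \in starts w1 -> a \in starts ws.
  by rewrite wsE starts_cat mem_cat => ->.
have inX a : a \in rcons (starts (e1 :: X)) (orbit_repr l.2) ->
    a = orbit_repr e1.1 \/ a \in starts X.
  rewrite mem_rcons !inE lh orbit_repr_act orbA orbb => /orP[/eqP|]; tauto.
split.
- split; first exact: simple_loop_closed HX uX lh.
  exact: simple_loop_closed H2 u2 lwE.
- apply: (trace_cap_disjoint HX H2) => a /inX aX.
  rewrite mem_rcons inE lwE orbit_repr_act => a2.
  have {}a2 : a \in starts ws.
    by apply: sub; case/orP: a2 => // /eqP->; exact: mem_head.
  case: aX => [aE|aX]; last exact: disj a2 aX.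
  by apply: (base_notin aE); right.
- by rewrite -f0e1 -E12; exact: (legal_segment r_gt0 edgeA H1 u1).
- split.
    apply: (trace_cap_segment HX H1 u1).
    + move=> a /inX[//|aX]; rewrite mem_rcons !inE E12 => a2.
      case/or3P: a2 => [/eqP aE|/eqP->|aw].
      * by case: (disj _ aX); apply: sub; rewrite aE mem_head.
      * by rewrite f0e1.
      * by case: (disj (sub' _ aw) aX).
    + by have [] := trace_vertex (mem_head e1 X).
    + by rewrite -f0e1; have [] := trace_vertex (mem_head f0 w1).
  apply: (trace_cap_segment H2 H1 u1).
  + by rewrite lwE orbit_repr_act.
  + by have [] := trace_vertex (mem_head e2 w2).
  + by rewrite -E12; have [] := trace_vertex (legal_last H1).
- by [].
Qed.

End SecondWalk.

Lemma realized_free e : (forall e, tense_edge e -> free_point e.1) ->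
  tense_edge e -> realized.
Proof.
move=> all_free te; have [s [l [[Hl _ us] stop]]] := walk [::] te.
have end_free e0 s0 l0 : legal s0 e0 l0 -> free_point l0.2.
  move=> H; have := legal_tense H (legal_last H); rewrite -tense_flip.
  exact: all_free.
have lr : orbit_repr l.2 \in starts (e :: s).
  by case: stop => // nf; case: nf; exact: end_free Hl.
have [s1 [e1 [X [h [E lE]]]]] := starts_split lr.
rewrite E in Hl us; have [HX _] := legal_split Hl.
have uX : uniq (starts (e1 :: X)).
  by move: us; rewrite starts_cat cat_uniq => /and3P[].
have [t|nt] := pselect (legal_turn l (act_edge h e1)).
  exact: (realized_loop HX t uX (legal_behead_free all_free HX)).
have te1 := legal_tense HX (mem_head _ _); have /andP[ae1 Te1] := te1.
have [w [aw Tw bw]] := gate (all_free _ te1) ae1 Te1.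
have tf0 : tense_edge (e1.1, w) by rewrite /tense_edge aw.
have turn_e1f0 : legal_turn (flip e1) (e1.1, w) by apply/asboolP.
(* As [l] comes back through the gate of [e1], it may turn into the other gate; the reverse of the
   new edge plays the stem in [hook_turn]. *)
have turn_lf0 : legal_turn l (act_edge h (e1.1, w)).
  have tff : tense_edge (flip (e1.1, w)) by rewrite tense_flip.
  have := legal_turn_flip turn_e1f0; rewrite flipK => tt.
  exact: (hook_turn tff te1 tt lE nt).
have [ws [lw [[HW dis uW] stopW]]] := walk (starts X) tf0.
have disj a : a \in starts ws -> a \in starts X -> False.
  by move=> /mapP[e' e's ->]; have [_ /negP] := dis e' e's.
case: stopW => [nf|hit|self].
- by case: nf; exact: end_free HW.
- exact: (second_walk_hits_loop all_free HX HW (erefl _) turn_e1f0 turn_lf0 uX uW disj hit).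
- have [w1 [e2 [w2 [h2 [WE lwE]]]]] := starts_split self.
  case: w1 WE => [[e2E _]|f0 w1 [_ WE]].
    rewrite -e2E in lwE.
    exact: (second_walk_returns all_free HX HW (erefl _) lE turn_e1f0 turn_lf0 uX uW
      disj lwE).
  exact: (second_walk_hits_itself all_free HX HW (erefl _) lE turn_e1f0 turn_lf0 uX uW
    disj WE lwE).
Qed.

End CandidateLoops.

Theorem theorem9p10 (R : realType) (p k : nat) (Gi : 'I_p -> groupType)
    (G : groupType) (iota : forall i, group_hom (Gi i) G) (x : 'I_k -> G)
    (hG : is_free_product iota x)
    (A B : Gtree R G)
    (hA : in_outer_space iota A) (hB : in_outer_space iota B)
    (hHyp : Hyp R iota !=set0) :
  exists (g : G) (L : set A),
    [/\ Hyp R iota g,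
        (translation_length B g / translation_length A g)%:E
          = stretch iota A B,
        is_axis g L
      & let S := @orbit_proj R G A @` L in
        [\/ simple_loop R S,
            figure_eight R S,
            barbell R S
          | singly_degenerate_barbell R (nonfree_vertex A) S \/
            doubly_degenerate_barbell R (nonfree_vertex A) S]].
Proof.
have [f [r [es [fe r0 lip orb [[u [v [uv Tuv]]] gate]]]]] :=
  train_track_exists hG hA hB hHyp.
have eA := os_C1_edges hA; have eB := os_C1_edges hB.
have te : tense_edge f r (u, v) by rewrite /tense_edge uv.
have [g [L [gh gr axL sh]]] : realized A B r.
  have [[e [tee nf]]|H] :=
      pselect (exists e : A * A, tense_edge f r e /\ ~ free_point e.1).
    exact: (realized_nonfree fe r0 eA eB orb gate tee nf).
  apply: (realized_free fe r0 eA orb gate _ te) => e tee.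
  by apply: contrapT => nf; apply: H; exists e.
exists g, L; split=> //; first by exists A.
rewrite gr; apply/le_anti/andP; split.
  by apply: ereal_sup_ubound; exists g; [exists A|rewrite gr].
apply: ge_ereal_sup => _ [g' _ <-]; rewrite lee_fin.
(* A quotient by 0 is 0 by convention, so the bound by [r] holds in the degenerate case too. *)
have [l0|l0] := ltrP 0 (translation_length A g'); first by rewrite ler_pdivrMr.
suff -> : translation_length A g' = 0 by rewrite invr0 mulr0 ltW.
by apply/le_anti; rewrite l0 translation_length_ge// => y; exact: mdist_nneg.
Qed.
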